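(* Let $C\subset\mathbb{R}^2$ be an oval and $p\in\operatorname{int}(C)$. For $j=1,2$ let $q_{p,j}(\theta)=\frac{\partial q_p(\theta)}{\partial p_j}$. Then $$\frac{\partial\mathcal E_C}{\partial p_j}(p)=-\int_0^\pi\rho_p(\theta)q_{p,j}(\theta)\,d\theta,\qquad \rho_p=q_p+q_p''.$$ Consequently every $p\in\mathcal C_{\operatorname{ART}}(C)$ of a non-centrally symmetric oval $C$ satisfies $$\int_0^\pi\rho_pq_{p,1}\,d\theta=0,\qquad \int_0^\pi\rho_pq_{p,2}\,d\theta=0.$$
   Context: An oval is a smooth ($C^\infty$), strictly convex simple closed curve $C\subset\mathbb{R}^2$ with positive curvature; $\operatorname{int}(C)$ is the open region it bounds. For $x\in C$, $\iota_C(x)\in C$ is the unique point different from $x$ whose tangent line is parallel to $T_xC$. $\Phi_C$ sends a line $\overline{xy}$ ($x\ne y\in C$) to $\overline{\iota_C(x)\iota_C(y)}$; $\Lambda_p$ is the pencil of lines through $p=(p_1,p_2)\in\operatorname{int}(C)$; $\operatorname{ART}_C(p)$ is the envelope of the line family $\Phi_C(\Lambda_p)$. Put $n(\theta)=(\cos\theta,\sin\theta)$, $\tau(\theta)=(-\sin\theta,\cos\theta)$. For each $\theta$ there is exactly one line of $\Phi_C(\Lambda_p)$ with normal $n(\theta)$, written $n(\theta)\cdot(z-p)=q_p(\theta)$, with $q_p(\theta)$ smooth in $(p,\theta)$ and $q_p(\theta+\pi)=-q_p(\theta)$; primes denote $\theta$-derivatives, and $\partial/\partial p_j$ is taken at fixed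 $\theta$. $\operatorname{ART}_C(p)$ is the closed front $X_p(\theta)=p+q_pn+q_p'\tau$, $\theta\in[0,\pi]$, with oriented area $A^*(\operatorname{ART}_C(p))=\frac12\oint[X_p,dX_p]=\frac12\int_0^\pi(q_p^2-(q_p')^2)\,d\theta$, where $[u,v]=\det(u,v)$. Energy: $\mathcal E_C(p)=-A^*(\operatorname{ART}_C(p))$ for $p\in\operatorname{int}(C)$ and $\mathcal E_C(p)=0$ for $p\in C$; $\mathcal C_{\operatorname{ART}}(C)=\operatorname*{arg\,max}_{p\in\overline{\operatorname{int}(C)}}\mathcal E_C(p)$. *)

(* Defs.v *)
From Stdlib Require Import Reals ClassicalEpsilon.
From Coquelicot Require Import Coquelicot.
Open Scope R_scope.

Definition pt : Type := (R * R)%type.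

Definition vadd (u v : pt) : pt := (fst u + fst v, snd u + snd v).
Definition vsub (u v : pt) : pt := (fst u - fst v, snd u - snd v).
Definition vscal (a : R) (u : pt) : pt := (a * fst u, a * snd u).
Definition dot (u v : pt) : R := fst u * fst v + snd u * snd v.
Definition cross (u v : pt) : R := fst u * snd v - snd u * fst v.
Definition vnorm (u : pt) : R := sqrt (dot u u).

Definition velocity (f : R -> pt) (t : R) : pt :=
  (Derive (fun u => fst (f u)) t, Derive (fun u => snd (f u)) t).
Definition acceleration (f : R -> pt) (t : R) : pt :=
  (Derive_n (fun u => fst (f u)) 2 t, Derive_n (fun u => snd (f u)) 2 t).
Definition curvature (f : R -> pt) (t : R) : R :=
  cross (velocity f t) (acceleration f t) / vnorm (velocity f t) ^ 3.

(* An oval is given by a counterclockwise regular parametrization, which every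
   such curve has; with this orientation positive curvature means that the
   curve bends to the left, and strict convexity (the curve lies on one side of
   each of its tangent lines and meets it only at the point of contact) means
   that the rest of the curve is strictly to the left of each tangent. *)
Record oval := Oval {
  gamma :> R -> pt;
  period : R;
  period_pos : 0 < period;
  gamma_periodic : forall t, gamma (t + period) = gamma t;
  gamma_simple : forall s t, 0 <= s < period -> 0 <= t < period ->
    gamma s = gamma t -> s = t;
  gamma_smooth : forall n t,
    ex_derive_n (fun u => fst (gamma u)) n t /\
    ex_derive_n (fun u => snd (gamma u)) n t;
  gamma_regular : forall t, velocity gamma t <> (0, 0);
  gamma_curvature : forall t, 0 < curvature gamma t;
  gamma_strictly_convex : forall s t, gamma s <> gamma t ->
    0 < cross (velocity gamma t) (vsub (gamma s) (gamma t))
}.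

Definition on_oval (C : oval) (z : pt) : Prop := exists t, C t = z.

Definition joined_off (C : oval) (p z : pt) : Prop :=
  exists f : R -> pt,
    (forall t, continuous f t) /\ f 0 = p /\ f 1 = z /\
    forall t, 0 <= t <= 1 -> ~ on_oval C (f t).

(* The bounded component of the complement of the curve; the complement is
   open, so its components are its path components. *)
Definition int_oval (C : oval) (p : pt) : Prop :=
  ~ on_oval C p /\ exists M, forall z, joined_off C p z -> vnorm z <= M.

Definition closure (D : pt -> Prop) (z : pt) : Prop :=
  forall eps : posreal, exists y, D y /\ ball z eps y.

Definition centrally_symmetric (C : oval) : Prop :=
  exists c, forall z, on_oval C z <-> on_oval C (vsub (vscal 2 c) z).

Definition parallel_tangents (C : oval) (x y : pt) : Prop :=
  exists s t, C s = x /\ C t = y /\ cross (velocity C s) (velocity C t) = 0.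

(* Meaningful for x on the curve. *)
Definition iota (C : oval) (x : pt) : pt :=
  epsilon (inhabits x)
    (fun y => on_oval C y /\ y <> x /\ parallel_tangents C x y).

(* Lines are represented by their sets of points. *)
Definition line_through (x y : pt) : pt -> Prop :=
  fun z => cross (vsub y x) (vsub z x) = 0.
Definition same_line (L L' : pt -> Prop) : Prop := forall z, L z <-> L' z.
Definition pencil (p : pt) (L : pt -> Prop) : Prop :=
  (exists x y, x <> y /\ same_line L (line_through x y)) /\ L p.

(* The graph of Phi_C, and the image of a family of lines. *)
Definition Phi (C : oval) (L L' : pt -> Prop) : Prop :=
  exists x y, on_oval C x /\ on_oval C y /\ x <> y /\
    same_line L (line_through x y) /\
    same_line L' (line_through (iota C x) (iota C y)).
Definition Phi_image (C : oval) (F : (pt -> Prop) -> Prop) (L' : pt -> Prop)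
  : Prop := exists L, F L /\ Phi C L L'.

Definition nvec (theta : R) : pt := (cos theta, sin theta).
Definition tauvec (theta : R) : pt := (- sin theta, cos theta).

(* For p inside the oval, the unique r such that the line
   n(theta).(z - p) = r belongs to Phi_C(Lambda_p). *)
Definition q (C : oval) (p : pt) (theta : R) : R :=
  epsilon (inhabits 0)
    (fun r => Phi_image C (pencil p)
                (fun z => dot (nvec theta) (vsub z p) = r)).

Definition rho (C : oval) (p : pt) (theta : R) : R :=
  q C p theta + Derive_n (q C p) 2 theta.

Definition q_1 (C : oval) (p : pt) (theta : R) : R :=
  Derive (fun x => q C (x, snd p) theta) (fst p).
Definition q_2 (C : oval) (p : pt) (theta : R) : R :=
  Derive (fun y => q C (fst p, y) theta) (snd p).

Definition ART (C : oval) (p : pt) (theta : R) : pt :=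
  vadd p (vadd (vscal (q C p theta) (nvec theta))
               (vscal (Derive (q C p) theta) (tauvec theta))).

Definition ART_area (C : oval) (p : pt) : R :=
  / 2 * RInt (fun theta => cross (ART C p theta) (velocity (ART C p) theta))
          0 PI.

(* Only the values on the closed region matter; the else branch contains the
   curve itself. *)
Definition energy (C : oval) (p : pt) : R :=
  if excluded_middle_informative (int_oval C p) then - ART_area C p else 0.

Definition C_ART (C : oval) (p : pt) : Prop :=
  closure (int_oval C) p /\
  forall p', closure (int_oval C) p' -> energy C p' <= energy C p.

(* Main.v *)
Require Import Defs.
From Stdlib Require Import Reals Lra Lia ZArith ClassicalEpsilon FunctionalExtensionality.
From Coquelicot Require Import Coquelicot.
Open Scope R_scope.

(** Parametrize the oval by its tangent angle. The point with parallel tangent is then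
    the one at angle phi + PI, so Phi sends the chord with endpoints at angles s, t to
    the one at s + PI, t + PI. For p inside and given theta, the image chord with
    normal n(theta) is determined by two equations in its endpoint angles: the
    original chord passes through p and the image chord is orthogonal to n(theta).
    Monotonicity of both conditions gives existence, uniqueness and continuity of the
    solution (second_spec, gap_sign, continuous_start), and the sign of the Jacobian
    (jacobian_neg) gives its derivatives, hence the regularity of q.

    Since q is antiperiodic in theta, integration by parts turns the energy into
    - 1/2 times the integral of (q + q'') q, a quadratic form whose polarization is
    symmetric (self_adjoint). Its variation is therefore minus the integral of
    (q + q'') times the variation of q, up to a quadratic remainder which is o(h)
    because q + q'' depends continuously on p (energy_derivative).

    The energy is zero on the boundary, so a point of positive energy keeps maximizers
    inside. Let O be the intersection of two diameters, that is, of chords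
    joining points with parallel tangents. By Wirtinger's inequality
    (wirtinger_rigid), an energy at most 0 at O forces q to be a combination of cos and
    sin, which says that all image lines of the pencil at O are concurrent. As Phi
    fixes diameters, their common point is O. So the chords through O are permuted by
    the antipodal map, and since the second endpoint of such a chord increases with the
    first, every chord through O is a diameter (all_diameters_through). Concurrent diameters with parallel tangents at
    their ends make the oval symmetric about O (antipode_of_diameters). Hence the
    energy of an oval that is not centrally symmetric is positive at O, its maximizers
    are interior, and they are critical points. *)

(** * Calculus on the real line *)

Lemma continuous_of_derive (f : R -> R) x l : is_derive f x l -> continuous f x.
Proof.
intros H; apply (ex_derive_continuous (K := R_AbsRing) (V := R_NormedModule)).
exists l; exact H.
Qed.

Lemma continuity_of_continuous (f : R -> R) :
  (forall x, continuous f x) -> continuity f.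
Proof.
intros H x; apply continuity_pt_filterlim; exact (H x).
Qed.

Lemma ivt_pos_neg (f : R -> R) x y :
  (forall x, continuous f x) -> x < y -> 0 < f x -> f y < 0 ->
  exists z, x < z < y /\ f z = 0.
Proof.
intros Hc xy Hx Hy.
destruct (IVT (fun z => - f z) x y) as [z [Hz Ez]]; try lra.
- apply continuity_of_continuous; intros u.
  apply (continuous_opp (V := R_NormedModule)); apply Hc.
- exists z; split; [|lra].
  split; destruct Hz as [[?|?] [?|?]]; subst; lra.
Qed.

Lemma ivt_neg_pos (f : R -> R) x y :
  (forall x, continuous f x) -> x < y -> f x < 0 -> 0 < f y ->
  exists z, x < z < y /\ f z = 0.
Proof.
intros Hc xy Hx Hy.
destruct (ivt_pos_neg (fun z => - f z) x y) as [z [Hz Ez]]; try lra.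
- intros u; apply (continuous_opp (V := R_NormedModule)); apply Hc.
- exists z; split; lra.
Qed.

(** Caratheodory's difference quotient: f is differentiable at x0 with derivative d
    exactly when this quotient, completed by d, is continuous at x0. *)
Definition slope (f : R -> R) (x0 d y : R) : R :=
  if Req_EM_T y x0 then d else (f y - f x0) / (y - x0).

Lemma slope_eq f x0 d y : f y - f x0 = slope f x0 d y * (y - x0).
Proof.
unfold slope; destruct (Req_EM_T y x0) as [->|n]; [ring|field; lra].
Qed.

Lemma slope_base f x0 d : slope f x0 d x0 = d.
Proof. unfold slope; destruct (Req_EM_T x0 x0); congruence. Qed.

Lemma locally_R (x : R) (P : R -> Prop) :
  locally x P <-> exists d : posreal, forall y : R, Rabs (y - x) < d -> P y.
Proof. reflexivity. Qed.

Lemma continuous_R (f : R -> R) (x : R) : continuous f x <->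
  forall eps : posreal, exists d : posreal,
    forall y : R, Rabs (y - x) < d -> Rabs (f y - f x) < eps.
Proof. exact (filterlim_locally f (f x)). Qed.

Lemma continuous_slope f x0 d : is_derive f x0 d -> continuous (slope f x0 d) x0.
Proof.
intros H; apply is_derive_Reals in H.
apply continuous_R; intros eps.
destruct (H eps (cond_pos eps)) as [del Hd].
exists del; intros y Hy.
rewrite slope_base; unfold slope; destruct (Req_EM_T y x0) as [->|n].
- rewrite Rminus_diag, Rabs_R0; apply cond_pos.
- specialize (Hd (y - x0)); replace (x0 + (y - x0)) with y in Hd by ring.
  apply Hd; [lra|exact Hy].
Qed.

Lemma is_derive_of_slope (f s : R -> R) x0 :
  locally x0 (fun y => f y - f x0 = s y * (y - x0)) ->
  continuous s x0 -> is_derive f x0 (s x0).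
Proof.
intros H1 Hs; apply locally_R in H1; destruct H1 as [d1 H1].
apply is_derive_Reals; intros eps He.
destruct (proj1 (continuous_R s x0) Hs (mkposreal eps He)) as [d2 H2].
assert (Hm : 0 < Rmin d1 d2) by (apply Rmin_pos; apply cond_pos).
exists (mkposreal _ Hm); intros h hn Hh; simpl in Hh.
assert (Hh1 : Rabs h < d1) by (eapply Rlt_le_trans; [exact Hh|apply Rmin_l]).
assert (Hh2 : Rabs h < d2) by (eapply Rlt_le_trans; [exact Hh|apply Rmin_r]).
assert (B1 : Rabs (x0 + h - x0) < d1).
{ replace (x0 + h - x0) with h by ring; exact Hh1. }
assert (B2 : Rabs (x0 + h - x0) < d2).
{ replace (x0 + h - x0) with h by ring; exact Hh2. }
rewrite (H1 _ B1).
replace (s (x0 + h) * (x0 + h - x0) / h) with (s (x0 + h)) by (field; exact hn).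
exact (H2 _ B2).
Qed.

Lemma derive_pos_near (f : R -> R) x l : is_derive f x l -> 0 < l ->
  exists d, 0 < d /\ forall h, 0 < h < d -> f (x - h) < f x < f (x + h).
Proof.
intros H Hl; apply is_derive_Reals in H.
destruct (H l Hl) as [d Hd]; exists d; split; [apply cond_pos|].
intros h Hh; split.
- specialize (Hd (- h)); assert (A : Rabs (- h) < d) by (rewrite Rabs_Ropp, Rabs_pos_eq; lra).
  specialize (Hd ltac:(lra) A); apply Rabs_def2 in Hd.
  assert (E : f (x - h) - f x = ((f (x + - h) - f x) / - h) * - h) by (unfold Rminus; field; lra).
  nra.
- specialize (Hd h); assert (A : Rabs h < d) by (rewrite Rabs_pos_eq; lra).
  specialize (Hd ltac:(lra) A); apply Rabs_def2 in Hd.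
  assert (E : f (x + h) - f x = ((f (x + h) - f x) / h) * h) by (field; lra).
  nra.
Qed.

Lemma critical_local_max (f : R -> R) (x l : R) : is_derive f x l -> locally x (fun y => f y <= f x) -> l = 0.
Proof.
intros D H; destruct (proj1 (locally_R x _) H) as [d Hd].
destruct (Rtotal_order l 0) as [h|[h|h]]; [exfalso|exact h|exfalso].
- destruct (derive_pos_near (fun y => - f y) x (- l)) as (e & He & N); [|lra|].
  + apply (is_derive_opp (K := R_AbsRing) (V := R_NormedModule)), D.
  + assert (P : 0 < Rmin (d / 2) (e / 2)) by (apply Rmin_pos; [generalize (cond_pos d)|]; lra).
    generalize (Rmin_l (d / 2) (e / 2)) (Rmin_r (d / 2) (e / 2)); set (m := Rmin (d / 2) (e / 2)) in *; intros M1 M2.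
    specialize (N m ltac:(lra)); specialize (Hd (x - m)).
    replace (x - m - x) with (- m) in Hd by ring; rewrite Rabs_Ropp, Rabs_pos_eq in Hd by lra.
    generalize (cond_pos d); intros; specialize (Hd ltac:(lra)); lra.
- destruct (derive_pos_near f x l D h) as (e & He & N).
  assert (P : 0 < Rmin (d / 2) (e / 2)) by (apply Rmin_pos; [generalize (cond_pos d)|]; lra).
  generalize (Rmin_l (d / 2) (e / 2)) (Rmin_r (d / 2) (e / 2)); set (m := Rmin (d / 2) (e / 2)) in *; intros M1 M2.
  specialize (N m ltac:(lra)); specialize (Hd (x + m)).
  replace (x + m - x) with m in Hd by ring; rewrite Rabs_pos_eq in Hd by lra.
  generalize (cond_pos d); intros; specialize (Hd ltac:(lra)); lra.
Qed.

Section ContinuityToolkit.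
Context {T : UniformSpace}.
Lemma locally_and (z : T) (P Q : T -> Prop) :
  locally z P -> locally z Q -> locally z (fun u => P u /\ Q u).
Proof. apply filter_and. Qed.
Lemma locally_imp (z : T) (P Q : T -> Prop) :
  (forall u, P u -> Q u) -> locally z P -> locally z Q.
Proof. apply filter_imp. Qed.
Implicit Types f g : T -> R.
Lemma cont_const (c : R) (z : T) : continuous (fun _ : T => c) z.
Proof. apply continuous_const. Qed.
Lemma cont_plus f g z : continuous f z -> continuous g z -> continuous (fun u => f u + g u) z.
Proof. apply (continuous_plus (V := R_NormedModule)). Qed.
Lemma cont_opp f z : continuous f z -> continuous (fun u => - f u) z.
Proof. apply (continuous_opp (V := R_NormedModule)). Qed.
Lemma cont_minus f g z : continuous f z -> continuous g z -> continuous (fun u => f u - g u) z.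
Proof. apply (continuous_minus (V := R_NormedModule)). Qed.
Lemma cont_mult f g z : continuous f z -> continuous g z -> continuous (fun u => f u * g u) z.
Proof. apply (continuous_mult (K := R_AbsRing)). Qed.
Lemma cont_inv f z : continuous f z -> f z <> 0 -> continuous (fun u => / f u) z.
Proof.
intros Hf n; apply (continuous_comp f Rinv); [exact Hf|].
apply (continuous_Rinv_comp (fun x => x)); [apply continuous_id|exact n].
Qed.
Lemma cont_div f g z : continuous f z -> continuous g z -> g z <> 0 ->
  continuous (fun u => f u / g u) z.
Proof. intros; apply cont_mult; [|apply cont_inv]; assumption. Qed.
Lemma cont_comp f (h : R -> R) z : continuous f z -> continuous h (f z) ->
  continuous (fun u => h (f u)) z.
Proof. intros; apply (continuous_comp f h); assumption. Qed.
Lemma cont_cos f z : continuous f z -> continuous (fun u => cos (f u)) z.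
Proof. intros; apply cont_comp; [assumption|apply continuous_cos]. Qed.
Lemma cont_sin f z : continuous f z -> continuous (fun u => sin (f u)) z.
Proof. intros; apply cont_comp; [assumption|apply continuous_sin]. Qed.

Lemma locally_pos f z : continuous f z -> 0 < f z -> locally z (fun u => 0 < f u).
Proof.
intros Hf Hp.
generalize (proj1 (filterlim_locally f (f z)) Hf (mkposreal _ Hp)).
apply filter_imp; intros u Hu.
assert (Hu' : Rabs (f u - f z) < f z) by exact Hu.
apply Rabs_def2 in Hu'; lra.
Qed.
Lemma locally_lt f g z : continuous f z -> continuous g z -> f z < g z ->
  locally z (fun u => f u < g u).
Proof.
intros Hf Hg H.
generalize (locally_pos (fun u => g u - f u) z (cont_minus _ _ _ Hg Hf)).
intros A; assert (P : 0 < g z - f z) by lra; specialize (A P); revert A.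
apply filter_imp; intros; lra.
Qed.

(** The form in which implicitly defined functions are shown to be continuous: f z
    is the place where some continuous quantity changes sign, and that quantity
    keeps its signs at two fixed places x1, x2 on both sides. *)
Lemma continuous_bracket f z :
  (forall e, 0 < e -> exists x1 x2, f z - e < x1 < f z /\ f z < x2 < f z + e /\
     locally z (fun u => x1 < f u < x2)) ->
  continuous f z.
Proof.
intros H; apply filterlim_locally; intros eps.
destruct (H eps (cond_pos eps)) as (x1 & x2 & H1 & H2 & L).
revert L; apply filter_imp; intros u Hu.
assert (A : Rabs (f u - f z) < eps) by (apply Rabs_def1; lra); exact A.
Qed.
End ContinuityToolkit.

Ltac cont_step :=
  match goal with
  | |- continuous (fun u => ?c) ?z => refine (cont_const c z)
  | |- continuous (fun u => @?f u + @?g u) ?z => refine (cont_plus f g z _ _)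
  | |- continuous (fun u => @?f u - @?g u) ?z => refine (cont_minus f g z _ _)
  | |- continuous (fun u => @?f u * @?g u) ?z => refine (cont_mult f g z _ _)
  | |- continuous (fun u => @?f u / @?g u) ?z => refine (cont_div f g z _ _ _)
  | |- continuous (fun u => - @?f u) ?z => refine (cont_opp f z _)
  | |- continuous (fun u => cos (@?f u)) ?z => refine (cont_cos f z _)
  | |- continuous (fun u => sin (@?f u)) ?z => refine (cont_sin f z _)
  | |- continuous (fun u => u) ?z => refine (continuous_id z)
  | _ => assumption
  end.

(** Implicit differentiation in two unknowns. Once the solution (a, b) is known to be
    continuous, the two equations need only be written as linear relations between
    increments with coefficients continuous at x0; Cramer's rule then exhibits
    continuous difference quotients for a and b. *)
Lemma implicit_derivative (a b u1 v1 w1 u2 v2 w2 : R -> R) (x0 : R) :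
  continuous u1 x0 -> continuous v1 x0 -> continuous w1 x0 ->
  continuous u2 x0 -> continuous v2 x0 -> continuous w2 x0 ->
  u1 x0 * v2 x0 - v1 x0 * u2 x0 <> 0 ->
  locally x0 (fun x =>
    u1 x * (a x - a x0) + v1 x * (b x - b x0) + w1 x * (x - x0) = 0 /\
    u2 x * (a x - a x0) + v2 x * (b x - b x0) + w2 x * (x - x0) = 0) ->
  is_derive a x0 ((v1 x0 * w2 x0 - w1 x0 * v2 x0) / (u1 x0 * v2 x0 - v1 x0 * u2 x0)) /\
  is_derive b x0 ((w1 x0 * u2 x0 - u1 x0 * w2 x0) / (u1 x0 * v2 x0 - v1 x0 * u2 x0)).
Proof.
intros cu1 cv1 cw1 cu2 cv2 cw2 D H.
set (det := fun x => u1 x * v2 x - v1 x * u2 x).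
assert (cd : continuous det x0).
{ apply cont_minus; apply cont_mult; assumption. }
assert (Dn : locally x0 (fun x => det x <> 0)).
{ destruct (Rdichotomy _ _ D) as [Hn|Hp].
  - generalize (locally_lt det (fun _ => 0) x0 cd (cont_const _ _) Hn).
    apply filter_imp; intros; lra.
  - generalize (locally_lt (fun _ => 0) det x0 (cont_const _ _) cd Hp).
    apply filter_imp; intros; lra. }
split.
- apply (is_derive_of_slope a (fun x => (v1 x * w2 x - w1 x * v2 x) / det x)).
  + generalize (filter_and _ _ H Dn); apply filter_imp; intros x [[E1 E2] nd].
    apply (Rmult_eq_reg_l (det x)); [|exact nd].
    transitivity ((v1 x * w2 x - w1 x * v2 x) * (x - x0)); [|field; exact nd].
    unfold det.
    replace ((u1 x * v2 x - v1 x * u2 x) * (a x - a x0)) with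
      (v2 x * (u1 x * (a x - a x0)) - v1 x * (u2 x * (a x - a x0))) by ring.
    replace (u1 x * (a x - a x0)) with (- (v1 x * (b x - b x0)) - w1 x * (x - x0)) by lra.
    replace (u2 x * (a x - a x0)) with (- (v2 x * (b x - b x0)) - w2 x * (x - x0)) by lra.
    ring.
  + apply cont_div; [|exact cd|exact D].
    apply cont_minus; apply cont_mult; assumption.
- apply (is_derive_of_slope b (fun x => (w1 x * u2 x - u1 x * w2 x) / det x)).
  + generalize (filter_and _ _ H Dn); apply filter_imp; intros x [[E1 E2] nd].
    apply (Rmult_eq_reg_l (det x)); [|exact nd].
    transitivity ((w1 x * u2 x - u1 x * w2 x) * (x - x0)); [|field; exact nd].
    unfold det.
    replace ((u1 x * v2 x - v1 x * u2 x) * (b x - b x0)) with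
      (u1 x * (v2 x * (b x - b x0)) - u2 x * (v1 x * (b x - b x0))) by ring.
    replace (v1 x * (b x - b x0)) with (- (u1 x * (a x - a x0)) - w1 x * (x - x0)) by lra.
    replace (v2 x * (b x - b x0)) with (- (u2 x * (a x - a x0)) - w2 x * (x - x0)) by lra.
    ring.
  + apply cont_div; [|exact cd|exact D].
    apply cont_minus; apply cont_mult; assumption.
Qed.

Lemma mod_period (P c x : R) : 0 < P -> exists k : Z, c <= x - IZR k * P < c + P.
Proof.
intros HP; exists (up ((x - c) / P) - 1)%Z.
destruct (archimed ((x - c) / P)) as [A B].
rewrite minus_IZR.
assert (E : x - c = (x - c) / P * P) by (field; lra).
set (y := (x - c) / P) in *; nra.
Qed.

Lemma periodic_Z {A : Type} (f : R -> A) P : (forall x, f (x + P) = f x) ->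
  forall (k : Z) x, f (x + IZR k * P) = f x.
Proof.
intros H.
assert (Hn : forall (n : nat) x, f (x + INR n * P) = f x).
{ induction n as [|n IH]; intros x; [simpl; f_equal; ring|].
  rewrite S_INR, <- (IH x), <- (H (x + INR n * P)); f_equal; ring. }
intros k x; destruct (Z_le_gt_dec 0 k) as [h|h].
- rewrite <- (Z2Nat.id k) by lia; rewrite <- INR_IZR_INZ; apply Hn.
- rewrite <- (Hn (Z.to_nat (- k)) (x + IZR k * P)).
  f_equal; rewrite INR_IZR_INZ, Z2Nat.id by lia; rewrite opp_IZR; ring.
Qed.

(** * Closed curves parametrized by the tangent angle *)

Lemma increasing_of_derive (f df : R -> R) a b : a < b ->
  (forall x, a <= x <= b -> is_derive f x (df x)) ->
  (forall x, a < x < b -> 0 < df x) -> f a < f b.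
Proof.
intros ab Hd Hp.
destruct (MVT_cor2 f df a b ab) as [c [E Hc]].
- intros c Hc; apply is_derive_Reals, Hd, Hc.
- specialize (Hp c Hc); nra.
Qed.

Lemma nondecreasing_of_derive (f df : R -> R) a b : a < b ->
  (forall x, a <= x <= b -> is_derive f x (df x)) ->
  (forall x, a < x < b -> 0 <= df x) -> f a <= f b.
Proof.
intros ab Hd Hp.
destruct (MVT_cor2 f df a b ab) as [c [E Hc]].
- intros c Hc; apply is_derive_Reals, Hd, Hc.
- specialize (Hp c Hc); nra.
Qed.

Lemma constant_of_derive (f : R -> R) : (forall x, is_derive f x 0) -> forall x y, f x = f y.
Proof.
assert (H : forall f : R -> R, (forall x, is_derive f x 0) -> forall x y, x < y -> f x = f y).
{ intros g Hg x y xy.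
  destruct (MVT_cor2 g (fun _ => 0) x y xy) as [c [E _]].
  - intros c _; apply is_derive_Reals, Hg.
  - lra. }
intros Hf x y; destruct (Rtotal_order x y) as [h|[->|h]]; auto.
symmetry; auto.
Qed.

(** A closed curve given by its tangent angle phi, with rad the radius of curvature.
    Closing up after a single turn with rad > 0 already forces strict convexity, see
    tang_pos. In this parametrization the point with parallel tangent is the one at
    phi + PI. *)
Record turning_curve := {
  cx : R -> R;
  cy : R -> R;
  rad : R -> R;
  rad' : R -> R;
  is_derive_cx : forall phi, is_derive cx phi (rad phi * cos phi);
  is_derive_cy : forall phi, is_derive cy phi (rad phi * sin phi);
  rad_pos : forall phi, 0 < rad phi;
  is_derive_rad : forall phi, is_derive rad phi (rad' phi);
  continuous_rad' : forall phi, continuous rad' phi;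
  cx_periodic : forall phi, cx (phi + 2 * PI) = cx phi;
  cy_periodic : forall phi, cy (phi + 2 * PI) = cy phi
}.

Definition at_angle (K : turning_curve) (phi : R) : pt := (cx K phi, cy K phi).

(** The cross product of the unit tangent at phi with z minus the point at phi:
    positive to the left of the tangent line. *)
Definition tang (K : turning_curve) (phi : R) (z : pt) : R :=
  cos phi * (snd z - cy K phi) - sin phi * (fst z - cx K phi).

Definition orient (x y z : pt) : R := cross (vsub y x) (vsub z x).

Lemma at_angle_periodic K phi : at_angle K (phi + 2 * PI) = at_angle K phi.
Proof. unfold at_angle; rewrite cx_periodic, cy_periodic; reflexivity. Qed.

Lemma at_angle_periodic_Z K k phi : at_angle K (phi + IZR k * (2 * PI)) = at_angle K phi.
Proof. apply (periodic_Z (at_angle K)), at_angle_periodic. Qed.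

Lemma continuous_cx K phi : continuous (cx K) phi.
Proof. eapply continuous_of_derive, is_derive_cx. Qed.
Lemma continuous_cy K phi : continuous (cy K) phi.
Proof. eapply continuous_of_derive, is_derive_cy. Qed.
Lemma continuous_rad K phi : continuous (rad K) phi.
Proof. eapply continuous_of_derive, is_derive_rad. Qed.

Lemma Derive_cx K phi : Derive (fun x => cx K x) phi = rad K phi * cos phi.
Proof. exact (is_derive_unique _ _ _ (is_derive_cx K phi)). Qed.
Lemma Derive_cy K phi : Derive (fun x => cy K x) phi = rad K phi * sin phi.
Proof. exact (is_derive_unique _ _ _ (is_derive_cy K phi)). Qed.

Lemma tang_base K phi : tang K phi (at_angle K phi) = 0.
Proof. unfold tang, at_angle; simpl; ring. Qed.

Lemma cos_add_2PI x : cos (x + 2 * PI) = cos x.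
Proof. rewrite cos_plus, cos_2PI, sin_2PI; ring. Qed.
Lemma sin_add_2PI x : sin (x + 2 * PI) = sin x.
Proof. rewrite sin_plus, cos_2PI, sin_2PI; ring. Qed.

Lemma tang_periodic K phi z : tang K (phi + 2 * PI) z = tang K phi z.
Proof. unfold tang; rewrite cx_periodic, cy_periodic, cos_add_2PI, sin_add_2PI; ring. Qed.

Lemma tang_periodic_Z K k phi z : tang K (phi + IZR k * (2 * PI)) z = tang K phi z.
Proof. apply (periodic_Z (fun x => tang K x z)); intros; apply tang_periodic. Qed.

Lemma is_derive_tang K phi psi :
  is_derive (fun x => tang K phi (at_angle K x)) psi (rad K psi * sin (psi - phi)).
Proof.
unfold tang, at_angle; simpl.
auto_derive.
- split; [|split; trivial]; eexists; [apply is_derive_cy|apply is_derive_cx].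
- rewrite Derive_cx, Derive_cy.
  rewrite sin_minus; ring.
Qed.

(** The distance to the tangent at phi has derivative rad * sin (psi - phi): it grows
    from 0 over the first half turn and decreases back to 0 over the second. *)
Lemma tang_pos K phi psi : phi < psi < phi + 2 * PI -> 0 < tang K phi (at_angle K psi).
Proof.
intros H; generalize PI_RGT_0; intros Hpi.
destruct (Rle_or_lt psi (phi + PI)) as [h|h].
- rewrite <- (tang_base K phi).
  apply (increasing_of_derive (fun x => tang K phi (at_angle K x)) (fun x => rad K x * sin (x - phi))); [lra| |].
  + intros; apply is_derive_tang.
  + intros x Hx; apply Rmult_lt_0_compat; [apply rad_pos|apply sin_gt_0; lra].
- assert (A : - tang K phi (at_angle K psi) < - tang K phi (at_angle K (phi + 2 * PI))).
  { apply (increasing_of_derive (fun x => - tang K phi (at_angle K x)) (fun x => - (rad K x * sin (x - phi)))); [lra| |].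
    + intros x _; apply (is_derive_opp (V := R_NormedModule) (fun x => tang K phi (at_angle K x))), is_derive_tang.
    + intros x Hx; generalize (rad_pos K x); intros Hr.
      assert (sin (x - phi) < 0) by (apply sin_lt_0; lra); nra. }
  rewrite at_angle_periodic, tang_base in A; lra.
Qed.

Lemma tang_nonneg K phi psi : 0 <= tang K phi (at_angle K psi).
Proof.
generalize PI_RGT_0; intros Hpi.
destruct (mod_period (2 * PI) phi psi ltac:(lra)) as [k Hk].
rewrite <- (at_angle_periodic_Z K (- k) psi), opp_IZR.
replace (psi + - IZR k * (2 * PI)) with (psi - IZR k * (2 * PI)) by ring.
destruct (Req_dec (psi - IZR k * (2 * PI)) phi) as [->|n].
- rewrite tang_base; lra.
- left; apply tang_pos; lra.
Qed.

Lemma at_angle_inj K phi psi : at_angle K phi = at_angle K psi ->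
  exists k : Z, psi = phi + IZR k * (2 * PI).
Proof.
intros E; generalize PI_RGT_0; intros Hpi.
destruct (mod_period (2 * PI) phi psi ltac:(lra)) as [k Hk]; exists k.
destruct (Req_dec (psi - IZR k * (2 * PI)) phi) as [e|n]; [lra|exfalso].
assert (A : 0 < tang K phi (at_angle K (psi - IZR k * (2 * PI)))) by (apply tang_pos; lra).
replace (psi - IZR k * (2 * PI)) with (psi + IZR (- k) * (2 * PI)) in A by (rewrite opp_IZR; ring).
rewrite at_angle_periodic_Z, <- E, tang_base in A; lra.
Qed.

(** Strictly to the left of every tangent; this is the bounded component of the
    complement, see int_oval_iff. *)
Definition inside (K : turning_curve) (p : pt) : Prop := forall phi, 0 < tang K phi p.

(** As a function of b on ]s, s + 2 PI[ it changes sign once, where the line through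
    p and the point at s meets the curve again. *)
Definition chord_side (K : turning_curve) (s : R) (p : pt) (b : R) : R :=
  orient (at_angle K s) (at_angle K b) p.

Lemma is_derive_chord_side K s p b : is_derive (chord_side K s p) b
  (rad K b * (cos b * (snd p - cy K s) - sin b * (fst p - cx K s))).
Proof.
unfold chord_side, orient, cross, vsub, at_angle; simpl.
auto_derive.
- split; [|split; trivial]; eexists; [apply is_derive_cx|apply is_derive_cy].
- rewrite Derive_cx, Derive_cy; ring.
Qed.

Lemma continuous_chord_side K s p b : continuous (chord_side K s p) b.
Proof. eapply continuous_of_derive, is_derive_chord_side. Qed.

(** Secants from s have nearly the direction of the tangent just after s, and the
    opposite direction just before s + 2 PI. *)
Lemma chord_side_near K s p : 0 < tang K s p ->
  exists d, 0 < d /\ forall h, 0 < h < d ->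
    0 < chord_side K s p (s + h) /\ chord_side K s p (s + 2 * PI - h) < 0.
Proof.
intros Hp.
assert (Hr : forall b, (b = s \/ b = s + 2 * PI) ->
  0 < rad K b * (cos b * (snd p - cy K s) - sin b * (fst p - cx K s)) /\ chord_side K s p b = 0).
{ intros b Hb; generalize (rad_pos K b); intros Hr; split.
  - apply Rmult_lt_0_compat; [exact Hr|].
    destruct Hb as [->| ->]; [exact Hp|rewrite cos_add_2PI, sin_add_2PI; exact Hp].
  - unfold chord_side; destruct Hb as [->| ->]; [|rewrite at_angle_periodic];
    unfold orient, cross, vsub; simpl; ring. }
destruct (Hr s (or_introl eq_refl)) as [P1 Z1].
destruct (Hr _ (or_intror eq_refl)) as [P2 Z2].
destruct (derive_pos_near _ _ _ (is_derive_chord_side K s p s) P1) as (d1 & H1 & N1).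
destruct (derive_pos_near _ _ _ (is_derive_chord_side K s p (s + 2 * PI)) P2) as (d2 & H2 & N2).
exists (Rmin d1 d2); split; [apply Rmin_pos; assumption|].
intros h [Hh1 Hh2]; split.
- rewrite <- Z1; apply N1; split; [exact Hh1|]; eapply Rlt_le_trans; [exact Hh2|apply Rmin_l].
- rewrite <- Z2; apply N2; split; [exact Hh1|]; eapply Rlt_le_trans; [exact Hh2|apply Rmin_r].
Qed.

Lemma collinear_param (A B Z : pt) : orient A B Z = 0 -> A <> B ->
  exists mu, Z = (fst A + mu * (fst B - fst A), snd A + mu * (snd B - snd A)).
Proof.
destruct A as [a1 a2], B as [b1 b2], Z as [z1 z2]; unfold orient, cross, vsub; simpl; intros E n.
destruct (Req_dec (b1 - a1) 0) as [h1|h1].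
- destruct (Req_dec (b2 - a2) 0) as [h2|h2].
  + exfalso; apply n; f_equal; lra.
  + exists ((z2 - a2) / (b2 - a2)); f_equal.
    * rewrite h1; rewrite h1 in E; assert ((b2 - a2) * (z1 - a1) = 0) by lra.
      apply Rmult_integral in H; lra.
    * field; exact h2.
- exists ((z1 - a1) / (b1 - a1)); f_equal.
  + field; exact h1.
  + apply (Rmult_eq_reg_l (b1 - a1)); [|exact h1]; transitivity ((b1 - a1) * a2 + (b2 - a2) * (z1 - a1)).
    * lra.
    * field; exact h1.
Qed.

Lemma tang_affine K phi (A B : pt) mu :
  tang K phi (fst A + mu * (fst B - fst A), snd A + mu * (snd B - snd A)) =
  (1 - mu) * tang K phi A + mu * tang K phi B.
Proof. unfold tang; simpl; ring. Qed.

Lemma at_angle_neq K a b : a < b < a + 2 * PI -> at_angle K a <> at_angle K b.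
Proof.
intros H E; generalize (tang_pos K a b H); rewrite <- E, tang_base; lra.
Qed.

(** The ratio mu is positive because p and the point at b are both strictly to the
    left of the tangent at a. *)
Lemma chord_param K a b p : a < b < a + 2 * PI -> 0 < tang K a p ->
  chord_side K a p b = 0 ->
  exists mu, 0 < mu /\
   p = (cx K a + mu * (cx K b - cx K a), cy K a + mu * (cy K b - cy K a)).
Proof.
intros H Hp E.
destruct (collinear_param _ _ _ E (at_angle_neq K a b H)) as [mu Hmu].
exists mu; split; [|exact Hmu].
rewrite Hmu, tang_affine, tang_base in Hp.
generalize (tang_pos K a b H); intros; nra.
Qed.

Lemma tang_pos' K phi psi : phi - 2 * PI < psi < phi -> 0 < tang K phi (at_angle K psi).
Proof.
intros H; rewrite <- at_angle_periodic; apply tang_pos; lra.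
Qed.

(** Three points of the curve are never collinear, as the tangent at the middle one
    would separate the other two; so the orientation keeps the sign that it has for b
    close to a. *)
Lemma orient_pos K a b c : a < b -> b < c -> c < a + 2 * PI ->
  0 < orient (at_angle K a) (at_angle K b) (at_angle K c).
Proof.
intros ab bc ca.
assert (NZ : forall x, a < x < c -> chord_side K a (at_angle K c) x <> 0).
{ intros x Hx E.
  destruct (chord_param K a x (at_angle K c)) as (mu & Hmu & Ec); try lra; [apply tang_pos; lra|].
  (* The point at c is a + mu (x - a): beyond x if mu > 1, which the tangent at x
     forbids, and otherwise between a and x, which the tangent at c forbids. *)
  generalize (tang_pos' K c a ltac:(lra)) (tang_pos' K c x ltac:(lra)); intros T1 T2.
  generalize (tang_pos' K x a ltac:(lra)) (tang_pos K x c ltac:(lra)); intros T3 T4.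
  assert (E1 := tang_affine K c (at_angle K a) (at_angle K x) mu).
  assert (E2 := tang_affine K x (at_angle K a) (at_angle K x) mu).
  simpl in E1, E2; rewrite <- Ec, tang_base in E1; rewrite <- Ec, tang_base in E2.
  assert (M : 1 - mu < 0) by (apply Rnot_le_lt; intros h; nra).
  nra. }
destruct (chord_side_near K a (at_angle K c)) as (d & Hd & N); [apply tang_pos; lra|].
set (h := Rmin (d / 2) ((b - a) / 2)).
assert (Hh : 0 < h < d /\ a + h < b).
{ unfold h; generalize (Rmin_l (d / 2) ((b - a) / 2)) (Rmin_r (d / 2) ((b - a) / 2)).
  generalize (Rmin_pos (d / 2) ((b - a) / 2)); intros; split; [split|]; lra. }
destruct Hh as [Hh Hb].
destruct (N h Hh) as [Np _].
destruct (Rtotal_order 0 (chord_side K a (at_angle K c) b)) as [?|[Z|Ng]]; [assumption| |].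
- exfalso; apply (NZ b); [lra|congruence].
- exfalso; destruct (ivt_pos_neg (chord_side K a (at_angle K c)) (a + h) b) as (z & Hz & Ez); try assumption.
  + intros; apply continuous_chord_side.
  + apply (NZ z); [lra|exact Ez].
Qed.

(** * The second endpoint of a chord through an interior point *)

Lemma cont_px (z : pt * R) : continuous (fun u : pt * R => fst (fst u)) z.
Proof.
apply (continuous_comp (fun u : pt * R => fst u) (fun p : pt => fst p));
[apply continuous_fst|apply continuous_fst].
Qed.
Lemma cont_py (z : pt * R) : continuous (fun u : pt * R => snd (fst u)) z.
Proof.
apply (continuous_comp (fun u : pt * R => fst u) (fun p : pt => snd p));
[apply continuous_fst|apply continuous_snd].
Qed.
Lemma cont_ang (z : pt * R) : continuous (fun u : pt * R => snd u) z.
Proof. apply continuous_snd. Qed.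

Ltac cont_curve :=
  match goal with
  | |- continuous (fun u => cx ?K (@?f u)) ?z => refine (cont_comp f (cx K) z _ (continuous_cx K _))
  | |- continuous (fun u => cy ?K (@?f u)) ?z => refine (cont_comp f (cy K) z _ (continuous_cy K _))
  | |- continuous (fun u => rad ?K (@?f u)) ?z => refine (cont_comp f (rad K) z _ (continuous_rad K _))
  | |- continuous (fun u : _ => fst (fst u)) _ => apply cont_px
  | |- continuous (fun u : _ => snd (fst u)) _ => apply cont_py
  | |- continuous (fun u : _ => snd u) _ => apply cont_ang
  | _ => cont_step
  end.

Lemma continuous_tang K p phi : continuous (fun x => tang K x p) phi.
Proof.
unfold tang; repeat cont_curve.
Qed.

(** By compactness of a period the distances of p to the tangents have a positive
    minimum, and moving p changes all of them by little. *)
Lemma inside_open K p : inside K p -> locally p (inside K).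
Proof.
intros H; generalize PI_RGT_0; intros Hpi.
destruct (continuity_ab_min (fun x => tang K x p) 0 (2 * PI)) as (m & Hm & _); [lra| |].
{ intros c _; apply continuity_pt_filterlim, continuous_tang. }
set (e := tang K m p) in *.
assert (He : 0 < e / 2) by (specialize (H m); fold e in H; lra).
enough (G : forall z : pt, Rabs (fst z - fst p) < e / 2 -> Rabs (snd z - snd p) < e / 2 -> inside K z).
{ exists (mkposreal _ He); intros z [B1 B2]; exact (G z B1 B2). }
intros z A1 A2 phi.
destruct (mod_period (2 * PI) 0 phi ltac:(lra)) as [k Hk].
assert (Hmin : e <= tang K phi p).
{ rewrite <- (tang_periodic_Z K (- k) phi p), opp_IZR.
  replace (phi + - IZR k * (2 * PI)) with (phi - IZR k * (2 * PI)) by ring.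
  apply Hm; lra. }
assert (E : tang K phi z = tang K phi p + (cos phi * (snd z - snd p) - sin phi * (fst z - fst p))).
{ unfold tang; ring. }
rewrite E; apply Rabs_def2 in A1; apply Rabs_def2 in A2.
generalize (COS_bound phi) (SIN_bound phi); intros [C1 C2] [S1 S2].
assert (Q1 : - (e / 2) < cos phi * (snd z - snd p)) by (destruct (Rle_dec 0 (cos phi)); nra).
assert (Q2 : sin phi * (fst z - fst p) < e / 2) by (destruct (Rle_dec 0 (sin phi)); nra).
lra.
Qed.

Definition is_chord (K : turning_curve) (p : pt) (s b : R) : Prop :=
  s < b < s + 2 * PI /\ chord_side K s p b = 0.

Lemma is_chord_sign K p s b x : 0 < tang K s p -> is_chord K p s b ->
  (s < x < b -> 0 < chord_side K s p x) /\ (b < x < s + 2 * PI -> chord_side K s p x < 0).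
Proof.
intros Hp [H E]; destruct (chord_param K s b p H Hp E) as (mu & Hmu & Ep).
assert (F : chord_side K s p x = mu * orient (at_angle K s) (at_angle K x) (at_angle K b)).
{ rewrite Ep; unfold chord_side, orient, cross, vsub, at_angle; simpl; ring. }
rewrite F; split; intros Hx.
- apply Rmult_lt_0_compat; [exact Hmu|apply orient_pos; lra].
- assert (A : 0 < orient (at_angle K s) (at_angle K b) (at_angle K x)) by (apply orient_pos; lra).
  replace (orient (at_angle K s) (at_angle K x) (at_angle K b)) with
    (- orient (at_angle K s) (at_angle K b) (at_angle K x)); [nra|].
  unfold orient, cross, vsub; simpl; ring.
Qed.

Lemma is_chord_exists K p s : 0 < tang K s p -> exists b, is_chord K p s b.
Proof.
intros Hp; generalize PI_RGT_0; intros Hpi.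
destruct (chord_side_near K s p Hp) as (d & Hd & N).
set (h := Rmin (d / 2) PI / 2).
assert (Hh : 0 < h < d /\ h < PI).
{ unfold h; generalize (Rmin_l (d / 2) PI) (Rmin_r (d / 2) PI) (Rmin_pos (d / 2) PI).
  intros; repeat split; lra. }
destruct (N h (proj1 Hh)) as [A B].
destruct (ivt_pos_neg (chord_side K s p) (s + h) (s + 2 * PI - h)) as (z & Hz & Ez); try assumption; try lra.
- intros; apply continuous_chord_side.
- exists z; split; [lra|exact Ez].
Qed.

Lemma is_chord_unique K p s b b' : 0 < tang K s p ->
  is_chord K p s b -> is_chord K p s b' -> b = b'.
Proof.
intros Hp H H'.
destruct (is_chord_sign K p s b b' Hp H) as [A B].
destruct H as [H E], H' as [H' E'].
destruct (Rtotal_order b b') as [h|[h|h]]; [|exact h|].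
- specialize (B ltac:(lra)); lra.
- specialize (A ltac:(lra)); lra.
Qed.

(** The upper bound on mu comes from the tangent at b, which has both p and the point
    at s strictly on its left. *)
Lemma chord_between K p s b : inside K p -> is_chord K p s b ->
  exists mu, 0 < mu < 1 /\
   p = (cx K s + mu * (cx K b - cx K s), cy K s + mu * (cy K b - cy K s)).
Proof.
intros Hp [H E]; destruct (chord_param K s b p H (Hp s) E) as (mu & Hmu & Ep).
exists mu; split; [|exact Ep]; split; [exact Hmu|].
generalize (Hp b); rewrite Ep.
change (cx K s) with (fst (at_angle K s)); change (cy K s) with (snd (at_angle K s)).
change (cx K b) with (fst (at_angle K b)); change (cy K b) with (snd (at_angle K b)).
rewrite tang_affine, tang_base; generalize (tang_pos' K b s ltac:(lra)); intros; nra.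
Qed.

Lemma is_chord_swap K p s b : is_chord K p s b -> is_chord K p b (s + 2 * PI).
Proof.
intros [H E]; split; [lra|].
rewrite <- Ropp_0, <- E; unfold chord_side; rewrite at_angle_periodic.
unfold orient, cross, vsub; simpl; ring.
Qed.

Lemma is_chord_shift K p s b k : is_chord K p s b ->
  is_chord K p (s + IZR k * (2 * PI)) (b + IZR k * (2 * PI)).
Proof.
intros [H E]; split; [lra|].
unfold chord_side; rewrite !at_angle_periodic_Z; exact E.
Qed.

(** Chords through a common interior point cross there, so the endpoints of two of
    them alternate along the curve: both endpoints turn in the same sense. *)
Lemma is_chord_mono K p s b s' b' : inside K p -> is_chord K p s b -> is_chord K p s' b' ->
  s < s' -> b < b'.
Proof.
intros Hp H H' ss.
destruct (Rle_or_lt b s') as [h|h]; [destruct H'; lra|].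
destruct (chord_between K p s b Hp H) as (mu & Hmu & Ep).
destruct (is_chord_sign K p s' b' b (Hp s') H') as [A B].
destruct H as [H E], H' as [H' E'].
assert (P : 0 < chord_side K s' p b).
{ replace (chord_side K s' p b) with
   ((1 - mu) * orient (at_angle K s') (at_angle K b) (at_angle K (s + 2 * PI))).
  - apply Rmult_lt_0_compat; [lra|apply orient_pos; lra].
  - rewrite at_angle_periodic; unfold chord_side; rewrite Ep.
    unfold orient, cross, vsub, at_angle; simpl; ring. }
destruct (Rtotal_order b b') as [?|[->|?]]; [assumption|lra|].
specialize (B ltac:(lra)); lra.
Qed.

Definition second (K : turning_curve) (p : pt) (s : R) : R :=
  epsilon (inhabits 0) (is_chord K p s).

Lemma second_spec K p s : inside K p -> is_chord K p s (second K p s).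
Proof. intros Hp; exact (epsilon_spec (inhabits 0) _ (is_chord_exists K p s (Hp s))). Qed.

Lemma second_eq K p s b : inside K p -> is_chord K p s b -> second K p s = b.
Proof. intros Hp H; apply (is_chord_unique K p s); [apply Hp|apply second_spec, Hp|exact H]. Qed.

Lemma locally_inside K (z : pt * R) : inside K (fst z) -> locally z (fun u => inside K (fst u)).
Proof.
intros H; destruct (inside_open K (fst z) H) as [d Hd]; exists d; intros u [B _]; exact (Hd _ B).
Qed.

Lemma continuous_second K (z : pt * R) : inside K (fst z) ->
  continuous (fun u : pt * R => second K (fst u) (snd u)) z.
Proof.
intros Hp; apply continuous_bracket; intros e He.
destruct (second_spec K (fst z) (snd z) Hp) as [Hb Eb].
assert (Sg := fun x => is_chord_sign K (fst z) (snd z) (second K (fst z) (snd z)) x (Hp _) (conj Hb Eb)).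
set (b := second K (fst z) (snd z)) in *.
set (x1 := Rmax (b - e / 2) ((snd z + b) / 2)).
set (x2 := Rmin (b + e / 2) ((snd z + 2 * PI + b) / 2)).
assert (H1 : b - e < x1 < b /\ snd z < x1).
{ unfold x1; generalize (Rmax_l (b - e / 2) ((snd z + b) / 2)) (Rmax_r (b - e / 2) ((snd z + b) / 2)).
  generalize (Rmax_lub_lt (b - e / 2) ((snd z + b) / 2) b); intros; repeat split; lra. }
assert (H2 : b < x2 < b + e /\ x2 < snd z + 2 * PI).
{ unfold x2; generalize (Rmin_l (b + e / 2) ((snd z + 2 * PI + b) / 2)) (Rmin_r (b + e / 2) ((snd z + 2 * PI + b) / 2)).
  generalize (Rmin_glb_lt (b + e / 2) ((snd z + 2 * PI + b) / 2) b); intros; repeat split; lra. }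
exists x1, x2; split; [tauto|split; [tauto|]].
assert (C : forall x, continuous (fun u : pt * R => chord_side K (snd u) (fst u) x) z).
{ intros x; unfold chord_side, orient, cross, vsub, at_angle; simpl.
  repeat cont_curve. }
assert (L1 : locally z (fun u : pt * R => snd u < x1)).
{ apply (locally_lt (fun u : pt * R => snd u) (fun _ => x1)); [apply cont_ang|apply cont_const|tauto]. }
assert (L2 : locally z (fun u : pt * R => x2 < snd u + 2 * PI)).
{ apply (locally_lt (fun _ => x2) (fun u : pt * R => snd u + 2 * PI)); [apply cont_const| |tauto].
  cont_step; [apply cont_ang|cont_step]. }
assert (L3 : locally z (fun u : pt * R => 0 < chord_side K (snd u) (fst u) x1)).
{ apply (locally_lt (fun _ => 0) _ z (cont_const _ _) (C x1)); apply Sg; lra. }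
assert (L4 : locally z (fun u : pt * R => chord_side K (snd u) (fst u) x2 < 0)).
{ apply (locally_lt _ (fun _ => 0) z (C x2) (cont_const _ _)); apply Sg; lra. }
generalize (locally_and _ _ _ (locally_inside K z Hp)
  (locally_and _ _ _ (locally_and _ _ _ L1 L2) (locally_and _ _ _ L3 L4))).
apply locally_imp; intros [p s]; simpl; intros (Hi & (M1 & M2) & M3 & M4).
destruct (second_spec K p s Hi) as [Hr Er].
assert (Sr := fun x => is_chord_sign K p s (second K p s) x (Hi _) (conj Hr Er)).
split.
- destruct (Rtotal_order x1 (second K p s)) as [?|[h|h]]; [assumption|rewrite h in M3; lra|].
  destruct (Sr x1) as [_ Q]; specialize (Q ltac:(lra)); lra.
- destruct (Rtotal_order (second K p s) x2) as [?|[h|h]]; [assumption|rewrite <- h in M4; lra|].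
  destruct (Sr x2) as [Q _]; specialize (Q ltac:(lra)); lra.
Qed.

(** * The image chord with a given normal *)

Lemma cont_pair {T U V : UniformSpace} (f : T -> U) (g : T -> V) z :
  continuous f z -> continuous g z ->
  continuous (U := prod_UniformSpace U V) (fun u => (f u, g u)) z.
Proof.
intros Hf Hg; apply filterlim_locally; intros eps.
generalize (filter_and _ _ (proj1 (filterlim_locally f (f z)) Hf eps) (proj1 (filterlim_locally g (g z)) Hg eps)).
apply filter_imp; intros u [A B]; split; assumption.
Qed.

(** The linear form n(theta) on the curve. It increases for half a turn from
    theta - PI / 2 and then decreases for half a turn, so a chord orthogonal to
    n(theta) has one endpoint in each half. *)
Definition height (K : turning_curve) (theta phi : R) : R :=
  cos theta * cx K phi + sin theta * cy K phi.

Lemma is_derive_height K theta phi :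
  is_derive (height K theta) phi (rad K phi * cos (phi - theta)).
Proof.
unfold height; auto_derive.
- split; [|split; trivial]; eexists; [apply is_derive_cx|apply is_derive_cy].
- rewrite Derive_cx, Derive_cy, cos_minus; ring.
Qed.

Lemma height_periodic K theta phi : height K theta (phi + 2 * PI) = height K theta phi.
Proof. unfold height; rewrite cx_periodic, cy_periodic; reflexivity. Qed.

Lemma height_increasing K theta x y : theta - PI / 2 <= x -> x < y -> y <= theta + PI / 2 ->
  height K theta x < height K theta y.
Proof.
intros h1 h2 h3; eapply increasing_of_derive; [exact h2| |].
- intros; apply is_derive_height.
- intros u Hu; apply Rmult_lt_0_compat; [apply rad_pos|apply cos_gt_0; lra].
Qed.

Lemma height_decreasing K theta x y : theta + PI / 2 <= x -> x < y -> y <= theta + 3 * (PI / 2) ->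
  height K theta y < height K theta x.
Proof.
intros h1 h2 h3; apply Ropp_lt_cancel.
apply (increasing_of_derive (fun u => - height K theta u) (fun u => - (rad K u * cos (u - theta)))); [exact h2| |].
- intros u _; apply (is_derive_opp (V := R_NormedModule) (height K theta)), is_derive_height.
- intros u Hu; generalize (rad_pos K u); intros Hr.
  assert (cos (u - theta) < 0) by (apply cos_lt_0; lra); nra.
Qed.

Lemma height_increasing' K theta x y : theta + 3 * (PI / 2) <= x -> x < y -> y <= theta + 5 * (PI / 2) ->
  height K theta x < height K theta y.
Proof.
intros h1 h2 h3.
replace x with ((x - 2 * PI) + 2 * PI) by ring; replace y with ((y - 2 * PI) + 2 * PI) by ring.
rewrite !height_periodic; apply height_increasing; lra.
Qed.

(** Passing to antipodes adds PI to tangent angles, so the images under Phi of the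
    chords through p are the chords from a to partner a. *)
Definition partner (K : turning_curve) (p : pt) (a : R) : R := second K p (a - PI) + PI.

(** Zero when the image chord issuing from a is orthogonal to n(theta). *)
Definition gap (K : turning_curve) (p : pt) (theta a : R) : R :=
  height K theta (partner K p a) - height K theta a.

Definition is_start (K : turning_curve) (p : pt) (theta a : R) : Prop :=
  theta - PI / 2 < a < theta + PI / 2 /\ gap K p theta a = 0.

Lemma partner_range K p a : inside K p -> a < partner K p a < a + 2 * PI.
Proof. intros Hp; unfold partner; destruct (second_spec K p (a - PI) Hp) as [H _]; lra. Qed.

Lemma partner_mono K p a a' : inside K p -> a < a' -> partner K p a < partner K p a'.
Proof.
intros Hp H; unfold partner; apply Rplus_lt_compat_r.
apply (is_chord_mono K p (a - PI) _ (a' - PI)); try apply second_spec; try assumption; lra.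
Qed.

Lemma is_start_partner K p theta a : inside K p -> is_start K p theta a ->
  theta + PI / 2 < partner K p a < theta + 3 * (PI / 2).
Proof.
intros Hp [Ha E]; unfold gap in E; generalize (partner_range K p a Hp); intros Hb.
split; apply Rnot_le_lt; intros h.
- generalize (height_increasing K theta a (partner K p a)); intros A; specialize (A ltac:(lra) ltac:(lra) ltac:(lra)); lra.
- generalize (height_increasing' K theta (partner K p a) (a + 2 * PI)); intros A.
  specialize (A ltac:(lra) ltac:(lra) ltac:(lra)); rewrite height_periodic in A; lra.
Qed.

(** As a grows towards theta + PI / 2 its height increases, while the partner turns in
    the same sense on the other half of the curve, where heights decrease. Hence each
    pencil has exactly one image line with normal n(theta). *)
Lemma gap_sign K p theta a0 a : inside K p -> is_start K p theta a0 ->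
  (theta - PI / 2 <= a < a0 -> 0 < gap K p theta a) /\
  (a0 < a <= theta + PI / 2 -> gap K p theta a < 0).
Proof.
intros Hp H0; generalize (is_start_partner K p theta a0 Hp H0); intros Hb0.
destruct H0 as [Ha0 E0]; unfold gap in *.
generalize (partner_range K p a Hp); intros Hb.
split; intros Ha.
- assert (M := partner_mono K p a a0 Hp ltac:(lra)).
  destruct (Rlt_or_le (partner K p a) (theta + PI / 2)) as [h|h].
  + generalize (height_increasing K theta a (partner K p a)); intros A; specialize (A ltac:(lra) ltac:(lra) ltac:(lra)); lra.
  + generalize (height_decreasing K theta (partner K p a) (partner K p a0)); intros A; specialize (A ltac:(lra) ltac:(lra) ltac:(lra)).
    generalize (height_increasing K theta a a0); intros B; specialize (B ltac:(lra) ltac:(lra) ltac:(lra)); lra.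
- assert (M := partner_mono K p a0 a Hp ltac:(lra)).
  destruct (Rle_or_lt (partner K p a) (theta + 3 * (PI / 2))) as [h|h].
  + generalize (height_decreasing K theta (partner K p a0) (partner K p a)); intros A; specialize (A ltac:(lra) ltac:(lra) ltac:(lra)).
    generalize (height_increasing K theta a0 a); intros B; specialize (B ltac:(lra) ltac:(lra) ltac:(lra)); lra.
  + generalize (height_increasing' K theta (partner K p a) (a + 2 * PI)); intros A; specialize (A ltac:(lra) ltac:(lra) ltac:(lra)).
    rewrite height_periodic in A; lra.
Qed.

Lemma is_start_unique K p theta a a' : inside K p ->
  is_start K p theta a -> is_start K p theta a' -> a = a'.
Proof.
intros Hp H H'; destruct (gap_sign K p theta a a' Hp H) as [A B]; destruct H as [H E], H' as [H' E'].
destruct (Rtotal_order a a') as [h|[h|h]]; [|exact h|].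
- specialize (B ltac:(lra)); lra.
- specialize (A ltac:(lra)); lra.
Qed.

Lemma continuous_height K theta phi : continuous (height K theta) phi.
Proof. eapply continuous_of_derive, is_derive_height. Qed.

Lemma continuous_partner K (z : pt * R) : inside K (fst z) ->
  continuous (fun u : pt * R => partner K (fst u) (snd u)) z.
Proof.
intros Hp; unfold partner; cont_step; [|cont_step].
apply (continuous_comp (fun u : pt * R => (fst u, snd u - PI)) (fun u : pt * R => second K (fst u) (snd u))).
- apply (cont_pair (U := prod_UniformSpace R_UniformSpace R_UniformSpace) (V := R_UniformSpace) (fun u : pt * R => fst u) (fun u => snd u - PI)); [apply continuous_fst|].
  cont_step; [apply cont_ang|cont_step].
- apply continuous_second; exact Hp.
Qed.

Lemma continuous_gap K p theta a : inside K p -> continuous (gap K p theta) a.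
Proof.
intros Hp; unfold gap; apply cont_minus; [|apply continuous_height].
apply (cont_comp (fun a => partner K p a) (height K theta)); [|apply continuous_height].
apply (continuous_comp (fun a : R => (p, a)) (fun u : pt * R => partner K (fst u) (snd u))).
- apply (cont_pair (U := prod_UniformSpace R_UniformSpace R_UniformSpace) (V := R_UniformSpace) (fun _ => p) (fun a => a)); [apply continuous_const|apply continuous_id].
- apply continuous_partner; exact Hp.
Qed.

Lemma tang_low K theta z : tang K (theta - PI / 2) z =
  cos theta * fst z + sin theta * snd z - height K theta (theta - PI / 2).
Proof.
unfold tang, height; rewrite cos_minus, sin_minus, cos_PI2, sin_PI2; ring.
Qed.
Lemma tang_high K theta z : tang K (theta + PI / 2) z =
  height K theta (theta + PI / 2) - (cos theta * fst z + sin theta * snd z).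
Proof.
unfold tang, height; rewrite cos_plus, sin_plus, cos_PI2, sin_PI2; ring.
Qed.

Lemma is_start_exists K p theta : inside K p -> exists a, is_start K p theta a.
Proof.
intros Hp; generalize PI_RGT_0; intros Hpi.
destruct (ivt_pos_neg (gap K p theta) (theta - PI / 2) (theta + PI / 2)) as (z & Hz & Ez).
- intros; apply continuous_gap, Hp.
- lra.
- generalize (tang_pos K _ _ (partner_range K p (theta - PI / 2) Hp)); rewrite tang_low; unfold gap, height; simpl; lra.
- generalize (tang_pos K _ _ (partner_range K p (theta + PI / 2) Hp)); rewrite tang_high; unfold gap, height; simpl; lra.
- exists z; split; assumption.
Qed.

Definition start (K : turning_curve) (p : pt) (theta : R) : R :=
  epsilon (inhabits 0) (is_start K p theta).
Definition finish (K : turning_curve) (p : pt) (theta : R) : R := partner K p (start K p theta).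

Lemma start_spec K p theta : inside K p -> is_start K p theta (start K p theta).
Proof. intros Hp; exact (epsilon_spec (inhabits 0) _ (is_start_exists K p theta Hp)). Qed.

Lemma continuous_start K (z : pt * R) : inside K (fst z) ->
  continuous (fun u : pt * R => start K (fst u) (snd u)) z.
Proof.
intros Hp; apply continuous_bracket; intros e He.
assert (S0 := start_spec K (fst z) (snd z) Hp).
assert (Sg := fun x => gap_sign K (fst z) (snd z) _ x Hp S0).
destruct S0 as [Ha Ea].
set (a := start K (fst z) (snd z)) in *.
set (x1 := Rmax (a - e / 2) ((snd z - PI / 2 + a) / 2)).
set (x2 := Rmin (a + e / 2) ((snd z + PI / 2 + a) / 2)).
assert (H1 : a - e < x1 < a /\ snd z - PI / 2 < x1).
{ unfold x1; generalize (Rmax_l (a - e / 2) ((snd z - PI / 2 + a) / 2)) (Rmax_r (a - e / 2) ((snd z - PI / 2 + a) / 2)).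
  generalize (Rmax_lub_lt (a - e / 2) ((snd z - PI / 2 + a) / 2) a); intros; repeat split; lra. }
assert (H2 : a < x2 < a + e /\ x2 < snd z + PI / 2).
{ unfold x2; generalize (Rmin_l (a + e / 2) ((snd z + PI / 2 + a) / 2)) (Rmin_r (a + e / 2) ((snd z + PI / 2 + a) / 2)).
  generalize (Rmin_glb_lt (a + e / 2) ((snd z + PI / 2 + a) / 2) a); intros; repeat split; lra. }
exists x1, x2; split; [tauto|split; [tauto|]].
assert (C : forall x, continuous (fun u : pt * R => gap K (fst u) (snd u) x) z).
{ intros x; unfold gap, height.
  assert (Cp : continuous (fun u : pt * R => partner K (fst u) x) z).
  { apply (continuous_comp (fun u : pt * R => (fst u, x)) (fun u : pt * R => partner K (fst u) (snd u))).
    - apply (cont_pair (U := prod_UniformSpace R_UniformSpace R_UniformSpace) (V := R_UniformSpace) (fun u : pt * R => fst u) (fun _ => x)); [apply continuous_fst|apply continuous_const].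
    - apply continuous_partner; exact Hp. }
  assert (C1 : continuous (fun u : pt * R => cx K (partner K (fst u) x)) z)
   by (apply (cont_comp _ (cx K) z Cp), continuous_cx).
  assert (C2 : continuous (fun u : pt * R => cy K (partner K (fst u) x)) z)
   by (apply (cont_comp _ (cy K) z Cp), continuous_cy).
  assert (C3 := cont_ang z).
  repeat cont_step. }
assert (L1 : locally z (fun u : pt * R => snd u - PI / 2 < x1)).
{ apply (locally_lt (fun u : pt * R => snd u - PI / 2) (fun _ => x1)); [|apply cont_const|tauto].
  cont_step; [apply cont_ang|cont_step]. }
assert (L2 : locally z (fun u : pt * R => x2 < snd u + PI / 2)).
{ apply (locally_lt (fun _ => x2) (fun u : pt * R => snd u + PI / 2)); [apply cont_const| |tauto].
  cont_step; [apply cont_ang|cont_step]. }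
assert (L3 : locally z (fun u : pt * R => 0 < gap K (fst u) (snd u) x1)).
{ apply (locally_lt (fun _ => 0) _ z (cont_const _ _) (C x1)); apply Sg; lra. }
assert (L4 : locally z (fun u : pt * R => gap K (fst u) (snd u) x2 < 0)).
{ apply (locally_lt _ (fun _ => 0) z (C x2) (cont_const _ _)); apply Sg; lra. }
generalize (locally_and _ _ _ (locally_inside K z Hp)
  (locally_and _ _ _ (locally_and _ _ _ L1 L2) (locally_and _ _ _ L3 L4))).
apply locally_imp; intros [p s]; simpl; intros (Hi & (M1 & M2) & M3 & M4).
assert (Sr := start_spec K p s Hi).
assert (Sr' := fun x => gap_sign K p s _ x Hi Sr); destruct Sr as [Hr Er].
split.
- destruct (Rtotal_order x1 (start K p s)) as [?|[h|h]]; [assumption|rewrite h in M3; lra|].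
  destruct (Sr' x1) as [_ Q]; destruct (Rle_or_lt x1 (s + PI / 2)) as [k|k]; [specialize (Q ltac:(lra)); lra|].
  lra.
- destruct (Rtotal_order (start K p s) x2) as [?|[h|h]]; [assumption|rewrite <- h in M4; lra|].
  destruct (Sr' x2) as [Q _]; destruct (Rle_or_lt (s - PI / 2) x2) as [k|k]; [specialize (Q ltac:(lra)); lra|].
  lra.
Qed.

Lemma continuous_finish K (z : pt * R) : inside K (fst z) ->
  continuous (fun u : pt * R => finish K (fst u) (snd u)) z.
Proof.
intros Hp.
apply (continuous_comp (fun u : pt * R => (fst u, start K (fst u) (snd u))) (fun u : pt * R => partner K (fst u) (snd u))).
- apply (cont_pair (U := prod_UniformSpace R_UniformSpace R_UniformSpace) (V := R_UniformSpace) (fun u : pt * R => fst u) (fun u => start K (fst u) (snd u))); [apply continuous_fst|].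
  apply continuous_start, Hp.
- apply continuous_partner; exact Hp.
Qed.

(** * Smooth dependence of the image chord *)

Definition translate (z v : pt * R) (h : R) : pt * R :=
  ((fst (fst z) + h * fst (fst v), snd (fst z) + h * snd (fst v)), snd z + h * snd v).

Lemma translate_0 z v : translate z v 0 = z.
Proof. destruct z as [[x y] t]; unfold translate; simpl; rewrite !Rmult_0_l, !Rplus_0_r; reflexivity. Qed.

(** Joint continuity of f and of its derivative g along v, over all (p, theta) with p
    inside. The derivative is carried as an explicit function because second
    derivatives are obtained by differentiating its formula. *)
Definition C1_along (K : turning_curve) (v : pt * R) (f g : pt * R -> R) : Prop :=
  forall z, inside K (fst z) ->
    continuous f z /\ continuous g z /\ is_derive (fun h => f (translate z v h)) 0 (g z).

Lemma C1_const K v c : C1_along K v (fun _ => c) (fun _ => 0).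
Proof.
intros z _; split; [apply cont_const|split; [apply cont_const|]].
apply (is_derive_const (K := R_AbsRing) (V := R_NormedModule)).
Qed.

Lemma is_derive_affine (a b x : R) : is_derive (fun h => a + h * b) x b.
Proof. auto_derive; [trivial|ring]. Qed.

Lemma C1_px K v : C1_along K v (fun u => fst (fst u)) (fun _ => fst (fst v)).
Proof.
intros z _; split; [apply cont_px|split; [apply cont_const|apply is_derive_affine]].
Qed.
Lemma C1_py K v : C1_along K v (fun u => snd (fst u)) (fun _ => snd (fst v)).
Proof.
intros z _; split; [apply cont_py|split; [apply cont_const|apply is_derive_affine]].
Qed.
Lemma C1_ang K v : C1_along K v (fun u => snd u) (fun _ => snd v).
Proof.
intros z _; split; [apply cont_ang|split; [apply cont_const|apply is_derive_affine]].
Qed.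

Lemma C1_plus K v f g df dg : C1_along K v f df -> C1_along K v g dg ->
  C1_along K v (fun u => f u + g u) (fun u => df u + dg u).
Proof.
intros Hf Hg z Hz; destruct (Hf z Hz) as (a1 & a2 & a3), (Hg z Hz) as (b1 & b2 & b3).
split; [apply cont_plus; assumption|split; [apply cont_plus; assumption|]].
apply (is_derive_plus (K := R_AbsRing) (V := R_NormedModule)); assumption.
Qed.
Lemma C1_minus K v f g df dg : C1_along K v f df -> C1_along K v g dg ->
  C1_along K v (fun u => f u - g u) (fun u => df u - dg u).
Proof.
intros Hf Hg z Hz; destruct (Hf z Hz) as (a1 & a2 & a3), (Hg z Hz) as (b1 & b2 & b3).
split; [apply cont_minus; assumption|split; [apply cont_minus; assumption|]].
apply (is_derive_minus (K := R_AbsRing) (V := R_NormedModule)); assumption.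
Qed.
Lemma C1_opp K v f df : C1_along K v f df -> C1_along K v (fun u => - f u) (fun u => - df u).
Proof.
intros Hf z Hz; destruct (Hf z Hz) as (a1 & a2 & a3).
split; [apply cont_opp; assumption|split; [apply cont_opp; assumption|]].
apply (is_derive_opp (K := R_AbsRing) (V := R_NormedModule)); assumption.
Qed.
Lemma C1_mult K v f g df dg : C1_along K v f df -> C1_along K v g dg ->
  C1_along K v (fun u => f u * g u) (fun u => df u * g u + f u * dg u).
Proof.
intros Hf Hg z Hz; destruct (Hf z Hz) as (a1 & a2 & a3), (Hg z Hz) as (b1 & b2 & b3).
split; [apply cont_mult; assumption|split].
- repeat cont_step.
- generalize (is_derive_mult (K := R_AbsRing) _ _ _ _ _ a3 b3 Rmult_comm); simpl.
  rewrite translate_0; trivial.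
Qed.
Lemma C1_div K v f g df dg : C1_along K v f df -> C1_along K v g dg ->
  (forall z, inside K (fst z) -> g z <> 0) ->
  C1_along K v (fun u => f u / g u) (fun u => (df u * g u - f u * dg u) / (g u * g u)).
Proof.
intros Hf Hg Hn z Hz; destruct (Hf z Hz) as (a1 & a2 & a3), (Hg z Hz) as (b1 & b2 & b3).
specialize (Hn z Hz).
assert (Hn2 : g z * g z <> 0) by (apply Rmult_integral_contrapositive_currified; assumption).
split; [apply cont_div; assumption|split].
- repeat cont_step.
- generalize (is_derive_div _ _ _ _ _ a3 b3); rewrite translate_0; intros A; specialize (A Hn).
  replace (g z * g z) with (g z ^ 2) by ring; exact A.
Qed.
Lemma C1_comp K v f df (h dh : R -> R) : (forall x, is_derive h x (dh x)) ->
  (forall x, continuous dh x) -> C1_along K v f df ->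
  C1_along K v (fun u => h (f u)) (fun u => df u * dh (f u)).
Proof.
intros Hh Hc Hf z Hz; destruct (Hf z Hz) as (a1 & a2 & a3).
split; [exact (cont_comp f h z a1 (continuous_of_derive _ _ _ (Hh _)))|split].
- exact (cont_mult df (fun u => dh (f u)) z a2 (cont_comp f dh z a1 (Hc _))).
- generalize (is_derive_comp (K := R_AbsRing) (V := R_NormedModule) h (fun t => f (translate z v t)) 0 (dh (f z)) (df z)).
  rewrite translate_0; intros A; exact (A (Hh _) a3).
Qed.

Lemma continuous_cx' K phi : continuous (fun x => rad K x * cos x) phi.
Proof. apply cont_mult; [apply continuous_rad|apply continuous_cos]. Qed.
Lemma continuous_cy' K phi : continuous (fun x => rad K x * sin x) phi.
Proof. apply cont_mult; [apply continuous_rad|apply continuous_sin]. Qed.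

Lemma C1_cos K v f df : C1_along K v f df -> C1_along K v (fun u => cos (f u)) (fun u => df u * - sin (f u)).
Proof.
apply (C1_comp K v f df cos (fun x => - sin x)).
- intros; apply is_derive_cos.
- intros; apply cont_opp, continuous_sin.
Qed.
Lemma C1_sin K v f df : C1_along K v f df -> C1_along K v (fun u => sin (f u)) (fun u => df u * cos (f u)).
Proof. apply (C1_comp K v f df sin cos); [apply is_derive_sin|apply continuous_cos]. Qed.
Lemma C1_cx K v f df : C1_along K v f df ->
  C1_along K v (fun u => cx K (f u)) (fun u => df u * (rad K (f u) * cos (f u))).
Proof. apply (C1_comp K v f df (cx K) (fun x => rad K x * cos x)); [apply is_derive_cx|apply continuous_cx']. Qed.
Lemma C1_cy K v f df : C1_along K v f df ->
  C1_along K v (fun u => cy K (f u)) (fun u => df u * (rad K (f u) * sin (f u))).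
Proof. apply (C1_comp K v f df (cy K) (fun x => rad K x * sin x)); [apply is_derive_cy|apply continuous_cy']. Qed.
Lemma C1_rad K v f df : C1_along K v f df ->
  C1_along K v (fun u => rad K (f u)) (fun u => df u * rad' K (f u)).
Proof. apply (C1_comp K v f df (rad K) (rad' K)); [apply is_derive_rad|apply continuous_rad']. Qed.

Ltac C1_step :=
  match goal with
  | |- C1_along ?K ?v (fun u => ?c) _ => refine (C1_const K v c)
  | |- C1_along ?K ?v (fun u => @?f u + @?g u) _ => refine (C1_plus K v f g _ _ _ _)
  | |- C1_along ?K ?v (fun u => @?f u - @?g u) _ => refine (C1_minus K v f g _ _ _ _)
  | |- C1_along ?K ?v (fun u => @?f u * @?g u) _ => refine (C1_mult K v f g _ _ _ _)
  | |- C1_along ?K ?v (fun u => - @?f u) _ => refine (C1_opp K v f _ _)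
  | |- C1_along ?K ?v (fun u => cos (@?f u)) _ => refine (C1_cos K v f _ _)
  | |- C1_along ?K ?v (fun u => sin (@?f u)) _ => refine (C1_sin K v f _ _)
  | |- C1_along ?K ?v (fun u => cx _ (@?f u)) _ => refine (C1_cx K v f _ _)
  | |- C1_along ?K ?v (fun u => cy _ (@?f u)) _ => refine (C1_cy K v f _ _)
  | |- C1_along ?K ?v (fun u => rad _ (@?f u)) _ => refine (C1_rad K v f _ _)
  | |- C1_along ?K ?v (fun u => fst (fst u)) _ => refine (C1_px K v)
  | |- C1_along ?K ?v (fun u => snd (fst u)) _ => refine (C1_py K v)
  | |- C1_along ?K ?v (fun u => snd u) _ => refine (C1_ang K v)
  | |- C1_along ?K ?v _ _ => eassumption
  end.

Section Jacobian.
Context (K : turning_curve).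
Let a (z : pt * R) := start K (fst z) (snd z).
Let b (z : pt * R) := finish K (fst z) (snd z).

(** Two equations determine the endpoint angles a, b of the image chord: p lies on
    the chord from a - PI to b - PI (side), and the chord from a to b is orthogonal to
    n(theta) (gap). The next six functions are the derivatives of their left-hand
    sides in a, in b, and along v. *)
Definition side_start (z : pt * R) : R :=
  rad K (a z - PI) * (cos (a z - PI) * (cy K (b z - PI) - snd (fst z))
                      - sin (a z - PI) * (cx K (b z - PI) - fst (fst z))).
Definition side_finish (z : pt * R) : R :=
  rad K (b z - PI) * (cos (b z - PI) * (snd (fst z) - cy K (a z - PI))
                      - sin (b z - PI) * (fst (fst z) - cx K (a z - PI))).
Definition side_dir (v z : pt * R) : R :=
  fst (fst v) * (cy K (a z - PI) - cy K (b z - PI))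
  - snd (fst v) * (cx K (a z - PI) - cx K (b z - PI)).
Definition gap_start (z : pt * R) : R :=
  - (cos (snd z) * (rad K (a z) * cos (a z)) + sin (snd z) * (rad K (a z) * sin (a z))).
Definition gap_finish (z : pt * R) : R :=
  cos (snd z) * (rad K (b z) * cos (b z)) + sin (snd z) * (rad K (b z) * sin (b z)).
Definition gap_dir (v z : pt * R) : R :=
  snd v * (cos (snd z) * (cy K (b z) - cy K (a z)) - sin (snd z) * (cx K (b z) - cx K (a z))).
Definition jacobian (z : pt * R) : R :=
  side_start z * gap_finish z - side_finish z * gap_start z.
(** Cramer's rule for the derivatives of the endpoint angles along v. *)
Definition start_dir (v z : pt * R) : R :=
  (side_finish z * gap_dir v z - side_dir v z * gap_finish z) / jacobian z.
Definition finish_dir (v z : pt * R) : R :=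
  (side_dir v z * gap_start z - side_start z * gap_dir v z) / jacobian z.

Lemma chord_start_finish z : inside K (fst z) ->
  is_chord K (fst z) (a z - PI) (b z - PI).
Proof.
intros Hp; unfold b, finish, partner; replace (second K (fst z) (start K (fst z) (snd z) - PI) + PI - PI)
  with (second K (fst z) (a z - PI)) by (unfold a; ring).
apply second_spec, Hp.
Qed.

(** The gap decreases in both endpoints, as heights increase at the start and
    decrease at the finish; the side increases in the start and decreases in the
    finish, because p lies strictly between the endpoints of its chord. *)
Lemma jacobian_neg z : inside K (fst z) -> jacobian z < 0.
Proof.
intros Hp.
destruct (start_spec K (fst z) (snd z) Hp) as [Ha Ea].
assert (Hb := is_start_partner K _ _ _ Hp (conj Ha Ea)).
destruct (chord_between K _ _ _ Hp (chord_start_finish z Hp)) as (mu & Hmu & Ep).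
destruct (chord_start_finish z Hp) as [Hr _].
fold (a z) in Ha; change (partner K (fst z) (start K (fst z) (snd z))) with (b z) in Hb.
assert (U1 : 0 < side_start z).
{ unfold side_start; apply Rmult_lt_0_compat; [apply rad_pos|].
  replace (cos _ * _ - _) with ((1 - mu) * tang K (a z - PI) (at_angle K (b z - PI))).
  - apply Rmult_lt_0_compat; [lra|apply tang_pos; lra].
  - rewrite Ep; unfold tang; simpl; ring. }
assert (V1 : side_finish z < 0).
{ unfold side_finish.
  assert (0 < tang K (b z - PI) (at_angle K (a z - PI))) by (apply tang_pos'; lra).
  replace (cos _ * _ - _) with (- (mu * tang K (b z - PI) (at_angle K (a z - PI)))).
  - generalize (rad_pos K (b z - PI)); intros.
    assert (0 < mu * tang K (b z - PI) (at_angle K (a z - PI))) by (apply Rmult_lt_0_compat; lra).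
    generalize (Rmult_lt_0_compat _ _ H0 H1); lra.
  - rewrite Ep; unfold tang; simpl; ring. }
assert (U2 : gap_start z < 0).
{ unfold gap_start.
  assert (0 < rad K (a z) * cos (a z - snd z)) by (apply Rmult_lt_0_compat; [apply rad_pos|apply cos_gt_0; lra]).
  rewrite cos_minus in H; lra. }
assert (V2 : gap_finish z < 0).
{ unfold gap_finish; generalize (rad_pos K (b z)); intros.
  assert (cos (b z - snd z) < 0) by (apply cos_lt_0; lra).
  rewrite cos_minus in H0; nra. }
unfold jacobian; nra.
Qed.

Lemma continuous_a z : inside K (fst z) -> continuous a z.
Proof. apply continuous_start. Qed.
Lemma continuous_b z : inside K (fst z) -> continuous b z.
Proof. apply continuous_finish. Qed.

Lemma continuous_jacobian_entries z v : inside K (fst z) ->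
  continuous side_start z /\ continuous side_finish z /\ continuous (side_dir v) z /\
  continuous gap_start z /\ continuous gap_finish z /\ continuous (gap_dir v) z.
Proof.
intros Hp; assert (ca := continuous_a z Hp); assert (cb := continuous_b z Hp).
unfold side_start, side_finish, side_dir, gap_start, gap_finish, gap_dir.
repeat split; repeat cont_curve.
Qed.

Lemma continuous_translate z v : continuous (U := prod_UniformSpace (prod_UniformSpace R_UniformSpace R_UniformSpace) R_UniformSpace) (translate z v) 0.
Proof.
unfold translate.
apply (cont_pair (U := prod_UniformSpace R_UniformSpace R_UniformSpace) (V := R_UniformSpace)); [apply (cont_pair (U := R_UniformSpace) (V := R_UniformSpace))|];
repeat cont_step.
Qed.

Lemma locally_translate z v : inside K (fst z) -> locally 0 (fun h => inside K (fst (translate z v h))).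
Proof.
intros Hp; assert (C := continuous_translate z v).
apply (C (fun u : pt * R => inside K (fst u))); rewrite translate_0; apply locally_inside, Hp.
Qed.

(** Both equations are bilinear in quantities that depend on one variable each, so
    replacing derivatives by difference quotients turns them into exact relations
    between increments. *)
Lemma is_derive_start_finish z v : inside K (fst z) ->
  is_derive (fun h => a (translate z v h)) 0 (start_dir v z) /\
  is_derive (fun h => b (translate z v h)) 0 (finish_dir v z).
Proof.
intros Hp.
set (ah := fun h => a (translate z v h)); set (bh := fun h => b (translate z v h)).
assert (a0 : ah 0 = a z) by (unfold ah; rewrite translate_0; reflexivity).
assert (b0 : bh 0 = b z) by (unfold bh; rewrite translate_0; reflexivity).
assert (ca : continuous ah 0).
{ apply (continuous_comp (translate z v) a); [apply continuous_translate|rewrite translate_0; apply continuous_a, Hp]. }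
assert (cb : continuous bh 0).
{ apply (continuous_comp (translate z v) b); [apply continuous_translate|rewrite translate_0; apply continuous_b, Hp]. }
set (px := fun h => fst (fst z) + h * fst (fst v)); set (py := fun h => snd (fst z) + h * snd (fst v)).
set (th := fun h => snd z + h * snd v).
assert (cpx : continuous px 0) by (unfold px; repeat cont_step).
assert (cpy : continuous py 0) by (unfold py; repeat cont_step).
assert (cth : continuous th 0) by (unfold th; repeat cont_step).
set (sAx := fun h => slope (cx K) (a z - PI) (rad K (a z - PI) * cos (a z - PI)) (ah h - PI)).
set (sAy := fun h => slope (cy K) (a z - PI) (rad K (a z - PI) * sin (a z - PI)) (ah h - PI)).
set (sBx := fun h => slope (cx K) (b z - PI) (rad K (b z - PI) * cos (b z - PI)) (bh h - PI)).
set (sBy := fun h => slope (cy K) (b z - PI) (rad K (b z - PI) * sin (b z - PI)) (bh h - PI)).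
set (sXx := fun h => slope (cx K) (a z) (rad K (a z) * cos (a z)) (ah h)).
set (sXy := fun h => slope (cy K) (a z) (rad K (a z) * sin (a z)) (ah h)).
set (sYx := fun h => slope (cx K) (b z) (rad K (b z) * cos (b z)) (bh h)).
set (sYy := fun h => slope (cy K) (b z) (rad K (b z) * sin (b z)) (bh h)).
set (sc := fun h => slope cos (snd z) (- sin (snd z)) (th h)).
set (ss := fun h => slope sin (snd z) (cos (snd z)) (th h)).
assert (SC : forall (f g : R -> R) x0 d, continuous g 0 -> g 0 = x0 -> is_derive f x0 d ->
   continuous (fun h => slope f x0 d (g h)) 0 /\ slope f x0 d (g 0) = d).
{ intros f g x0 d Hg E D; split; [|rewrite E; apply slope_base].
  apply (cont_comp g (slope f x0 d)); [exact Hg|rewrite E; apply continuous_slope, D]. }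
assert (caP : continuous (fun h => ah h - PI) 0) by (repeat cont_step).
assert (cbP : continuous (fun h => bh h - PI) 0) by (repeat cont_step).
destruct (SC _ (fun h => ah h - PI) _ _ caP (f_equal (fun x => x - PI) a0) (is_derive_cx K (a z - PI))) as [c1 e1].
destruct (SC _ (fun h => ah h - PI) _ _ caP (f_equal (fun x => x - PI) a0) (is_derive_cy K (a z - PI))) as [c2 e2].
destruct (SC _ (fun h => bh h - PI) _ _ cbP (f_equal (fun x => x - PI) b0) (is_derive_cx K (b z - PI))) as [c3 e3].
destruct (SC _ (fun h => bh h - PI) _ _ cbP (f_equal (fun x => x - PI) b0) (is_derive_cy K (b z - PI))) as [c4 e4].
destruct (SC _ ah _ _ ca a0 (is_derive_cx K (a z))) as [c5 e5].
destruct (SC _ ah _ _ ca a0 (is_derive_cy K (a z))) as [c6 e6].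
destruct (SC _ bh _ _ cb b0 (is_derive_cx K (b z))) as [c7 e7].
destruct (SC _ bh _ _ cb b0 (is_derive_cy K (b z))) as [c8 e8].
assert (t0 : th 0 = snd z) by (unfold th; ring).
destruct (SC _ th _ _ cth t0 (is_derive_cos (snd z))) as [c9 e9].
destruct (SC _ th _ _ cth t0 (is_derive_sin (snd z))) as [c10 e10].
fold (sAx 0) in e1; fold (sAy 0) in e2; fold (sBx 0) in e3; fold (sBy 0) in e4.
fold (sXx 0) in e5; fold (sXy 0) in e6; fold (sYx 0) in e7; fold (sYy 0) in e8.
fold (sc 0) in e9; fold (ss 0) in e10; fold sAx in c1; fold sAy in c2; fold sBx in c3; fold sBy in c4.
fold sXx in c5; fold sXy in c6; fold sYx in c7; fold sYy in c8; fold sc in c9; fold ss in c10.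
set (u1 := fun h => sAx h * (cy K (bh h - PI) - snd (fst z)) - sAy h * (cx K (bh h - PI) - fst (fst z))).
set (v1 := fun h => sBx h * (py h - cy K (a z - PI)) - sBy h * (px h - cx K (a z - PI))).
set (w1 := fun h => fst (fst v) * (cy K (ah h - PI) - cy K (b z - PI)) - snd (fst v) * (cx K (ah h - PI) - cx K (b z - PI))).
set (u2 := fun h => - (cos (th h) * sXx h + sin (th h) * sXy h)).
set (v2 := fun h => cos (th h) * sYx h + sin (th h) * sYy h).
set (w2 := fun h => snd v * (ss h * (cy K (b z) - cy K (a z)) + sc h * (cx K (b z) - cx K (a z)))).
assert (E1 : u1 0 = side_start z).
{ unfold u1, side_start; rewrite e1, e2, b0; ring. }
assert (E2 : v1 0 = side_finish z).
{ unfold v1, side_finish, px, py; rewrite e3, e4; ring. }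
assert (E3 : w1 0 = side_dir v z).
{ unfold w1, side_dir; rewrite a0; ring. }
assert (E4 : u2 0 = gap_start z).
{ unfold u2, gap_start; rewrite e5, e6, t0; ring. }
assert (E5 : v2 0 = gap_finish z).
{ unfold v2, gap_finish; rewrite e7, e8, t0; ring. }
assert (E6 : w2 0 = gap_dir v z).
{ unfold w2, gap_dir; rewrite e9, e10; ring. }
unfold start_dir, finish_dir, jacobian; rewrite <- E1, <- E2, <- E3, <- E4, <- E5, <- E6.
apply (implicit_derivative ah bh u1 v1 w1 u2 v2 w2 0).
1-6: unfold u1, v1, w1, u2, v2, w2; repeat cont_curve.
- rewrite E1, E2, E4, E5; apply Rlt_not_eq, (jacobian_neg z Hp).
- generalize (locally_translate z v Hp); apply locally_imp; intros h Hh.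
  assert (I0 : chord_side K (a z - PI) (fst z) (b z - PI) = 0) by apply (chord_start_finish z Hp).
  assert (Ih : chord_side K (ah h - PI) (px h, py h) (bh h - PI) = 0)
    by apply (chord_start_finish (translate z v h) Hh).
  assert (J0 : height K (snd z) (b z) - height K (snd z) (a z) = 0)
    by apply (proj2 (start_spec K (fst z) (snd z) Hp)).
  assert (Jh : height K (th h) (bh h) - height K (th h) (ah h) = 0)
    by apply (proj2 (start_spec K (fst (translate z v h)) (snd (translate z v h)) Hh)).
  assert (F1 : cx K (ah h - PI) - cx K (a z - PI) = sAx h * (ah h - a z)).
  { unfold sAx; rewrite slope_eq with (d := rad K (a z - PI) * cos (a z - PI)); ring. }
  assert (F2 : cy K (ah h - PI) - cy K (a z - PI) = sAy h * (ah h - a z)).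
  { unfold sAy; rewrite slope_eq with (d := rad K (a z - PI) * sin (a z - PI)); ring. }
  assert (F3 : cx K (bh h - PI) - cx K (b z - PI) = sBx h * (bh h - b z)).
  { unfold sBx; rewrite slope_eq with (d := rad K (b z - PI) * cos (b z - PI)); ring. }
  assert (F4 : cy K (bh h - PI) - cy K (b z - PI) = sBy h * (bh h - b z)).
  { unfold sBy; rewrite slope_eq with (d := rad K (b z - PI) * sin (b z - PI)); ring. }
  assert (F5 : cx K (ah h) - cx K (a z) = sXx h * (ah h - a z)) by apply slope_eq.
  assert (F6 : cy K (ah h) - cy K (a z) = sXy h * (ah h - a z)) by apply slope_eq.
  assert (F7 : cx K (bh h) - cx K (b z) = sYx h * (bh h - b z)) by apply slope_eq.
  assert (F8 : cy K (bh h) - cy K (b z) = sYy h * (bh h - b z)) by apply slope_eq.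
  assert (F9 : cos (th h) - cos (snd z) = sc h * (h * snd v)).
  { unfold sc; rewrite slope_eq with (d := - sin (snd z)); unfold th; ring. }
  assert (F10 : sin (th h) - sin (snd z) = ss h * (h * snd v)).
  { unfold ss; rewrite slope_eq with (d := cos (snd z)); unfold th; ring. }
  rewrite a0, b0, Rminus_0_r; split.
  + unfold chord_side, orient, cross, vsub, at_angle in I0, Ih; simpl in I0, Ih.
    transitivity ((cx K (ah h - PI) - cx K (a z - PI)) * (cy K (bh h - PI) - snd (fst z))
       - (cy K (ah h - PI) - cy K (a z - PI)) * (cx K (bh h - PI) - fst (fst z))
       + ((cx K (bh h - PI) - cx K (b z - PI)) * (py h - cy K (a z - PI))
       - (cy K (bh h - PI) - cy K (b z - PI)) * (px h - cx K (a z - PI)))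
       + w1 h * h).
    * rewrite F1, F2, F3, F4; unfold u1, v1; ring.
    * unfold w1; unfold px, py in *; lra.
  + unfold height in J0, Jh.
    transitivity (cos (th h) * (cx K (bh h) - cx K (b z)) + sin (th h) * (cy K (bh h) - cy K (b z))
      - (cos (th h) * (cx K (ah h) - cx K (a z)) + sin (th h) * (cy K (ah h) - cy K (a z)))
      + ((sin (th h) - sin (snd z)) * (cy K (b z) - cy K (a z)) + (cos (th h) - cos (snd z)) * (cx K (b z) - cx K (a z)))).
    * rewrite F5, F6, F7, F8, F9, F10; unfold u2, v2, w2; ring.
    * lra.
Qed.

Lemma C1_start v : C1_along K v a (start_dir v).
Proof.
intros z Hp; split; [apply continuous_a, Hp|split].
- destruct (continuous_jacobian_entries z v Hp) as (? & ? & ? & ? & ? & ?).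
  assert (J := jacobian_neg z Hp).
  apply cont_div; [repeat cont_step|unfold jacobian; repeat cont_step|lra].
- apply is_derive_start_finish, Hp.
Qed.

Lemma C1_finish v : C1_along K v b (finish_dir v).
Proof.
intros z Hp; split; [apply continuous_b, Hp|split].
- destruct (continuous_jacobian_entries z v Hp) as (? & ? & ? & ? & ? & ?).
  assert (J := jacobian_neg z Hp).
  apply cont_div; [repeat cont_step|unfold jacobian; repeat cont_step|lra].
- apply is_derive_start_finish, Hp.
Qed.

(** The function q_p(theta), at z = (p, theta); see q_eq. *)
Definition pencil_support (z : pt * R) : R :=
  height K (snd z) (a z) - (cos (snd z) * fst (fst z) + sin (snd z) * snd (fst z)).

Definition pencil_support_dir (v z : pt * R) : R :=
  snd v * (cos (snd z) * (cy K (a z) - snd (fst z)) - sin (snd z) * (cx K (a z) - fst (fst z)))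
  + start_dir v z * (cos (snd z) * (rad K (a z) * cos (a z)) + sin (snd z) * (rad K (a z) * sin (a z)))
  - (cos (snd z) * fst (fst v) + sin (snd z) * snd (fst v)).

Lemma C1_ext v f g g' : C1_along K v f g -> (forall z, g z = g' z) -> C1_along K v f g'.
Proof.
intros H E z Hz; destruct (H z Hz) as (c1 & c2 & d); rewrite <- E; split; [assumption|split; [|assumption]].
apply (continuous_ext g); assumption.
Qed.

Lemma C1_pencil_support v : C1_along K v pencil_support (pencil_support_dir v).
Proof.
assert (Ca := C1_start v).
eapply C1_ext.
- unfold pencil_support, height; repeat C1_step.
- intros z; unfold pencil_support_dir; simpl; ring.
Qed.

Lemma C1_pencil_support_dir v : exists g, C1_along K v (pencil_support_dir v) g.
Proof.
assert (Ca := C1_start v); assert (Cb := C1_finish v).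
assert (Cs : exists g, C1_along K v (start_dir v) g).
{ unfold start_dir.
  eexists; apply C1_div; [| |intros z Hz; apply Rlt_not_eq, (jacobian_neg z Hz)];
  unfold jacobian, side_start, side_finish, side_dir, gap_start, gap_finish, gap_dir; repeat C1_step. }
destruct Cs as [ds Cs].
eexists; unfold pencil_support_dir; repeat C1_step.
Qed.

End Jacobian.

(** * The tangent angle of an oval *)

Lemma polar_unit x y : x * x + y * y = 1 -> exists phi, x = cos phi /\ y = sin phi.
Proof.
intros E.
assert (Hx : -1 <= x <= 1) by (split; nra).
assert (Hs : sqrt (1 - x²) = Rabs y).
{ replace (1 - x²) with (y²) by (unfold Rsqr; lra); apply sqrt_Rsqr_abs. }
destruct (Rle_or_lt 0 y) as [h|h].
- exists (acos x); rewrite cos_acos, sin_acos, Hs, Rabs_pos_eq by assumption; split; reflexivity.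
- exists (- acos x); rewrite cos_neg, sin_neg, cos_acos, sin_acos, Hs, Rabs_left by assumption; split; lra.
Qed.

Ltac sides := repeat match goal with |- _ /\ _ => split | |- True => exact I end.

(** Difference quotients are periodic, whether or not they converge. *)
Lemma Derive_periodic (f : R -> R) P : (forall t, f (t + P) = f t) ->
  forall t, Derive f (t + P) = Derive f t.
Proof.
intros H t; unfold Derive; f_equal; apply Lim_ext; intros h.
replace (t + P + h) with (t + h + P) by ring; rewrite !H; reflexivity.
Qed.

Lemma is_derive_inverse (f df g : R -> R) :
  (forall t, is_derive f t (df t)) -> (forall t, 0 < df t) -> (forall y, f (g y) = y) ->
  forall y, is_derive g y (/ df (g y)).
Proof.
intros Hf Hp Hg y.
assert (Inc : forall a b, a < b -> f a < f b).
{ intros a b ab; apply (increasing_of_derive f df); auto. }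
assert (Cg : continuous g y).
{ apply continuous_bracket; intros e He; exists (g y - e / 2), (g y + e / 2).
  split; [lra|split; [lra|]].
  assert (L1 : f (g y - e / 2) < y) by (rewrite <- (Hg y) at 2; apply Inc; lra).
  assert (L2 : y < f (g y + e / 2)) by (rewrite <- (Hg y) at 1; apply Inc; lra).
  generalize (locally_and y _ _
    (locally_lt (fun _ => f (g y - e / 2)) (fun u => u) y (cont_const _ _) (continuous_id _) L1)
    (locally_lt (fun u => u) (fun _ => f (g y + e / 2)) y (continuous_id _) (cont_const _ _) L2)).
  apply locally_imp; intros u [A B]; split; apply Rnot_le_lt; intros h.
  - destruct h as [h|h]; [apply Inc in h|rewrite <- h in A]; rewrite Hg in *; lra.
  - destruct h as [h|h]; [apply Inc in h|rewrite h in B]; rewrite Hg in *; lra. }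
set (s := fun u => slope f (g y) (df (g y)) (g u)).
assert (Cs : continuous s y).
{ apply (cont_comp g (slope f (g y) (df (g y)))); [exact Cg|apply continuous_slope, Hf]. }
assert (Es : s y = df (g y)) by apply slope_base.
rewrite <- Es; apply (is_derive_of_slope g (fun u => / s u)).
- assert (P : 0 < s y) by (rewrite Es; apply Hp).
  generalize (locally_pos s y Cs P); apply locally_imp; intros u Hu.
  assert (E : u - y = s u * (g u - g y)).
  { unfold s; rewrite <- slope_eq, !Hg; reflexivity. }
  rewrite E; field; lra.
- apply cont_inv; [exact Cs|rewrite Es; generalize (Hp (g y)); lra].
Qed.

Definition coord_x (C : oval) (n : nat) : R -> R := Derive_n (fun u => fst (C u)) n.
Definition coord_y (C : oval) (n : nat) : R -> R := Derive_n (fun u => snd (C u)) n.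

Section Reparametrization.
Context (C : oval).
Local Notation x := (coord_x C).
Local Notation y := (coord_y C).

Lemma is_derive_coord n t : is_derive (x n) t (x (S n) t) /\ is_derive (y n) t (y (S n) t).
Proof.
destruct (gamma_smooth C (S n) t) as [A B]; split; apply Derive_correct; assumption.
Qed.
Lemma continuous_coord n t : continuous (x n) t /\ continuous (y n) t.
Proof. destruct (is_derive_coord n t); split; eapply continuous_of_derive; eassumption. Qed.
Lemma coord_periodic n t : x n (t + period C) = x n t /\ y n (t + period C) = y n t.
Proof.
revert t; induction n as [|n IH]; intros t.
- split; [exact (f_equal fst (gamma_periodic C t))|exact (f_equal snd (gamma_periodic C t))].
- split; apply Derive_periodic; intros; apply IH.
Qed.

Lemma velocity_coord t : velocity C t = (x 1 t, y 1 t).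
Proof. reflexivity. Qed.

Lemma acceleration_coord t : acceleration C t = (x 2 t, y 2 t).
Proof. reflexivity. Qed.
Local Opaque coord_x coord_y.
Lemma ex_derive_x n t : ex_derive (fun u => x n u) t.
Proof. exact (ex_intro _ _ (proj1 (is_derive_coord n t))). Qed.
Lemma ex_derive_y n t : ex_derive (fun u => y n u) t.
Proof. exact (ex_intro _ _ (proj2 (is_derive_coord n t))). Qed.
Ltac ex_coord :=
  match goal with
  | |- ex_derive (fun u => coord_x _ _ u) _ => apply ex_derive_x
  | |- ex_derive (fun u => coord_y _ _ u) _ => apply ex_derive_y
  end.
Let speed t := sqrt (x 1 t * x 1 t + y 1 t * y 1 t).
Let turn t := x 1 t * y 2 t - y 1 t * x 2 t.

Lemma speed2_pos t : 0 < x 1 t * x 1 t + y 1 t * y 1 t.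
Proof.
assert (H := gamma_regular C t); rewrite velocity_coord in H.
destruct (Req_dec (x 1 t) 0) as [h|h]; [|nra].
destruct (Req_dec (y 1 t) 0) as [k|k]; [|nra].
exfalso; apply H; rewrite h, k; reflexivity.
Qed.
Lemma speed_pos t : 0 < speed t.
Proof. apply sqrt_lt_R0, speed2_pos. Qed.
Lemma speed_sqr t : speed t * speed t = x 1 t * x 1 t + y 1 t * y 1 t.
Proof. apply sqrt_sqrt, Rlt_le, speed2_pos. Qed.

Lemma turn_pos t : 0 < turn t.
Proof.
assert (H := gamma_curvature C t); unfold curvature in H.
rewrite velocity_coord, acceleration_coord in H.
assert (E : vnorm (x 1 t, y 1 t) = speed t) by reflexivity; rewrite E in H.
change (cross (x 1 t, y 1 t) (x 2 t, y 2 t)) with (turn t) in H.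
assert (P : 0 < speed t ^ 3) by apply pow_lt, speed_pos.
replace (turn t) with (turn t / speed t ^ 3 * speed t ^ 3) by (field; apply Rgt_not_eq, speed_pos).
apply Rmult_lt_0_compat; assumption.
Qed.

Lemma Derive_x n t : Derive (fun u => x n u) t = x (S n) t.
Proof. exact (is_derive_unique _ _ _ (proj1 (is_derive_coord n t))). Qed.
Lemma Derive_y n t : Derive (fun u => y n u) t = y (S n) t.
Proof. exact (is_derive_unique _ _ _ (proj2 (is_derive_coord n t))). Qed.

Lemma is_derive_speed t : is_derive speed t ((x 1 t * x 2 t + y 1 t * y 2 t) / speed t).
Proof.
unfold speed; auto_derive.
- sides; solve [ex_coord | apply speed2_pos].
- rewrite Derive_x, Derive_y; field; apply Rgt_not_eq, speed_pos.
Qed.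
Lemma is_derive_turn t : is_derive turn t (x 1 t * y 3 t - y 1 t * x 3 t).
Proof.
unfold turn; auto_derive.
- sides; solve [ex_coord].
- rewrite !Derive_x, !Derive_y; ring.
Qed.
Lemma continuous_speed t : continuous speed t.
Proof. eapply continuous_of_derive, is_derive_speed. Qed.
Lemma continuous_turn t : continuous turn t.
Proof. eapply continuous_of_derive, is_derive_turn. Qed.

(* The derivative of the tangent angle: curvature times speed. *)
Let rate t := turn t / (speed t * speed t).
Lemma rate_pos t : 0 < rate t.
Proof. apply Rdiv_lt_0_compat; [apply turn_pos|apply Rmult_lt_0_compat; apply speed_pos]. Qed.
Lemma continuous_rate t : continuous rate t.
Proof.
unfold rate; assert (A := continuous_speed t); assert (B := continuous_turn t).
assert (D : speed t * speed t <> 0) by (generalize (speed_pos t); nra).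
repeat cont_step.
Qed.

(** Take ang to be the primitive of the turning rate with the right initial value; in
    the frame rotated by ang the unit tangent has derivative zero. *)
Lemma exists_tangent_angle : exists ang : R -> R,
  (forall t, is_derive ang t (rate t)) /\
  (forall t, x 1 t = speed t * cos (ang t) /\ y 1 t = speed t * sin (ang t)).
Proof.
destruct (polar_unit (x 1 0 / speed 0) (y 1 0 / speed 0)) as (phi0 & Hc & Hs).
{ generalize (speed_pos 0); intros; replace 1 with (speed 0 * speed 0 / (speed 0 * speed 0)) by (field; lra).
  rewrite speed_sqr at 1; field; lra. }
set (ang := fun t => phi0 + RInt rate 0 t).
assert (D : forall t, is_derive ang t (rate t)).
{ intros t; unfold ang.
  replace (rate t) with (0 + rate t) by ring.
  apply (is_derive_plus (K := R_AbsRing) (V := R_NormedModule)); [apply (is_derive_const (K := R_AbsRing) (V := R_NormedModule))|].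
  apply (is_derive_RInt (V := R_NormedModule) rate _ 0); [|apply continuous_rate].
  apply filter_forall; intros u; apply (RInt_correct (V := R_CompleteNormedModule)).
  apply ex_RInt_continuous; intros; apply continuous_rate. }
exists ang; split; [exact D|].
set (c := fun t => (x 1 t * cos (ang t) + y 1 t * sin (ang t)) / speed t).
set (d := fun t => (y 1 t * cos (ang t) - x 1 t * sin (ang t)) / speed t).
assert (DA : forall t, Derive (fun u => ang u) t = rate t) by (intros; apply is_derive_unique, D).
assert (DS : forall t, Derive (fun u => speed u) t = (x 1 t * x 2 t + y 1 t * y 2 t) / speed t) by (intros; apply is_derive_unique, is_derive_speed).
assert (ES : forall t, ex_derive (fun u => speed u) t) by (intros; eexists; apply is_derive_speed).
assert (EA : forall t, ex_derive (fun u => ang u) t) by (intros; eexists; apply D).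
assert (Hc0 : forall t, is_derive c t 0).
{ intros t; unfold c; generalize (speed_pos t) (speed_sqr t); intros Sp S2.
  auto_derive.
  - sides; try solve [ex_coord | apply ES | apply EA | lra].
  - rewrite Derive_x, Derive_y, DA, DS; unfold rate, turn.
    set (X1 := x 1 t) in *; set (Y1 := y 1 t) in *; set (S := speed t) in *.
    set (X2 := x 2 t); set (Y2 := y 2 t); set (co := cos (ang t)); set (si := sin (ang t)).
    apply (Rmult_eq_reg_l (S * S * S)); [|apply Rgt_not_eq; repeat apply Rmult_lt_0_compat; exact Sp].
    rewrite Rmult_0_r.
    transitivity (co * (S * S * X2 - (X1 * Y2 - Y1 * X2) * - Y1 - (X1 * X2 + Y1 * Y2) * X1)
       + si * (S * S * Y2 - (X1 * Y2 - Y1 * X2) * X1 - (X1 * X2 + Y1 * Y2) * Y1)); [field; lra|].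
    rewrite S2; ring. }
assert (Hd0 : forall t, is_derive d t 0).
{ intros t; unfold d; generalize (speed_pos t) (speed_sqr t); intros Sp S2.
  auto_derive.
  - sides; try solve [ex_coord | apply ES | apply EA | lra].
  - rewrite Derive_x, Derive_y, DA, DS; unfold rate, turn.
    set (X1 := x 1 t) in *; set (Y1 := y 1 t) in *; set (S := speed t) in *.
    set (X2 := x 2 t); set (Y2 := y 2 t); set (co := cos (ang t)); set (si := sin (ang t)).
    apply (Rmult_eq_reg_l (S * S * S)); [|apply Rgt_not_eq; repeat apply Rmult_lt_0_compat; exact Sp].
    rewrite Rmult_0_r.
    transitivity (co * (S * S * Y2 - (X1 * Y2 - Y1 * X2) * X1 - (X1 * X2 + Y1 * Y2) * Y1)
       - si * (S * S * X2 - (X1 * Y2 - Y1 * X2) * - Y1 - (X1 * X2 + Y1 * Y2) * X1)); [field; lra|].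
    rewrite S2; ring. }
assert (a0 : ang 0 = phi0) by (unfold ang; rewrite RInt_point; unfold zero; simpl; ring).
assert (Sp0 := speed_pos 0).
assert (c1 : forall t, c t = 1).
{ intros t; rewrite (constant_of_derive c Hc0 t 0); unfold c; rewrite a0, <- Hc, <- Hs.
  replace 1 with (speed 0 * speed 0 / (speed 0 * speed 0)) by (field; lra).
  rewrite speed_sqr at 1; field; lra. }
assert (d0 : forall t, d t = 0).
{ intros t; rewrite (constant_of_derive d Hd0 t 0); unfold d; rewrite a0, <- Hc, <- Hs; field; lra. }
intros t; specialize (c1 t); specialize (d0 t); unfold c, d in c1, d0.
generalize (speed_pos t) (sin2_cos2 (ang t)); unfold Rsqr; intros Sp SC.
assert (F1 : x 1 t * cos (ang t) + y 1 t * sin (ang t) = speed t).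
{ rewrite <- (Rmult_1_l (speed t)), <- c1; field; lra. }
assert (F2 : y 1 t * cos (ang t) - x 1 t * sin (ang t) = 0).
{ rewrite <- (Rmult_0_l (speed t)), <- d0; field; lra. }
split.
- transitivity (x 1 t * (sin (ang t) * sin (ang t) + cos (ang t) * cos (ang t))); [rewrite SC; ring|].
  rewrite <- F1; transitivity (x 1 t * (sin (ang t) * sin (ang t) + cos (ang t) * cos (ang t)) + (y 1 t * cos (ang t) - x 1 t * sin (ang t)) * sin (ang t)); [rewrite F2|]; ring.
- transitivity (y 1 t * (sin (ang t) * sin (ang t) + cos (ang t) * cos (ang t))); [rewrite SC; ring|].
  rewrite <- F1; transitivity (y 1 t * (sin (ang t) * sin (ang t) + cos (ang t) * cos (ang t)) - (y 1 t * cos (ang t) - x 1 t * sin (ang t)) * cos (ang t)); [rewrite F2|]; ring.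
Qed.

(** The turning over a period is a positive multiple of 2 PI. More than one turn would
    give two distinct points with tangents of the same direction, each strictly to the
    left of the tangent at the other. *)
Lemma total_turning ang : (forall t, is_derive ang t (rate t)) ->
  (forall t, x 1 t = speed t * cos (ang t) /\ y 1 t = speed t * sin (ang t)) ->
  forall t, ang (t + period C) = ang t + 2 * PI.
Proof.
intros D E; assert (Pp := period_pos C); generalize PI_RGT_0; intros Hpi.
assert (Inc : forall a b, a < b -> ang a < ang b).
{ intros a b ab; apply (increasing_of_derive ang rate); auto; intros; apply rate_pos. }
assert (Sper : forall t, speed (t + period C) = speed t).
{ intros t; unfold speed; destruct (coord_periodic 1 t) as [-> ->]; reflexivity. }
assert (Rper : forall t, rate (t + period C) = rate t).
{ intros t; unfold rate, turn; rewrite Sper; destruct (coord_periodic 1 t) as [-> ->], (coord_periodic 2 t) as [-> ->]; reflexivity. }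
set (T := ang (0 + period C) - ang 0).
assert (HT : forall t, ang (t + period C) = ang t + T).
{ intros t.
  assert (Z : forall t, is_derive (fun t => ang (t + period C) - ang t) t 0).
  { intros u; auto_derive.
    - split; [|split; [|trivial]]; eexists; apply D.
    - assert (DA : forall u, Derive (fun v => ang v) u = rate u) by (intros; apply is_derive_unique, D).
      rewrite !DA, Rper; ring. }
  generalize (constant_of_derive _ Z t 0); unfold T; lra. }
assert (T0 : 0 < T) by (unfold T; generalize (Inc 0 (0 + period C)); intros; lra).
assert (Tc : cos T = 1 /\ sin T = 0).
{ assert (Hc : cos (ang 0 + T) = cos (ang 0) /\ sin (ang 0 + T) = sin (ang 0)).
  { rewrite <- HT; destruct (E 0) as [E1 E2], (E (0 + period C)) as [E3 E4].
    destruct (coord_periodic 1 0) as [q1 q2]; rewrite q1, Sper in E3; rewrite q2, Sper in E4.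
    generalize (speed_pos 0); intros; split; apply (Rmult_eq_reg_l (speed 0)); lra. }
  rewrite cos_plus, sin_plus in Hc; generalize (sin2_cos2 (ang 0)); unfold Rsqr; intros SC.
  destruct Hc as [h1 h2]; set (c := cos (ang 0)) in *; set (s := sin (ang 0)) in *.
  split.
  - transitivity (c * (c * cos T - s * sin T) + s * (s * cos T + c * sin T)).
    + replace (cos T) with (cos T * (s * s + c * c)) at 1 by (rewrite SC; ring); ring.
    + rewrite h1, h2; lra.
  - transitivity (c * (s * cos T + c * sin T) - s * (c * cos T - s * sin T)).
    + replace (sin T) with (sin T * (s * s + c * c)) at 1 by (rewrite SC; ring); ring.
    + rewrite h1, h2; ring. }
assert (Tle : T <= 2 * PI).
{ apply Rnot_lt_le; intros h.
  destruct (ivt_neg_pos (fun t => ang t - ang 0 - 2 * PI) 0 (period C)) as (t2 & Ht & Et); try assumption.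
  - intros t; assert (continuous ang t) by (eapply continuous_of_derive, D); repeat cont_step.
  - lra.
  - unfold T in h; rewrite Rplus_0_l in h; lra.
  - assert (Ea : ang t2 = ang 0 + 2 * PI) by lra.
    assert (N : C t2 <> C 0).
    { intros e; apply (gamma_simple C) in e; lra. }
    assert (A := gamma_strictly_convex C t2 0 N).
    assert (B := gamma_strictly_convex C 0 t2 (not_eq_sym N)).
    rewrite velocity_coord in A, B; destruct (E 0) as [E1 E2], (E t2) as [E3 E4].
    rewrite E1, E2 in A; rewrite E3, E4, Ea, cos_add_2PI, sin_add_2PI in B.
    unfold cross, vsub in A, B; simpl in A, B.
    set (L := cos (ang 0) * (snd (C t2) - snd (C 0)) - sin (ang 0) * (fst (C t2) - fst (C 0))).
    assert (A' : 0 < speed 0 * L) by (unfold L; lra).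
    assert (B' : 0 < - (speed t2 * L)) by (unfold L; lra).
    generalize (speed_pos 0) (speed_pos t2); intros; nra. }
assert (TT : T = 2 * PI).
{ destruct Tle as [h|h]; [exfalso|exact h].
  assert (S : 0 < sin (T / 2)) by (apply sin_gt_0; lra).
  destruct Tc as [h1 _]; replace T with (2 * (T / 2)) in h1 by field.
  rewrite cos_2a_sin in h1; nra. }
intros t; rewrite HT, TT; reflexivity.
Qed.

(** The tangent angle increases from minus to plus infinity; the inverse function
    reparametrizes the oval, with radius of curvature speed^3 / turn. *)
Lemma exists_turning_curve : exists K : turning_curve,
  (forall phi, exists t N, 0 < N /\ C t = at_angle K phi /\ velocity C t = (N * cos phi, N * sin phi)) /\
  (forall t, exists phi N, 0 < N /\ C t = at_angle K phi /\ velocity C t = (N * cos phi, N * sin phi)).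
Proof.
destruct exists_tangent_angle as (ang & D & E).
assert (Tot := total_turning ang D E).
assert (Pp := period_pos C); generalize PI_RGT_0; intros Hpi.
assert (Inc : forall a b, a < b -> ang a < ang b).
{ intros a b ab; apply (increasing_of_derive ang rate); auto; intros; apply rate_pos. }
assert (Inj : forall a b, ang a = ang b -> a = b).
{ intros a b e; destruct (Rtotal_order a b) as [h|[h|h]]; [apply Inc in h; lra|exact h|apply Inc in h; lra]. }
assert (TotZ : forall k t, ang (t + IZR k * period C) = ang t + IZR k * (2 * PI)).
{ intros k t.
  assert (H : forall u, ang (u + period C) / (2 * PI) - (u + period C) / period C = ang u / (2 * PI) - u / period C).
  { intros u; rewrite Tot; field; lra. }
  assert (G := periodic_Z (fun u => ang u / (2 * PI) - u / period C) (period C) H k t); simpl in G.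
  apply (Rmult_eq_reg_r (/ (2 * PI))); [|apply Rinv_neq_0_compat; lra].
  transitivity (ang (t + IZR k * period C) / (2 * PI)); [reflexivity|].
  transitivity (ang t / (2 * PI) - t / period C + (t + IZR k * period C) / period C); [lra|field; lra]. }
assert (Sur : forall phi, exists t, ang t = phi).
{ intros phi; destruct (mod_period (2 * PI) (ang 0) phi ltac:(lra)) as [k [H1 H2]].
  destruct H1 as [H1|H1].
  - destruct (ivt_neg_pos (fun t => ang t - (phi - IZR k * (2 * PI))) 0 (period C)) as (t & Ht & Et); try lra.
    + intros t; assert (continuous ang t) by (eapply continuous_of_derive, D); repeat cont_step.
    + rewrite <- (Rplus_0_l (period C)), Tot; lra.
    + exists (t + IZR k * period C); rewrite TotZ; lra.
  - exists (0 + IZR k * period C); rewrite TotZ; lra. }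
set (inv := fun phi => epsilon (inhabits 0) (fun t => ang t = phi)).
assert (Hinv : forall phi, ang (inv phi) = phi).
{ intros phi; exact (epsilon_spec (inhabits 0) (fun t => ang t = phi) (Sur phi)). }
assert (Dinv := is_derive_inverse ang rate inv D rate_pos Hinv).
assert (Cinv : forall phi, continuous inv phi) by (intros; eapply continuous_of_derive, Dinv).
assert (Iper : forall phi, inv (phi + 2 * PI) = inv phi + period C).
{ intros phi; apply Inj; rewrite Tot, !Hinv; reflexivity. }
set (r := fun t => speed t * speed t * speed t / turn t).
set (r' := fun t => (3 * speed t * (x 1 t * x 2 t + y 1 t * y 2 t) * turn t
                     - speed t * speed t * speed t * (x 1 t * y 3 t - y 1 t * x 3 t)) / (turn t * turn t)).
assert (Dr : forall t, is_derive r t (r' t)).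
{ intros t; unfold r, r'; generalize (speed_pos t) (turn_pos t); intros; auto_derive.
  - sides; solve [exact (ex_intro _ _ (is_derive_speed t)) | exact (ex_intro _ _ (is_derive_turn t)) | lra].
  - assert (DS : Derive (fun v => speed v) t = (x 1 t * x 2 t + y 1 t * y 2 t) / speed t) by apply is_derive_unique, is_derive_speed.
    assert (DT : Derive (fun v => turn v) t = x 1 t * y 3 t - y 1 t * x 3 t) by apply is_derive_unique, is_derive_turn.
    rewrite DS, DT; field; lra. }
assert (Cr : forall t, continuous r' t).
{ intros t; unfold r'; assert (A := continuous_speed t); assert (B := continuous_turn t).
  destruct (continuous_coord 1 t), (continuous_coord 2 t), (continuous_coord 3 t).
  assert (turn t * turn t <> 0) by (generalize (turn_pos t); nra).
  repeat cont_step. }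
assert (P1 : forall phi, is_derive (fun u => x 0 (inv u)) phi (r (inv phi) * cos phi)).
{ intros phi; replace (r (inv phi) * cos phi) with (/ rate (inv phi) * x 1 (inv phi)).
  - apply (is_derive_comp (K := R_AbsRing) (V := R_NormedModule) (x 0) inv); [apply is_derive_coord|apply Dinv].
  - destruct (E (inv phi)) as [-> _]; rewrite Hinv; unfold r, rate; field.
    generalize (speed_pos (inv phi)) (turn_pos (inv phi)); lra. }
assert (P2 : forall phi, is_derive (fun u => y 0 (inv u)) phi (r (inv phi) * sin phi)).
{ intros phi; replace (r (inv phi) * sin phi) with (/ rate (inv phi) * y 1 (inv phi)).
  - apply (is_derive_comp (K := R_AbsRing) (V := R_NormedModule) (y 0) inv); [apply is_derive_coord|apply Dinv].
  - destruct (E (inv phi)) as [_ ->]; rewrite Hinv; unfold r, rate; field.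
    generalize (speed_pos (inv phi)) (turn_pos (inv phi)); lra. }
assert (P3 : forall phi, 0 < r (inv phi)).
{ intros phi; apply Rdiv_lt_0_compat; [repeat apply Rmult_lt_0_compat; apply speed_pos|apply turn_pos]. }
assert (P4 : forall phi, is_derive (fun u => r (inv u)) phi (/ rate (inv phi) * r' (inv phi))).
{ intros phi; apply (is_derive_comp (K := R_AbsRing) (V := R_NormedModule) r inv); [apply Dr|apply Dinv]. }
assert (P5 : forall phi, continuous (fun u => / rate (inv u) * r' (inv u)) phi).
{ intros phi; apply cont_mult; [apply cont_inv|].
  - apply (cont_comp inv rate); [apply Cinv|apply continuous_rate].
  - generalize (rate_pos (inv phi)); lra.
  - apply (cont_comp inv r'); [apply Cinv|apply Cr]. }
assert (P6 : forall phi, x 0 (inv (phi + 2 * PI)) = x 0 (inv phi)).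
{ intros phi; rewrite Iper; apply coord_periodic. }
assert (P7 : forall phi, y 0 (inv (phi + 2 * PI)) = y 0 (inv phi)).
{ intros phi; rewrite Iper; apply coord_periodic. }
exists (Build_turning_curve _ _ _ _ P1 P2 P3 P4 P5 P6 P7); unfold at_angle; simpl.
assert (Main : forall phi, 0 < speed (inv phi) /\ C (inv phi) = (x 0 (inv phi), y 0 (inv phi)) /\
   velocity C (inv phi) = (speed (inv phi) * cos phi, speed (inv phi) * sin phi)).
{ intros phi; split; [apply speed_pos|split; [apply surjective_pairing|]].
  rewrite velocity_coord; destruct (E (inv phi)) as [-> ->]; rewrite Hinv; reflexivity. }
split.
- intros phi; exists (inv phi), (speed (inv phi)); apply Main.
- intros t; exists (ang t), (speed (inv (ang t))).
  assert (e : inv (ang t) = t) by (apply Inj, Hinv); generalize (Main (ang t)); rewrite e; trivial.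
Qed.

End Reparametrization.

(** * Interior, antipodes and the lines of the image family *)

Definition parametrizes (K : turning_curve) (C : oval) : Prop :=
  (forall phi, exists t N, 0 < N /\ C t = at_angle K phi /\ velocity C t = (N * cos phi, N * sin phi)) /\
  (forall t, exists phi N, 0 < N /\ C t = at_angle K phi /\ velocity C t = (N * cos phi, N * sin phi)).

Section Oval.
Context (C : oval) (K : turning_curve) (HK : parametrizes K C).

Lemma on_oval_iff z : on_oval C z <-> exists phi, z = at_angle K phi.
Proof.
split.
- intros [t Ht]; destruct (proj2 HK t) as (phi & N & _ & E & _); exists phi; congruence.
- intros [phi ->]; destruct (proj1 HK phi) as (t & N & _ & E & _); exists t; exact E.
Qed.

(** Tangents are parallel when the angles differ by a multiple of PI, and even
    multiples give the same point. *)
Lemma iota_at_angle phi : Defs.iota C (at_angle K phi) = at_angle K (phi + PI).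
Proof.
generalize PI_RGT_0; intros Hpi; unfold Defs.iota.
assert (Ex : exists y, on_oval C y /\ y <> at_angle K phi /\ parallel_tangents C (at_angle K phi) y).
{ exists (at_angle K (phi + PI)); split; [apply on_oval_iff; eexists; reflexivity|split].
  - apply not_eq_sym, at_angle_neq; lra.
  - destruct (proj1 HK phi) as (s & N & HN & Es & Vs), (proj1 HK (phi + PI)) as (t & N' & HN' & Et & Vt).
    exists s, t; split; [exact Es|split; [exact Et|]].
    rewrite Vs, Vt, neg_cos, neg_sin; unfold cross; simpl; ring. }
generalize (epsilon_spec (inhabits (at_angle K phi)) _ Ex).
generalize (epsilon (inhabits (at_angle K phi)) (fun y => on_oval C y /\ y <> at_angle K phi /\ parallel_tangents C (at_angle K phi) y)).
intros y (_ & Ny & s & t & Es & Et & Cr).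
destruct (proj2 HK s) as (phis & N & HN & Es' & Vs), (proj2 HK t) as (phit & N' & HN' & Et' & Vt).
rewrite Vs, Vt in Cr; unfold cross in Cr; simpl in Cr.
assert (Z : sin (phit - phis) = 0).
{ rewrite sin_minus; apply (Rmult_eq_reg_l (N * N')); [|apply Rgt_not_eq, Rmult_lt_0_compat; assumption].
  rewrite Rmult_0_r; lra. }
apply sin_eq_0_0 in Z; destruct Z as [k Hk].
assert (E0 : at_angle K phi = at_angle K phis) by congruence.
apply at_angle_inj in E0; destruct E0 as [m Hm].
assert (Ey : y = at_angle K (phi + IZR k * PI)).
{ rewrite <- Et, Et'; replace phit with ((phi + IZR k * PI) + IZR m * (2 * PI)) by lra.
  apply at_angle_periodic_Z. }
destruct (Zeven_odd_dec k) as [Ev|Od].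
- exfalso; apply Ny; apply Zeven_ex in Ev; destruct Ev as [l ->].
  rewrite Ey, mult_IZR, <- (at_angle_periodic_Z K l phi); f_equal; ring.
- apply Zodd_ex in Od; destruct Od as [l ->].
  rewrite Ey, plus_IZR, mult_IZR, <- (at_angle_periodic_Z K l (phi + PI)); f_equal; ring.
Qed.

Lemma is_derive_tang_angle z phi : is_derive (fun x => tang K x z) phi
  (- (sin phi * (snd z - cy K phi) + cos phi * (fst z - cx K phi))).
Proof.
unfold tang; auto_derive.
- sides; [exact (ex_intro _ _ (is_derive_cy K phi))|exact (ex_intro _ _ (is_derive_cx K phi))].
- rewrite Derive_cx, Derive_cy; ring.
Qed.

(** A tangent distance that vanishes is minimal among nonnegative ones, so its derivative in
    the angle vanishes too; that derivative is the other component of z minus the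
    point of contact. *)
Lemma on_boundary z phi : (forall psi, 0 <= tang K psi z) -> tang K phi z = 0 -> z = at_angle K phi.
Proof.
intros H Z.
assert (D : - (sin phi * (snd z - cy K phi) + cos phi * (fst z - cx K phi)) = 0).
{ rewrite <- (Ropp_involutive (- _)), <- Ropp_0; f_equal.
  apply (critical_local_max (fun x => - tang K x z) phi).
  - apply (is_derive_opp (K := R_AbsRing) (V := R_NormedModule)), is_derive_tang_angle.
  - apply filter_forall; intros psi; rewrite Z; generalize (H psi); lra. }
unfold tang in Z.
generalize (sin2_cos2 phi); unfold Rsqr; intros SC.
rewrite (surjective_pairing z); unfold at_angle; f_equal.
- apply Rminus_diag_uniq; transitivity ((sin phi * sin phi + cos phi * cos phi) * (fst z - cx K phi)); [rewrite SC; ring|].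
  transitivity (- cos phi * - (sin phi * (snd z - cy K phi) + cos phi * (fst z - cx K phi)) - sin phi * (cos phi * (snd z - cy K phi) - sin phi * (fst z - cx K phi))); [ring|].
  rewrite D, Z; ring.
- apply Rminus_diag_uniq; transitivity ((sin phi * sin phi + cos phi * cos phi) * (snd z - cy K phi)); [rewrite SC; ring|].
  transitivity (- sin phi * - (sin phi * (snd z - cy K phi) + cos phi * (fst z - cx K phi)) + cos phi * (cos phi * (snd z - cy K phi) - sin phi * (fst z - cx K phi))); [ring|].
  rewrite D, Z; ring.
Qed.

Lemma inside_bounded : exists M, forall z, inside K z -> vnorm z <= M.
Proof.
exists (Rabs (cx K (0 + PI / 2)) + Rabs (cx K (PI + PI / 2)) + (Rabs (cy K (PI / 2 + PI / 2)) + Rabs (cy K (- (PI / 2) + PI / 2)))).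
intros z Hz.
generalize (Hz (0 + PI / 2)) (Hz (PI + PI / 2)) (Hz (PI / 2 + PI / 2)) (Hz (- (PI / 2) + PI / 2)).
rewrite !tang_high; unfold height.
rewrite cos_0, sin_0, cos_PI, sin_PI, cos_PI2, sin_PI2, cos_neg, sin_neg, cos_PI2, sin_PI2.
intros A1 A2 A3 A4.
set (X := fst z) in *; set (Y := snd z) in *.
assert (HX : Rabs X <= Rabs (cx K (0 + PI / 2)) + Rabs (cx K (PI + PI / 2))).
{ generalize (Rle_abs (cx K (0 + PI / 2))) (Rle_abs (- cx K (PI + PI / 2))); rewrite Rabs_Ropp; intros.
  generalize (Rabs_pos (cx K (0 + PI / 2))) (Rabs_pos (cx K (PI + PI / 2))); intros.
  apply Rabs_le; lra. }
assert (HY : Rabs Y <= Rabs (cy K (PI / 2 + PI / 2)) + Rabs (cy K (- (PI / 2) + PI / 2))).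
{ generalize (Rle_abs (cy K (PI / 2 + PI / 2))) (Rle_abs (- cy K (- (PI / 2) + PI / 2))); rewrite Rabs_Ropp; intros.
  generalize (Rabs_pos (cy K (PI / 2 + PI / 2))) (Rabs_pos (cy K (- (PI / 2) + PI / 2))); intros.
  apply Rabs_le; lra. }
apply Rle_trans with (Rabs X + Rabs Y); [|lra].
unfold vnorm, dot; fold X; fold Y.
generalize (Rabs_pos X) (Rabs_pos Y); intros PX PY.
rewrite <- (sqrt_Rsqr (Rabs X + Rabs Y)) by lra.
apply sqrt_le_1_alt; unfold Rsqr.
generalize (Rsqr_abs X) (Rsqr_abs Y); unfold Rsqr; intros -> ->; nra.
Qed.

(** Connectedness of the unit interval, for the first exit of a path from a region. *)
Lemma real_induction (P : R -> Prop) : P 0 ->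
  (forall t, 0 <= t <= 1 -> P t -> locally t P) ->
  (forall t, 0 < t <= 1 -> (forall s, 0 <= s < t -> P s) -> P t) -> P 1.
Proof.
intros P0 Op Cl.
set (E := fun t => 0 <= t <= 1 /\ forall s, 0 <= s <= t -> P s).
assert (E0 : E 0) by (split; [lra|intros s Hs; replace s with 0 by lra; exact P0]).
destruct (completeness E) as [T [UB LUB]].
{ exists 1; intros t [H _]; lra. }
{ exists 0; exact E0. }
assert (T0 : 0 <= T) by (apply UB, E0).
assert (T1 : T <= 1) by (apply LUB; intros t [H _]; lra).
assert (Low : forall s, 0 <= s < T -> P s).
{ intros s Hs; apply Classical_Prop.NNPP; intros N.
  assert (T <= s); [|lra].
  apply LUB; intros t [Ht Pt]; apply Rnot_lt_le; intros h; apply N, Pt; lra. }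
assert (PT : P T).
{ destruct (Req_dec T 0) as [->|n]; [exact P0|apply Cl; [lra|exact Low]]. }
destruct (Req_dec T 1) as [<-|n]; [exact PT|exfalso].
destruct (proj1 (locally_R T P) (Op T ltac:(lra) PT)) as [d Hd].
set (h := Rmin (d / 2) (1 - T)).
assert (Hh : 0 < h /\ h <= d / 2 /\ h <= 1 - T).
{ unfold h; split; [apply Rmin_pos; [generalize (cond_pos d)|]; lra|split; [apply Rmin_l|apply Rmin_r]]. }
assert (T + h <= T); [|lra].
apply UB; split; [lra|intros s Hs].
destruct (Rlt_or_le s T) as [k|k]; [apply Low; lra|].
apply Hd; rewrite Rabs_pos_eq by lra; generalize (cond_pos d); lra.
Qed.

Lemma inside_not_on p : inside K p -> ~ on_oval C p.
Proof.
intros Hp H; apply on_oval_iff in H; destruct H as [phi ->].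
generalize (Hp phi); rewrite tang_base; lra.
Qed.

Lemma joined_off_inside p z : inside K p -> joined_off C p z -> inside K z.
Proof.
intros Hp (f & Cf & f0 & f1 & Off); rewrite <- f1.
apply (real_induction (fun t => inside K (f t))).
- rewrite f0; exact Hp.
- intros t _ Ht; apply (Cf t), inside_open, Ht.
- intros t Ht Low.
  assert (Ct : forall phi, continuous (fun s => tang K phi (f s)) t).
  { intros phi.
    assert (C1 : continuous (fun s => fst (f s)) t) by (apply (continuous_comp f (fun p : pt => fst p)); [apply Cf|apply continuous_fst]).
    assert (C2 : continuous (fun s => snd (f s)) t) by (apply (continuous_comp f (fun p : pt => snd p)); [apply Cf|apply continuous_snd]).
    unfold tang; repeat cont_step. }
  assert (NN : forall phi, 0 <= tang K phi (f t)).
  { intros phi; apply Rnot_lt_le; intros h.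
    destruct (proj1 (locally_R t _) (locally_lt _ (fun _ => 0) t (Ct phi) (cont_const _ _) h)) as [d Hd].
    set (e := Rmin (d / 2) t).
    assert (He : 0 < e /\ e <= d / 2 /\ e <= t).
    { unfold e; split; [apply Rmin_pos; [generalize (cond_pos d)|]; lra|split; [apply Rmin_l|apply Rmin_r]]. }
    specialize (Hd (t - e)); specialize (Low (t - e) ltac:(lra) phi).
    replace (t - e - t) with (- e) in Hd by ring.
    rewrite Rabs_Ropp, Rabs_pos_eq in Hd by lra; generalize (cond_pos d); intros; specialize (Hd ltac:(lra)); lra. }
  intros phi; destruct (NN phi) as [h|h]; [exact h|exfalso].
  apply (Off t ltac:(lra)), on_oval_iff; exists phi; apply on_boundary; [exact NN|congruence].
Qed.

(** A point that is not strictly to the left of some tangent escapes to infinity along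
    the normal of that tangent without meeting the curve. Conversely a path that
    starts inside can only leave through a point where some tangent distance first
    vanishes, and such a point is on the curve. *)
Lemma int_oval_iff p : int_oval C p <-> inside K p.
Proof.
split.
- intros [Off [M HM]] phi; apply Rnot_le_lt; intros h.
  set (d := (sin phi, - cos phi) : pt).
  set (r := Rabs M + Rabs (dot p d) + 1).
  assert (Hr : 0 < r) by (unfold r; generalize (Rabs_pos M) (Rabs_pos (dot p d)); lra).
  set (f := fun t : R => (fst p + t * (r * fst d), snd p + t * (r * snd d)) : pt).
  generalize (sin2_cos2 phi); unfold Rsqr; intros SC.
  assert (J : joined_off C p (f 1)).
  { exists f; split; [|split; [|split]].
    - intros t; apply (cont_pair (U := R_UniformSpace) (V := R_UniformSpace)); repeat cont_step.
    - unfold f; rewrite !Rmult_0_l, !Rplus_0_r; symmetry; apply surjective_pairing.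
    - reflexivity.
    - intros t Ht On; assert (On' := On); apply on_oval_iff in On; destruct On as [psi E].
      assert (T : tang K phi (f t) = tang K phi p - t * r).
      { unfold tang, f, d; simpl.
        transitivity (cos phi * (snd p - cy K phi) - sin phi * (fst p - cx K phi) - t * r * (sin phi * sin phi + cos phi * cos phi)); [ring|rewrite SC; ring]. }
      assert (T' := tang_nonneg K phi psi); rewrite <- E, T in T'.
      assert (t = 0) by nra; subst t; apply Off.
      unfold f in On'; rewrite !Rmult_0_l, !Rplus_0_r, <- surjective_pairing in On'; exact On'. }
  specialize (HM _ J).
  assert (B : dot (f 1) d <= vnorm (f 1)).
  { unfold vnorm; apply Rle_trans with (Rabs (dot (f 1) d)); [apply Rle_abs|].
    rewrite <- sqrt_Rsqr_abs; apply sqrt_le_1_alt.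
    generalize (f 1); intros [w1 w2]; unfold dot, Rsqr, d; simpl.
    replace (w1 * w1 + w2 * w2) with ((w1 * w1 + w2 * w2) * (sin phi * sin phi + cos phi * cos phi)) by (rewrite SC; ring).
    generalize (Rle_0_sqr (w1 * cos phi + w2 * sin phi)); unfold Rsqr; lra. }
  assert (V : dot (f 1) d = dot p d + r).
  { unfold f, dot, d; simpl; transitivity (fst p * sin phi + snd p * - cos phi + r * (sin phi * sin phi + cos phi * cos phi)); [ring|rewrite SC; ring]. }
  generalize (Rle_abs M) (Rle_abs (- dot p d)); rewrite Rabs_Ropp; unfold r in V; lra.
- intros Hp; split; [apply inside_not_on, Hp|].
  destruct inside_bounded as [M HM]; exists M; intros z Hz.
  apply HM, (joined_off_inside p); assumption.
Qed.

(** Up to turns by 2 PI, and up to exchanging the endpoints of the chord, a is the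
    start of the unique image chord with normal n(theta). *)
Lemma image_chord_height p theta a b : inside K p -> is_chord K p (a - PI) (b - PI) ->
  height K theta a = height K theta b -> height K theta a = height K theta (start K p theta).
Proof.
intros Hp Hc E; generalize PI_RGT_0; intros Hpi.
destruct (mod_period (2 * PI) (theta - PI / 2) a ltac:(lra)) as [k Hk].
assert (HZ : forall x, height K theta (x - IZR k * (2 * PI)) = height K theta x).
{ intros x; rewrite <- (periodic_Z (height K theta) (2 * PI) (height_periodic K theta) (- k) x), opp_IZR; f_equal; ring. }
assert (Hc' : is_chord K p ((a - IZR k * (2 * PI)) - PI) ((b - IZR k * (2 * PI)) - PI)).
{ generalize (is_chord_shift K p _ _ (- k) Hc); rewrite opp_IZR; intros G.
  replace (a - IZR k * (2 * PI) - PI) with (a - PI + - IZR k * (2 * PI)) by ring.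
  replace (b - IZR k * (2 * PI) - PI) with (b - PI + - IZR k * (2 * PI)) by ring; exact G. }
rewrite <- (HZ a); rewrite <- (HZ a), <- (HZ b) in E.
set (a' := a - IZR k * (2 * PI)) in *; set (b' := b - IZR k * (2 * PI)) in *.
destruct (Rlt_or_le a' (theta + PI / 2)) as [h|h].
- assert (Pb : partner K p a' = b') by (unfold partner; rewrite (second_eq K p _ _ Hp Hc'); ring).
  destruct (Req_dec a' (theta - PI / 2)) as [e|e].
  + exfalso; destruct Hc' as [R _]; generalize (tang_pos K a' b' ltac:(lra)).
    rewrite e, tang_low; rewrite e in E; unfold height in *; simpl; lra.
  + f_equal; apply (is_start_unique K p theta); [exact Hp| |apply start_spec, Hp].
    split; [lra|unfold gap; rewrite Pb; lra].
- destruct Hc' as [R Z].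
  destruct (Rle_or_lt b' (theta + 3 * (PI / 2))) as [h1|h1].
  { exfalso; generalize (height_decreasing K theta a' b'); intros G; specialize (G ltac:(lra) ltac:(lra) ltac:(lra)); lra. }
  destruct (Rle_or_lt (theta + 5 * (PI / 2)) b') as [h2|h2].
  { exfalso; generalize (height_decreasing K theta (b' - 2 * PI) a'); intros G; specialize (G ltac:(lra) ltac:(lra) ltac:(lra)).
    rewrite <- (height_periodic K theta (b' - 2 * PI)) in G; replace (b' - 2 * PI + 2 * PI) with b' in G by ring; lra. }
  assert (Hs := is_chord_swap K p _ _ (conj R Z)).
  apply (is_chord_shift K p _ _ (-1)) in Hs.
  assert (Pb : partner K p (b' - 2 * PI) = a').
  { unfold partner; rewrite (second_eq K p _ (a' - PI) Hp); [ring|].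
    replace (b' - 2 * PI - PI) with (b' - PI + -1 * (2 * PI)) by ring.
    replace (a' - PI) with (a' - PI + 2 * PI + -1 * (2 * PI)) by ring; exact Hs. }
  assert (S : is_start K p theta (b' - 2 * PI)).
  { split; [lra|unfold gap; rewrite Pb].
    rewrite <- (height_periodic K theta (b' - 2 * PI)); replace (b' - 2 * PI + 2 * PI) with b' by ring; lra. }
  rewrite <- (is_start_unique K p theta _ _ Hp S (start_spec K p theta Hp)), E.
  rewrite <- (height_periodic K theta (b' - 2 * PI)); f_equal; ring.
Qed.

Lemma line_normal theta (w v : pt) : w <> (0, 0) -> dot (nvec theta) w = 0 ->
  (cross w v = 0 <-> dot (nvec theta) v = 0).
Proof.
intros Hw E; set (l := dot (tauvec theta) w).
generalize (sin2_cos2 theta); unfold Rsqr; intros SC.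
unfold dot, nvec, tauvec in *; simpl in *.
assert (W1 : fst w = - l * sin theta).
{ transitivity (fst w * (sin theta * sin theta + cos theta * cos theta) - cos theta * (cos theta * fst w + sin theta * snd w)); [rewrite SC, E; ring|unfold l; ring]. }
assert (W2 : snd w = l * cos theta).
{ transitivity (snd w * (sin theta * sin theta + cos theta * cos theta) - sin theta * (cos theta * fst w + sin theta * snd w)); [rewrite SC, E; ring|unfold l; ring]. }
assert (Hl : l <> 0).
{ intros h; apply Hw; rewrite (surjective_pairing w), W1, W2, h; f_equal; ring. }
unfold cross; rewrite W1, W2.
replace (- l * sin theta * snd v - l * cos theta * fst v) with (- (l * (cos theta * fst v + sin theta * snd v))) by ring.
split; intros H.
- apply (Rmult_eq_reg_l l); [lra|exact Hl].
- rewrite H; ring.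
Qed.

Lemma height_dot theta phi : height K theta phi = dot (nvec theta) (at_angle K phi).
Proof. reflexivity. Qed.

(** All image lines with normal n(theta) have the same height by image_chord_height,
    and the one from start to finish belongs to the image of the pencil. *)
Lemma Phi_image_pencil p theta r : inside K p ->
  (Phi_image C (pencil p) (fun z => dot (nvec theta) (vsub z p) = r) <->
   r = pencil_support K (p, theta)).
Proof.
intros Hp; generalize PI_RGT_0; intros Hpi; split.
- intros (L & [_ Lp] & x & y & Ox & Oy & Nxy & SL & SL').
  apply on_oval_iff in Ox; destruct Ox as [s ->]; apply on_oval_iff in Oy; destruct Oy as [t0 ->].
  destruct (mod_period (2 * PI) s t0 ltac:(lra)) as [k Hk].
  set (t := t0 - IZR k * (2 * PI)) in *.
  assert (Et : at_angle K t0 = at_angle K t).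
  { unfold t; rewrite <- (at_angle_periodic_Z K (- k) t0), opp_IZR; f_equal; ring. }
  rewrite Et in *; rewrite !iota_at_angle in SL'.
  assert (Hst : s < t < s + 2 * PI).
  { split; [|lra]; destruct (proj1 Hk) as [h|h]; [exact h|exfalso; apply Nxy; congruence]. }
  assert (Hc : is_chord K p s t) by (split; [exact Hst|apply (proj1 (SL p) Lp)]).
  assert (D1 : dot (nvec theta) (vsub (at_angle K (s + PI)) p) = r).
  { apply SL'; unfold line_through, cross, vsub; simpl; ring. }
  assert (D2 : dot (nvec theta) (vsub (at_angle K (t + PI)) p) = r).
  { apply SL'; unfold line_through, cross, vsub; simpl; ring. }
  assert (H := image_chord_height p theta (s + PI) (t + PI) Hp).
  replace (s + PI - PI) with s in H by ring; replace (t + PI - PI) with t in H by ring.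
  specialize (H Hc); unfold pencil_support; simpl; rewrite <- H.
  + unfold height, dot, vsub, nvec in *; simpl in *; lra.
  + unfold height, dot, vsub, nvec in *; simpl in *; lra.
- intros ->.
  assert (Hc := chord_start_finish K (p, theta) Hp); simpl in Hc.
  assert (Hs := start_spec K p theta Hp); destruct Hs as [_ G].
  set (a := start K p theta) in *; set (b := finish K p theta) in *.
  assert (G' : height K theta b = height K theta a) by (unfold gap in G; unfold b, finish; fold a; lra).
  exists (line_through (at_angle K (a - PI)) (at_angle K (b - PI))).
  assert (N : at_angle K (a - PI) <> at_angle K (b - PI)) by (apply at_angle_neq, Hc).
  split; [split; [|apply Hc]|].
  + exists (at_angle K (a - PI)), (at_angle K (b - PI)); split; [exact N|intros z; tauto].
  + exists (at_angle K (a - PI)), (at_angle K (b - PI)).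
    split; [apply on_oval_iff; eexists; reflexivity|split; [apply on_oval_iff; eexists; reflexivity|]].
    split; [exact N|split; [intros z; tauto|]].
    rewrite !iota_at_angle; replace (a - PI + PI) with a by ring; replace (b - PI + PI) with b by ring.
    intros z; unfold line_through; rewrite (line_normal theta).
    * change (pencil_support K (p, theta)) with (height K theta a - dot (nvec theta) p).
      rewrite height_dot; unfold dot, vsub; simpl; split; intros; lra.
    * intros e; apply (at_angle_neq K a b); [destruct Hc; lra|].
      unfold vsub, at_angle in *; simpl in e; injection e; intros; f_equal; lra.
    * unfold height, dot, vsub, nvec in *; simpl in *; lra.
Qed.

Lemma q_eq p theta : inside K p -> q C p theta = pencil_support K (p, theta).
Proof.
intros Hp; apply (Phi_image_pencil p theta _ Hp).
apply (epsilon_spec (inhabits 0) (fun r => Phi_image C (pencil p) (fun z => dot (nvec theta) (vsub z p) = r))).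
exists (pencil_support K (p, theta)); apply (Phi_image_pencil p theta _ Hp); reflexivity.
Qed.

Lemma pencil_support_antiperiodic p theta : inside K p ->
  pencil_support K (p, theta + PI) = - pencil_support K (p, theta).
Proof.
intros Hp; unfold pencil_support; simpl.
assert (Hc := chord_start_finish K (p, theta + PI) Hp); simpl in Hc.
assert (HN : forall phi, height K (theta + PI) phi = - height K theta phi).
{ intros phi; unfold height; rewrite neg_cos, neg_sin; ring. }
assert (Hs := start_spec K p (theta + PI) Hp); destruct Hs as [_ G].
unfold gap in G; rewrite !HN in G.
assert (H := image_chord_height p theta _ _ Hp Hc); rewrite HN, H, neg_cos, neg_sin; [ring|].
unfold finish; lra.
Qed.

End Oval.

(** * The derivative of the energy *)

(** An equation between integrals is typed in a normed module, where ring does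
    not recognize the real numbers. *)
Ltac real_eq := match goal with |- ?a = ?b => change (@eq R a b) end.

Lemma ex_RInt_cont (f : R -> R) a b : (forall x, continuous f x) -> ex_RInt f a b.
Proof. intros H; apply (ex_RInt_continuous (V := R_CompleteNormedModule)); intros; apply H. Qed.

Lemma RInt_of_derive (F f : R -> R) a b : (forall x, is_derive F x (f x)) ->
  (forall x, continuous f x) -> RInt f a b = F b - F a.
Proof.
intros D Cf; apply (is_RInt_unique (V := R_CompleteNormedModule)).
apply (is_RInt_derive (V := R_CompleteNormedModule) F f); intros; [apply D|apply Cf].
Qed.

Lemma RInt_lin (f g : R -> R) (c : R) a b : (forall x, continuous f x) -> (forall x, continuous g x) ->
  RInt (fun x => f x + c * g x) a b = RInt f a b + c * RInt g a b.
Proof.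
intros Cf Cg.
assert (E1 : RInt (fun x => c * g x) a b = c * RInt g a b).
{ apply (RInt_scal (V := R_CompleteNormedModule) g a b c), ex_RInt_cont, Cg. }
rewrite <- E1; apply (RInt_plus (V := R_CompleteNormedModule) f (fun x => c * g x)).
- apply ex_RInt_cont, Cf.
- apply ex_RInt_cont; intros x; specialize (Cg x); repeat cont_step.
Qed.

(** The two boundary conditions are those of the support functions of closed fronts
    traversed over half a turn. *)
Definition C2_antiperiodic (f f1 f2 : R -> R) : Prop :=
  (forall x, is_derive f x (f1 x)) /\ (forall x, is_derive f1 x (f2 x)) /\
  (forall x, continuous f2 x) /\ f PI = - f 0 /\ f1 PI = - f1 0.

(** The antiperiodic boundary conditions make the boundary terms of two integrations by
    parts cancel. *)
Lemma self_adjoint f f1 f2 g g1 g2 : C2_antiperiodic f f1 f2 -> C2_antiperiodic g g1 g2 ->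
  RInt (fun x => (f x + f2 x) * g x) 0 PI = RInt (fun x => (g x + g2 x) * f x) 0 PI.
Proof.
intros (Df & Df1 & Cf2 & Af & Af1) (Dg & Dg1 & Cg2 & Ag & Ag1).
assert (Cf : forall x, continuous f x) by (intros; eapply continuous_of_derive, Df).
assert (Cg : forall x, continuous g x) by (intros; eapply continuous_of_derive, Dg).
assert (Z : RInt (fun x => f2 x * g x - f x * g2 x) 0 PI = 0).
{ rewrite (RInt_of_derive (fun x => f1 x * g x - f x * g1 x)).
  - cbv beta; real_eq; rewrite Af, Af1, Ag, Ag1; ring.
  - intros x; auto_derive.
    + sides; [exact (ex_intro _ _ (Df1 x))|exact (ex_intro _ _ (Dg x))|exact (ex_intro _ _ (Df x))|exact (ex_intro _ _ (Dg1 x))].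
    + assert (E1 : Derive (fun x => f1 x) x = f2 x) by apply is_derive_unique, Df1.
      assert (E2 : Derive (fun x => f x) x = f1 x) by apply is_derive_unique, Df.
      assert (E3 : Derive (fun x => g1 x) x = g2 x) by apply is_derive_unique, Dg1.
      assert (E4 : Derive (fun x => g x) x = g1 x) by apply is_derive_unique, Dg.
      rewrite E1, E2, E3, E4; ring.
  - intros x; specialize (Cf x); specialize (Cg x); specialize (Cf2 x); specialize (Cg2 x); repeat cont_step. }
transitivity (RInt (fun x => (g x + g2 x) * f x + 1 * (f2 x * g x - f x * g2 x)) 0 PI).
- apply RInt_ext; intros x _; simpl; real_eq; ring.
- rewrite (RInt_lin (fun x => (g x + g2 x) * f x) (fun x => f2 x * g x - f x * g2 x)), Z; [real_eq; ring| |];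
  intros x; specialize (Cf x); specialize (Cg x); specialize (Cf2 x); specialize (Cg2 x); repeat cont_step.
Qed.

Lemma C2_trig A B : C2_antiperiodic (fun x => A * cos x + B * sin x)
  (fun x => - A * sin x + B * cos x) (fun x => - (A * cos x + B * sin x)).
Proof.
split; [|split; [|split; [|split]]].
- intros x; auto_derive; [trivial|ring].
- intros x; auto_derive; [trivial|ring].
- intros x; assert (H1 := continuous_cos x); assert (H2 := continuous_sin x); repeat cont_step.
- rewrite cos_PI, sin_PI, cos_0, sin_0; ring.
- rewrite cos_PI, sin_PI, cos_0, sin_0; ring.
Qed.

Lemma orthogonal_trig f f1 f2 A B : C2_antiperiodic f f1 f2 ->
  RInt (fun x => (f x + f2 x) * (A * cos x + B * sin x)) 0 PI = 0.
Proof.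
intros Hf; rewrite (self_adjoint _ _ _ _ _ _ Hf (C2_trig A B)).
transitivity (RInt (fun _ : R => 0) 0 PI); [apply RInt_ext; intros; simpl; real_eq; ring|].
rewrite (RInt_const (V := R_CompleteNormedModule)); unfold scal; simpl; unfold mult; simpl; real_eq; ring.
Qed.

Lemma uniform_near (k : R -> R -> R) a b : (forall t, a <= t <= b -> continuity_2d_pt k 0 t) ->
  forall eps, 0 < eps -> exists d, 0 < d /\ forall h, Rabs h < d -> forall t, a <= t <= b ->
    Rabs (k h t - k 0 t) < eps.
Proof.
intros H eps He.
destruct (uniform_continuity_2d_1d' k a b 0 H (mkposreal eps He)) as [d Hd].
exists d; split; [apply cond_pos|intros h Hh t Ht].
apply Rabs_def2 in Hh; generalize (cond_pos d); intros.
apply (Hd t 0 t h); try lra.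
rewrite Rminus_diag, Rabs_R0; lra.
Qed.

Lemma translate_add z v h k : translate z v (h + k) = translate (translate z v h) v k.
Proof. unfold translate; simpl; f_equal; [f_equal|]; ring. Qed.

Lemma C1_along_at K v f g z h : C1_along K v f g -> inside K (fst (translate z v h)) ->
  is_derive (fun u => f (translate z v u)) h (g (translate z v h)).
Proof.
intros H Hp; destruct (H _ Hp) as (_ & _ & D).
apply (is_derive_ext (fun u => f (translate (translate z v h) v (u - h)))).
- intros u; rewrite <- translate_add; do 2 f_equal; ring.
- replace (g (translate z v h)) with (1 * g (translate z v h)) by ring.
  apply (is_derive_comp (K := R_AbsRing) (V := R_NormedModule) (fun k => f (translate (translate z v h) v k)) (fun u => u - h)).
  + replace (h - h) with 0 by ring; exact D.
  + auto_derive; [trivial|ring].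
Qed.

Lemma is_derive_front (f f1 f2 : R -> R) (c t : R) :
  is_derive f t (f1 t) -> is_derive f1 t (f2 t) ->
  is_derive (fun u => c + (f u * cos u + f1 u * - sin u)) t (- (f t + f2 t) * sin t) /\
  is_derive (fun u => c + (f u * sin u + f1 u * cos u)) t ((f t + f2 t) * cos t).
Proof.
intros D D1.
assert (E1 : Derive (fun t => f t) t = f1 t) by apply is_derive_unique, D.
assert (E2 : Derive (fun t => f1 t) t = f2 t) by apply is_derive_unique, D1.
split; auto_derive.
- sides; [exact (ex_intro _ _ D)|exact (ex_intro _ _ D1)].
- rewrite E1, E2; ring.
- sides; [exact (ex_intro _ _ D)|exact (ex_intro _ _ D1)].
- rewrite E1, E2; ring.
Qed.

Definition dir_angle : pt * R := ((0, 0), 1).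
Definition dir_plane (vx vy : R) : pt * R := ((vx, vy), 0).

Lemma translate_plane p theta vx vy h :
  translate (p, theta) (dir_plane vx vy) h = ((fst p + h * vx, snd p + h * vy), theta).
Proof. unfold translate, dir_plane; simpl; rewrite Rmult_0_r, Rplus_0_r; reflexivity. Qed.

Lemma C1_along_angle K f g p theta : C1_along K dir_angle f g -> inside K p ->
  is_derive (fun t => f (p, t)) theta (g (p, theta)).
Proof.
intros H Hp.
assert (E : forall t, translate (p, 0) dir_angle t = (p, t)).
{ intros t; unfold translate, dir_angle; simpl; rewrite !Rmult_0_r, !Rplus_0_r, Rmult_1_r, Rplus_0_l, <- surjective_pairing; reflexivity. }
apply (is_derive_ext (fun t => f (translate (p, 0) dir_angle t))); [intros; rewrite E; reflexivity|].
replace (g (p, theta)) with (g (translate (p, 0) dir_angle theta)) by (rewrite E; reflexivity); apply (C1_along_at K); [exact H|rewrite E; exact Hp].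
Qed.

Lemma continuity_2d_translate K f p v t : (forall z, inside K (fst z) -> continuous f z) -> inside K p ->
  continuity_2d_pt (fun h t => f (translate (p, t) v h)) 0 t.
Proof.
intros Cf Hp; apply continuity_2d_pt_filterlim.
apply (continuous_comp (V := prod_UniformSpace (prod_UniformSpace R_UniformSpace R_UniformSpace) R_UniformSpace)
  (fun w : R * R => translate (p, snd w) v (fst w)) f (0, t)).
- unfold translate; simpl.
  assert (c1 : continuous (fun w : R * R => fst w) (0, t)) by apply continuous_fst.
  assert (c2 : continuous (fun w : R * R => snd w) (0, t)) by apply continuous_snd.
  apply (cont_pair (U := prod_UniformSpace R_UniformSpace R_UniformSpace) (V := R_UniformSpace)); [apply (cont_pair (U := R_UniformSpace) (V := R_UniformSpace))|];
  repeat cont_step.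
- simpl; rewrite translate_0; apply Cf, Hp.
Qed.

Section Energy.
Context (C : oval) (K : turning_curve) (HK : parametrizes K C).
Local Notation S := (pencil_support K).
Local Notation S1 := (pencil_support_dir K dir_angle).
Context (S2 : pt * R -> R) (HS2 : C1_along K dir_angle S1 S2).

Lemma support_C2 p : inside K p ->
  C2_antiperiodic (fun t => S (p, t)) (fun t => S1 (p, t)) (fun t => S2 (p, t)).
Proof.
intros Hp.
assert (D : forall t, is_derive (fun t => S (p, t)) t (S1 (p, t))).
{ intros t; apply (C1_along_angle K); [apply C1_pencil_support|exact Hp]. }
split; [exact D|split; [|split; [|split]]].
- intros t; apply (C1_along_angle K); [exact HS2|exact Hp].
- intros t; apply (continuous_comp (V := prod_UniformSpace (prod_UniformSpace R_UniformSpace R_UniformSpace) R_UniformSpace) (fun t : R => (p, t)) S2).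
  + apply (cont_pair (U := prod_UniformSpace R_UniformSpace R_UniformSpace) (V := R_UniformSpace) (fun _ => p) (fun t => t)); [apply continuous_const|apply continuous_id].
  + apply HS2, Hp.
- rewrite <- (Rplus_0_l PI); apply (pencil_support_antiperiodic K p 0 Hp).
- assert (A : forall t, S (p, t + PI) = - S (p, t)) by (intros; apply pencil_support_antiperiodic, Hp).
  assert (D1 : is_derive (fun t => S (p, t + PI)) 0 (S1 (p, 0 + PI))).
  { replace (S1 (p, 0 + PI)) with (1 * S1 (p, 0 + PI)) by ring.
    apply (is_derive_comp (K := R_AbsRing) (V := R_NormedModule) (fun t => S (p, t)) (fun t => t + PI)); [apply D|].
    auto_derive; [trivial|ring]. }
  assert (D2 : is_derive (fun t => S (p, t + PI)) 0 (- S1 (p, 0))).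
  { apply (is_derive_ext (fun t => - S (p, t))); [intros; symmetry; apply A|].
    apply (is_derive_opp (K := R_AbsRing) (V := R_NormedModule)), D. }
  rewrite <- (Rplus_0_l PI), <- (is_derive_unique _ _ _ D1); apply is_derive_unique, D2.
Qed.

Lemma q_fun p : inside K p -> q C p = (fun t => S (p, t)).
Proof. intros Hp; apply functional_extensionality; intros t; apply (q_eq C K HK), Hp. Qed.

Lemma Derive_q p t : inside K p -> Derive (q C p) t = S1 (p, t).
Proof. intros Hp; rewrite q_fun by assumption; apply is_derive_unique, support_C2, Hp. Qed.

Lemma rho_eq p t : inside K p -> rho C p t = S (p, t) + S2 (p, t).
Proof.
intros Hp; unfold rho; f_equal; [rewrite q_fun by assumption; reflexivity|].
change (Derive_n (q C p) 2 t) with (Derive (fun u => Derive (q C p) u) t).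
rewrite (Derive_ext _ (fun u => S1 (p, u))) by (intros; apply Derive_q, Hp).
apply is_derive_unique, support_C2, Hp.
Qed.

Lemma continuous_of_C2 f f1 f2 x : C2_antiperiodic f f1 f2 ->
  continuous f x /\ continuous f1 x /\ continuous f2 x.
Proof.
intros (D & D1 & C2 & _); split; [eapply continuous_of_derive, D|split; [eapply continuous_of_derive, D1|apply C2]].
Qed.

(** The front has velocity (q + q'') tau, and its part coming from p is orthogonal to
    q + q'' because trigonometric functions of frequency one lie in the kernel of the
    self-adjoint operator. *)
Lemma ART_area_eq p : inside K p ->
  ART_area C p = / 2 * RInt (fun t => (S (p, t) + S2 (p, t)) * S (p, t)) 0 PI.
Proof.
intros Hp; unfold ART_area; f_equal; assert (HC := support_C2 p Hp).
transitivity (RInt (fun t => (S (p, t) + S2 (p, t)) * S (p, t) + 1 * ((S (p, t) + S2 (p, t)) * (fst p * cos t + snd p * sin t))) 0 PI).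
- apply RInt_ext; intros t _; real_eq.
  assert (A : forall t, ART C p t = (fst p + (S (p, t) * cos t + S1 (p, t) * - sin t), snd p + (S (p, t) * sin t + S1 (p, t) * cos t))).
  { intros u; unfold ART; rewrite Derive_q, q_fun by assumption; reflexivity. }
  assert (V : velocity (ART C p) t = (- (S (p, t) + S2 (p, t)) * sin t, (S (p, t) + S2 (p, t)) * cos t)).
  { unfold velocity; destruct HC as (D & D1 & _).
    f_equal; rewrite (Derive_ext _ _ _ (fun u => f_equal _ (A u))); apply is_derive_unique;
    apply (is_derive_front (fun t => S (p, t)) (fun t => S1 (p, t)) (fun t => S2 (p, t))); [apply D|apply D1|apply D|apply D1]. }
  rewrite A, V; unfold cross; cbn [fst snd].
  generalize (sin2_cos2 t); unfold Rsqr; intros SC.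
  transitivity ((S (p, t) + S2 (p, t)) * (S (p, t) * (sin t * sin t + cos t * cos t)) + (S (p, t) + S2 (p, t)) * (fst p * cos t + snd p * sin t)); [ring|rewrite SC; ring].
- rewrite (RInt_lin (fun t => (S (p, t) + S2 (p, t)) * S (p, t)) (fun t => (S (p, t) + S2 (p, t)) * (fst p * cos t + snd p * sin t))).
  + rewrite (orthogonal_trig _ _ _ (fst p) (snd p) HC); real_eq; ring.
  + intros t; destruct (continuous_of_C2 _ _ _ t HC) as (c0 & c1 & c2); repeat cont_step.
  + intros t; destruct (continuous_of_C2 _ _ _ t HC) as (c0 & c1 & c2); assert (H1 := continuous_cos t); assert (H2 := continuous_sin t); repeat cont_step.
Qed.

Lemma energy_eq p : inside K p ->
  energy C p = - / 2 * RInt (fun t => (S (p, t) + S2 (p, t)) * S (p, t)) 0 PI.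
Proof.
intros Hp; unfold energy; destruct (excluded_middle_informative (int_oval C p)) as [h|h].
- rewrite ART_area_eq by assumption; ring.
- exfalso; apply h, (int_oval_iff C K HK), Hp.
Qed.

(** The energy is a quadratic form in q whose polarization is symmetric, which splits
    the difference into a linear and a quadratic term in the variation of q. *)
Lemma energy_difference p p' : inside K p -> inside K p' ->
  energy C p' - energy C p =
  - (RInt (fun t => (S (p, t) + S2 (p, t)) * S (p', t)) 0 PI - RInt (fun t => (S (p, t) + S2 (p, t)) * S (p, t)) 0 PI)
  - / 2 * RInt (fun t => ((S (p', t) + S2 (p', t)) - (S (p, t) + S2 (p, t))) * (S (p', t) - S (p, t))) 0 PI.
Proof.
intros Hp Hp'; rewrite !energy_eq by assumption.
assert (H := support_C2 p Hp); assert (H' := support_C2 p' Hp').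
assert (SA := self_adjoint _ _ _ _ _ _ H H'); simpl in SA.
assert (E : RInt (fun t => ((S (p', t) + S2 (p', t)) - (S (p, t) + S2 (p, t))) * (S (p', t) - S (p, t))) 0 PI =
  RInt (fun t => (S (p', t) + S2 (p', t)) * S (p', t)) 0 PI - 2 * RInt (fun t => (S (p, t) + S2 (p, t)) * S (p', t)) 0 PI
  + RInt (fun t => (S (p, t) + S2 (p, t)) * S (p, t)) 0 PI).
{ transitivity (RInt (fun t => (((S (p', t) + S2 (p', t)) * S (p', t) + -1 * ((S (p', t) + S2 (p', t)) * S (p, t)))
     + -1 * ((S (p, t) + S2 (p, t)) * S (p', t))) + 1 * ((S (p, t) + S2 (p, t)) * S (p, t))) 0 PI).
  - apply RInt_ext; intros t _; simpl; real_eq; ring.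
  - assert (CC : forall t, continuous (fun t => S (p, t)) t /\ continuous (fun t => S2 (p, t)) t /\
      continuous (fun t => S (p', t)) t /\ continuous (fun t => S2 (p', t)) t).
    { intros t; destruct (continuous_of_C2 _ _ _ t H) as (? & ? & ?), (continuous_of_C2 _ _ _ t H') as (? & ? & ?); auto. }
    rewrite (RInt_lin (fun t => ((S (p', t) + S2 (p', t)) * S (p', t) + -1 * ((S (p', t) + S2 (p', t)) * S (p, t)))
     + -1 * ((S (p, t) + S2 (p, t)) * S (p', t)))), (RInt_lin (fun t => (S (p', t) + S2 (p', t)) * S (p', t) + -1 * ((S (p', t) + S2 (p', t)) * S (p, t)))),
     (RInt_lin (fun t => (S (p', t) + S2 (p', t)) * S (p', t))), SA.
    1: real_eq; ring.
    all: intros t; destruct (CC t) as (? & ? & ? & ?); repeat cont_step. }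
rewrite E; field.
Qed.

Lemma RInt_mult_small (f g : R -> R) a b A B : a <= b -> (forall x, continuous f x) -> (forall x, continuous g x) ->
  (forall x, a <= x <= b -> Rabs (f x) <= A) -> (forall x, a <= x <= b -> Rabs (g x) <= B) ->
  Rabs (RInt (fun x => f x * g x) a b) <= (b - a) * (A * B).
Proof.
intros ab Cf Cg HA HB; apply abs_RInt_le_const; [exact ab| |].
- apply ex_RInt_cont; intros x; specialize (Cf x); specialize (Cg x); repeat cont_step.
- intros t Ht; rewrite Rabs_mult; apply Rmult_le_compat; auto using Rabs_pos.
Qed.

Lemma is_derive_quadratic (L Q : R -> R) (l c e : R) : is_derive L 0 l -> is_derive Q 0 0 ->
  is_derive (fun h => e + (- (L h - c) - / 2 * Q h)) 0 (- l).
Proof.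
intros DL DQ; auto_derive.
- sides; [exact (ex_intro _ _ DL)|exact (ex_intro _ _ DQ)].
- assert (E1 : Derive (fun h => L h) 0 = l) by apply is_derive_unique, DL.
  assert (E2 : Derive (fun h => Q h) 0 = 0) by apply is_derive_unique, DQ.
  rewrite E1, E2; ring.
Qed.

(** No mixed derivative of q in p and theta enters: after self_adjoint the linear term
    involves q + q'' only at the fixed point p, and the quadratic term is negligible. *)
Theorem energy_derivative p vx vy : inside K p ->
  is_derive (fun h => energy C (fst p + h * vx, snd p + h * vy)) 0
    (- RInt (fun t => (S (p, t) + S2 (p, t)) * pencil_support_dir K (dir_plane vx vy) (p, t)) 0 PI).
Proof.
intros Hp; set (v := dir_plane vx vy); generalize PI_RGT_0; intros Hpi.
set (P := fun h => (fst p + h * vx, snd p + h * vy) : pt).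
assert (TP : forall h t, translate (p, t) v h = (P h, t)) by (intros; apply translate_plane).
assert (P0 : P 0 = p) by (unfold P; rewrite !Rmult_0_l, !Rplus_0_r, <- surjective_pairing; reflexivity).
assert (Lin : locally 0 (fun h => inside K (P h))).
{ generalize (locally_translate K (p, 0) v Hp); apply locally_imp; intros h; rewrite TP; trivial. }
set (Sv := pencil_support_dir K v).
assert (HSv := C1_pencil_support K v); fold Sv in HSv.
assert (DS : forall h t, inside K (P h) -> is_derive (fun h => S (P h, t)) h (Sv (P h, t))).
{ intros h t Hh; apply (is_derive_ext (fun h => S (translate (p, t) v h))); [intros; rewrite TP; reflexivity|].
  replace (Sv (P h, t)) with (Sv (translate (p, t) v h)) by (rewrite TP; reflexivity); apply (C1_along_at K); [exact HSv|rewrite TP; exact Hh]. }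
assert (C2d : forall f : pt * R -> R, (forall z, inside K (fst z) -> continuous f z) -> forall t, continuity_2d_pt (fun h t => f (P h, t)) 0 t).
{ intros f Cf t; apply (continuity_2d_pt_ext (fun h t => f (translate (p, t) v h))); [intros; rewrite TP; reflexivity|].
  apply (continuity_2d_translate K); assumption. }
assert (HC := support_C2 p Hp).
set (rho0 := fun t => S (p, t) + S2 (p, t)).
assert (Crho0 : forall t, continuous rho0 t).
{ intros t; destruct (continuous_of_C2 _ _ _ t HC) as (? & ? & ?); unfold rho0; repeat cont_step. }
assert (Cpt : forall (f : pt * R -> R) t, (forall z, inside K (fst z) -> continuous f z) -> continuous (fun t => f (p, t)) t).
{ intros f t Cf; apply (continuous_comp (V := prod_UniformSpace (prod_UniformSpace R_UniformSpace R_UniformSpace) R_UniformSpace) (fun t : R => (p, t)) f).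
  + apply (cont_pair (U := prod_UniformSpace R_UniformSpace R_UniformSpace) (V := R_UniformSpace) (fun _ => p) (fun t => t)); [apply continuous_const|apply continuous_id].
  + apply Cf, Hp. }
(* The term linear in the variation of q is differentiated under the integral. *)
assert (Lp : is_derive (fun h => RInt (fun t => rho0 t * S (P h, t)) 0 PI) 0 (RInt (fun t => rho0 t * Sv (p, t)) 0 PI)).
{ replace (RInt (fun t => rho0 t * Sv (p, t)) 0 PI) with (RInt (fun t => Derive (fun h => rho0 t * S (P h, t)) 0) 0 PI).
  - apply (is_derive_RInt_param (fun h t => rho0 t * S (P h, t)) 0 PI 0).
    + revert Lin; apply locally_imp; intros h Hh t _.
      apply (ex_derive_scal (fun h => S (P h, t)) (rho0 t) h); eexists; apply DS, Hh.
    + intros t _; apply (continuity_2d_pt_ext_loc (fun h t => rho0 t * Sv (P h, t))).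
      * destruct (proj1 (locally_R 0 _) Lin) as [d Hd].
        exists d; intros h s Hh _; symmetry; rewrite Derive_scal; f_equal.
        apply is_derive_unique, DS, Hd; exact Hh.
      * apply continuity_2d_pt_mult; [|apply C2d; intros z Hz; apply HSv, Hz].
        apply (continuity_1d_2d_pt_comp rho0 (fun _ t => t)); [apply continuity_pt_filterlim, Crho0|apply continuity_2d_pt_id2].
    + revert Lin; apply locally_imp; intros h Hh; apply ex_RInt_cont; intros t.
      destruct (continuous_of_C2 _ _ _ t (support_C2 (P h) Hh)) as (? & ? & ?); specialize (Crho0 t); repeat cont_step.
  - apply RInt_ext; intros t _; rewrite Derive_scal; f_equal.
    replace (Sv (p, t)) with (Sv (P 0, t)) by (rewrite P0; reflexivity); apply is_derive_unique, DS; rewrite P0; exact Hp. }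
(* The quadratic term is o(h): q varies by O(h), and q + q'' tends to its value
   at p uniformly in the angle. *)
assert (Qp : is_derive (fun h => RInt (fun t => ((S (P h, t) + S2 (P h, t)) - (S (p, t) + S2 (p, t))) * (S (P h, t) - S (p, t))) 0 PI) 0 0).
{ set (kr := fun h t => S (P h, t) + S2 (P h, t)); set (kv := fun h t => Sv (P h, t)).
  assert (Ckr : forall t, 0 <= t <= PI -> continuity_2d_pt kr 0 t).
  { intros t _; apply continuity_2d_pt_plus; apply C2d; intros z Hz; [apply HSv, Hz|apply HS2, Hz]. }
  assert (Ckv : forall t, 0 <= t <= PI -> continuity_2d_pt kv 0 t).
  { intros t _; apply C2d; intros z Hz; apply HSv, Hz. }
  destruct (uniform_near kv 0 PI Ckv 1 Rlt_0_1) as (d1 & Hd1 & U1).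
  destruct (continuity_ab_maj (fun t => Rabs (Sv (p, t))) 0 PI) as (m & Hm & _); [lra| |].
  { intros c _; apply continuity_pt_filterlim.
    apply (cont_comp (fun t => Sv (p, t)) Rabs); [apply Cpt; intros z Hz; apply HSv, Hz|apply continuous_Rabs]. }
  set (M := Rabs (Sv (p, m)) + 1) in *.
  assert (HM : 0 < M) by (unfold M; generalize (Rabs_pos (Sv (p, m))); lra).
  destruct (proj1 (locally_R 0 _) Lin) as [d2 Hd2].
  assert (Bq : forall h, Rabs h < Rmin d1 d2 -> forall t, 0 <= t <= PI -> Rabs (S (P h, t) - S (p, t)) <= M * Rabs h).
  { intros h Hh t Ht.
    assert (Hh1 := Rlt_le_trans _ _ _ Hh (Rmin_l d1 d2)); assert (Hh2 := Rlt_le_trans _ _ _ Hh (Rmin_r d1 d2)).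
    assert (Bet : forall u, Rmin 0 h <= u <= Rmax 0 h -> Rabs u <= Rabs h).
    { intros u Hu; unfold Rmin, Rmax in Hu; destruct (Rle_dec 0 h) as [k|k].
      - rewrite !Rabs_pos_eq; lra.
      - rewrite !Rabs_left1; lra. }
    assert (Iu : forall u, Rabs u <= Rabs h -> inside K (P u)).
    { intros u Hu; apply Hd2; rewrite Rminus_0_r; lra. }
    destruct (MVT_gen (fun h => S (P h, t)) 0 h (fun h => Sv (P h, t))) as (c & Hc & Ec).
    - intros u Hu; apply DS, Iu, Bet; lra.
    - intros u Hu; apply continuity_pt_filterlim; eapply continuous_of_derive, DS, Iu, Bet, Hu.
    - rewrite P0, Rminus_0_r in Ec; rewrite Ec, Rabs_mult.
      apply Rmult_le_compat_r; [apply Rabs_pos|].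
      assert (A : Rabs (kv c t - kv 0 t) < 1) by (apply U1; [generalize (Bet c Hc); lra|exact Ht]).
      unfold kv in A; rewrite P0 in A; specialize (Hm t Ht); simpl in Hm; unfold M.
      generalize (Rabs_triang (Sv (P c, t) - Sv (p, t)) (Sv (p, t))).
      replace (Sv (P c, t) - Sv (p, t) + Sv (p, t)) with (Sv (P c, t)) by ring; lra. }
  apply is_derive_Reals; intros eps He.
  assert (He' : 0 < eps / (2 * PI * M)) by (apply Rdiv_lt_0_compat; [exact He|apply Rmult_lt_0_compat; lra]).
  destruct (uniform_near kr 0 PI Ckr _ He') as (d3 & Hd3 & U3).
  assert (Hd : 0 < Rmin (Rmin d1 d2) d3) by (repeat apply Rmin_pos; try assumption; apply cond_pos).
  exists (mkposreal _ Hd); intros h hn Hh; simpl in Hh.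
  rewrite P0, Rplus_0_l.
  assert (Z : RInt (fun t => (S (p, t) + S2 (p, t) - (S (p, t) + S2 (p, t))) * (S (p, t) - S (p, t))) 0 PI = 0).
  { transitivity (RInt (fun _ : R => 0) 0 PI); [apply RInt_ext; intros; simpl; real_eq; ring|].
    rewrite (RInt_const (V := R_CompleteNormedModule)); unfold scal; simpl; unfold mult; simpl; real_eq; ring. }
  rewrite Z, !Rminus_0_r; unfold Rdiv; rewrite Rabs_mult, Rabs_inv.
  assert (Ph : 0 < Rabs h) by (apply Rabs_pos_lt, hn).
  assert (Hh1 := Rlt_le_trans _ _ _ Hh (Rmin_l (Rmin d1 d2) d3)); assert (Hh3 := Rlt_le_trans _ _ _ Hh (Rmin_r (Rmin d1 d2) d3)).
  assert (Ih : inside K (P h)).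
  { apply Hd2; rewrite Rminus_0_r; apply (Rlt_le_trans _ _ _ Hh1), Rmin_r. }
  apply (Rmult_lt_reg_r (Rabs h)); [exact Ph|].
  rewrite Rmult_assoc, Rinv_l, Rmult_1_r by lra.
  apply Rle_lt_trans with ((PI - 0) * (eps / (2 * PI * M) * (M * Rabs h))).
  - apply (RInt_mult_small (fun t => S (P h, t) + S2 (P h, t) - (S (p, t) + S2 (p, t))) (fun t => S (P h, t) - S (p, t))); [lra| | | |].
    + intros t; destruct (continuous_of_C2 _ _ _ t (support_C2 (P h) Ih)) as (? & ? & ?), (continuous_of_C2 _ _ _ t HC) as (? & ? & ?); repeat cont_step.
    + intros t; destruct (continuous_of_C2 _ _ _ t (support_C2 (P h) Ih)) as (? & ? & ?), (continuous_of_C2 _ _ _ t HC) as (? & ? & ?); repeat cont_step.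
    + intros t Ht; generalize (U3 h Hh3 t Ht); unfold kr; rewrite P0; lra.
    + intros t Ht; apply Bq; assumption.
  - replace ((PI - 0) * (eps / (2 * PI * M) * (M * Rabs h))) with (eps / 2 * Rabs h) by (field; lra).
    apply Rmult_lt_compat_r; lra. }
apply (is_derive_ext_loc (fun h => energy C p + (- (RInt (fun t => rho0 t * S (P h, t)) 0 PI - RInt (fun t => rho0 t * S (p, t)) 0 PI)
   - / 2 * RInt (fun t => ((S (P h, t) + S2 (P h, t)) - (S (p, t) + S2 (p, t))) * (S (P h, t) - S (p, t))) 0 PI))).
- revert Lin; apply locally_imp; intros h Hh.
  unfold rho0; rewrite <- (energy_difference p (P h) Hp Hh); unfold P; real_eq; ring.
- apply (is_derive_quadratic _ _ _ _ _ Lp Qp).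
Qed.

End Energy.

(** * A point of positive energy *)

(** At a common zero of f and sin, f^2 is of second order and sin of first. *)
Lemma sqr_cot_small (f : R -> R) (x0 d : R) : is_derive f x0 d -> f x0 = 0 -> sin x0 = 0 -> cos x0 <> 0 ->
  forall eps, 0 < eps -> exists del, 0 < del /\ forall x, Rabs (x - x0) < del -> x <> x0 -> sin x <> 0 ->
    Rabs (f x * f x * (cos x / sin x)) < eps.
Proof.
intros D f0 s0 c0 eps He.
set (s := slope f x0 d); set (t := slope sin x0 (cos x0)).
assert (Cs := continuous_slope f x0 d D); fold s in Cs.
assert (Ct := continuous_slope sin x0 (cos x0) (is_derive_sin x0)); fold t in Ct.
assert (t0 : t x0 = cos x0) by apply slope_base.
set (k := fun x => s x * s x * (x - x0) * cos x / t x).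
assert (Ck : continuous k x0).
{ assert (t x0 <> 0) by (rewrite t0; exact c0).
  assert (Cc := continuous_cos x0); unfold k; repeat cont_step. }
assert (k0 : k x0 = 0) by (unfold k; rewrite t0; field; exact c0).
destruct (proj1 (continuous_R k x0) Ck (mkposreal eps He)) as [del Hd].
exists del; split; [apply cond_pos|intros x Hx nx sx].
specialize (Hd x Hx); rewrite k0, Rminus_0_r in Hd; simpl in Hd.
replace (f x * f x * (cos x / sin x)) with (k x); [exact Hd|].
assert (Ef : f x = s x * (x - x0)) by (unfold s; rewrite <- slope_eq; lra).
assert (Es : sin x = t x * (x - x0)) by (unfold t; rewrite <- slope_eq; lra).
rewrite Ef, Es; unfold k; field; split; [lra|].
intros h; rewrite h in Es; lra.
Qed.

(** Wirtinger's inequality with its equality case. The derivative of the integral of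
    f'^2 - f^2 up to x, minus f^2 cot x, is (f' - f cot x)^2; this primitive
    therefore grows from 0 to a value that is at most 0 by hypothesis, so it is
    constant and f / sin is constant as well. *)
Lemma wirtinger_rigid (f f1 f2 : R -> R) :
  (forall x, is_derive f x (f1 x)) -> (forall x, is_derive f1 x (f2 x)) -> (forall x, continuous f2 x) ->
  f 0 = 0 -> f PI = 0 -> 0 <= RInt (fun x => (f x + f2 x) * f x) 0 PI ->
  exists c, forall x, 0 <= x <= PI -> f x = c * sin x.
Proof.
intros D D1 C2 F0 FP HI; generalize PI_RGT_0; intros Hpi.
assert (Cf : forall x, continuous f x) by (intros; eapply continuous_of_derive, D).
assert (C1 : forall x, continuous f1 x) by (intros; eapply continuous_of_derive, D1).
set (w := fun x => f1 x * f1 x - f x * f x).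
assert (Cw : forall x, continuous w x).
{ intros x; specialize (Cf x); specialize (C1 x); unfold w; repeat cont_step. }
set (I := fun x => RInt w 0 x).
assert (DI : forall x, is_derive I x (w x)).
{ intros x; apply (is_derive_RInt (V := R_NormedModule) w _ 0); [|apply Cw].
  apply filter_forall; intros u; apply (RInt_correct (V := R_CompleteNormedModule)), ex_RInt_cont, Cw. }
assert (CI : forall x, continuous I x) by (intros; eapply continuous_of_derive, DI).
assert (I0 : I 0 = 0) by (unfold I; rewrite RInt_point; reflexivity).
assert (IP : I PI <= 0).
{ assert (E : RInt (fun x => (f x + f2 x) * f x + 1 * w x) 0 PI = 0).
  { rewrite (RInt_of_derive (fun x => f1 x * f x)).
    - rewrite F0, FP; real_eq; ring.
    - intros x; replace ((f x + f2 x) * f x + 1 * w x) with (f2 x * f x + f1 x * f1 x) by (unfold w; ring).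
      apply (is_derive_mult (K := R_AbsRing) f1 f x (f2 x) (f1 x) (D1 x) (D x) Rmult_comm).
    - intros x; specialize (Cf x); specialize (Cw x); specialize (C2 x); repeat cont_step. }
  rewrite (RInt_lin (fun x => (f x + f2 x) * f x) w) in E; [unfold I; lra| |exact Cw].
  intros x; specialize (Cf x); specialize (C2 x); repeat cont_step. }
set (W := fun x => I x - f x * f x * (cos x / sin x)).
set (W' := fun x => (f1 x - f x * (cos x / sin x)) * (f1 x - f x * (cos x / sin x))).
assert (DW : forall x, 0 < x < PI -> is_derive W x (W' x)).
{ intros x Hx; assert (Sp : 0 < sin x) by (apply sin_gt_0; lra).
  assert (G : forall J : R -> R, is_derive J x (w x) -> is_derive (fun x => J x - f x * f x * (cos x / sin x)) x (W' x)).
  { intros J DJ; auto_derive.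
    - sides; try lra; [exact (ex_intro _ _ DJ)|exact (ex_intro _ _ (D x))|exact (ex_intro _ _ (D x))].
    - assert (E1 : Derive (fun x => J x) x = w x) by apply is_derive_unique, DJ.
      assert (E2 : Derive (fun x => f x) x = f1 x) by apply is_derive_unique, D.
      rewrite E1, E2; unfold W', w.
      transitivity (f1 x * f1 x - f x * f x - 2 * f x * f1 x * (cos x / sin x) + f x * f x * ((sin x * sin x + cos x * cos x) / (sin x * sin x))).
      + field; lra.
      + field; lra. }
  exact (G I (DI x)). }
assert (MW : forall x y, 0 < x -> x < y -> y < PI -> W x <= W y).
{ intros x y h1 h2 h3; apply (nondecreasing_of_derive W W' x y h2).
  - intros u Hu; apply DW; lra.
  - intros u _; apply Rle_0_sqr. }
assert (W0 : forall x, 0 < x < PI -> W x = 0).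
{ intros x Hx; apply Rle_antisym; apply Rnot_lt_le; intros h.
  - set (e := W x / 2).
    destruct (sqr_cot_small f PI (f1 PI) (D PI) FP sin_PI ltac:(rewrite cos_PI; lra) e ltac:(unfold e; lra)) as (d1 & Hd1 & B1).
    destruct (proj1 (continuous_R I PI) (CI PI) (mkposreal e ltac:(unfold e; lra))) as [d2 B2]; simpl in B2.
    set (m := Rmin (Rmin d1 d2) (PI - x) / 2).
    assert (Hm : 0 < m /\ m < d1 /\ m < d2 /\ m < PI - x).
    { assert (P : 0 < Rmin (Rmin d1 d2) (PI - x)) by (repeat apply Rmin_pos; try lra; apply cond_pos).
      generalize (Rmin_l (Rmin d1 d2) (PI - x)) (Rmin_r (Rmin d1 d2) (PI - x)) (Rmin_l d1 d2) (Rmin_r d1 d2).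
      unfold m; intros; repeat split; lra. }
    assert (Ry : Rabs (PI - m - PI) = m) by (replace (PI - m - PI) with (- m) by ring; rewrite Rabs_Ropp; apply Rabs_pos_eq; lra).
    assert (Sp : 0 < sin (PI - m)) by (apply sin_gt_0; lra).
    specialize (B1 (PI - m) ltac:(lra) ltac:(lra) ltac:(lra)); specialize (B2 (PI - m) ltac:(lra)).
    apply Rabs_def2 in B1; apply Rabs_def2 in B2.
    assert (M := MW x (PI - m) ltac:(lra) ltac:(lra) ltac:(lra)).
    unfold W at 2 in M; unfold e in *; lra.
  - set (e := - W x / 2).
    destruct (sqr_cot_small f 0 (f1 0) (D 0) F0 sin_0 ltac:(rewrite cos_0; lra) e ltac:(unfold e; lra)) as (d1 & Hd1 & B1).
    destruct (proj1 (continuous_R I 0) (CI 0) (mkposreal e ltac:(unfold e; lra))) as [d2 B2]; simpl in B2.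
    set (m := Rmin (Rmin d1 d2) x / 2).
    assert (Hm : 0 < m /\ m < d1 /\ m < d2 /\ m < x).
    { assert (P : 0 < Rmin (Rmin d1 d2) x) by (repeat apply Rmin_pos; try lra; apply cond_pos).
      generalize (Rmin_l (Rmin d1 d2) x) (Rmin_r (Rmin d1 d2) x) (Rmin_l d1 d2) (Rmin_r d1 d2).
      unfold m; intros; repeat split; lra. }
    assert (Ry : Rabs (m - 0) = m) by (rewrite Rminus_0_r; apply Rabs_pos_eq; lra).
    assert (Sp : 0 < sin m) by (apply sin_gt_0; lra).
    specialize (B1 m ltac:(lra) ltac:(lra) ltac:(lra)); specialize (B2 m ltac:(lra)).
    apply Rabs_def2 in B1; apply Rabs_def2 in B2.
    assert (M := MW m x ltac:(lra) ltac:(lra) ltac:(lra)).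
    unfold W at 1 in M; unfold e in *; lra. }
assert (Eq : forall x, 0 < x < PI -> f1 x * sin x = f x * cos x).
{ intros x Hx; assert (Sp : 0 < sin x) by (apply sin_gt_0; lra).
  assert (Z : W' x = 0).
  { rewrite <- (is_derive_unique W x (W' x) (DW x Hx)); apply is_derive_unique.
    apply (is_derive_ext_loc (fun _ => 0)).
    - generalize (locally_and x _ _ (locally_lt (fun _ => 0) (fun u => u) x (cont_const _ _) (continuous_id _) (proj1 Hx))
        (locally_lt (fun u => u) (fun _ => PI) x (continuous_id _) (cont_const _ _) (proj2 Hx))).
      apply locally_imp; intros u Hu; symmetry; apply W0; exact Hu.
    - apply (is_derive_const (K := R_AbsRing) (V := R_NormedModule)). }
  unfold W' in Z; apply Rmult_integral in Z.
  assert (Z' : f1 x = f x * (cos x / sin x)) by lra.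
  rewrite Z'; field; lra. }
set (h := fun x => f x / sin x).
assert (Dh : forall x, 0 < x < PI -> is_derive h x 0).
{ intros x Hx; assert (Sp : 0 < sin x) by (apply sin_gt_0; lra).
  replace 0 with ((f1 x * sin x - f x * cos x) / sin x ^ 2) by (rewrite Eq by assumption; field; lra).
  apply is_derive_div; [apply D|apply is_derive_sin|lra]. }
assert (Hh : forall x y, 0 < x -> x < y -> y < PI -> h x = h y).
{ intros x y h1 h2 h3; apply Rle_antisym.
  - apply (nondecreasing_of_derive h (fun _ => 0) x y h2); intros; [apply Dh|]; lra.
  - apply Ropp_le_cancel, (nondecreasing_of_derive (fun u => - h u) (fun _ => - 0) x y h2); intros; [|lra].
    apply (is_derive_opp (K := R_AbsRing) (V := R_NormedModule)), Dh; lra. }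
exists (h (PI / 2)); intros x Hx.
destruct (Req_dec x 0) as [->|n0]; [rewrite sin_0; lra|].
destruct (Req_dec x PI) as [->|nP]; [rewrite sin_PI; lra|].
assert (Sp : 0 < sin x) by (apply sin_gt_0; lra).
assert (Ex : h x = h (PI / 2)).
{ destruct (Rtotal_order x (PI / 2)) as [k|[->|k]]; [apply Hh|reflexivity|symmetry; apply Hh]; lra. }
rewrite <- Ex; unfold h; field; lra.
Qed.

Lemma is_derive_add_cos (g : R -> R) t l A : is_derive g t l ->
  is_derive (fun u => g u - A * cos u) t (l + A * sin t).
Proof.
intros D; auto_derive; [sides; exact (ex_intro _ _ D)|].
assert (E : Derive (fun u => g u) t = l) by apply is_derive_unique, D.
rewrite E; ring.
Qed.

Lemma is_derive_add_sin (g : R -> R) t l A : is_derive g t l ->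
  is_derive (fun u => g u + A * sin u) t (l + A * cos t).
Proof.
intros D; auto_derive; [sides; exact (ex_intro _ _ D)|].
assert (E : Derive (fun u => g u) t = l) by apply is_derive_unique, D.
rewrite E; ring.
Qed.

Section Symmetry.
Context (C : oval) (K : turning_curve) (HK : parametrizes K C).
Local Notation S := (pencil_support K).
Local Notation S1 := (pencil_support_dir K dir_angle).
Context (S2 : pt * R -> R) (HS2 : C1_along K dir_angle S1 S2).

(** Subtracting S (p, 0) cos t makes the function vanish at 0 and at PI without changing
    the energy, and then Wirtinger's inequality is an equality. A support function
    of this form means that all image lines pass through p + (A, B). *)
Lemma concurrent_of_energy_le p : inside K p -> energy C p <= 0 ->
  exists A B, forall t, S (p, t) = A * cos t + B * sin t.
Proof.
intros Hp HE; generalize PI_RGT_0; intros Hpi.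
assert (HC := support_C2 K S2 HS2 p Hp).
rewrite (energy_eq C K HK S2 HS2 p Hp) in HE.
set (A := S (p, 0)).
set (f := fun t => S (p, t) - A * cos t); set (f1 := fun t => S1 (p, t) + A * sin t); set (f2 := fun t => S2 (p, t) + A * cos t).
assert (Anti : forall t, S (p, t + PI) = - S (p, t)) by (intros; apply pencil_support_antiperiodic, Hp).
destruct (wirtinger_rigid f f1 f2) as [B HB].
- intros t; apply (is_derive_add_cos (fun t => S (p, t)) t), HC.
- intros t; apply (is_derive_add_sin (fun t => S1 (p, t)) t), HC.
- intros t; destruct (continuous_of_C2 _ _ _ t HC) as (? & ? & ?); assert (Cc := continuous_cos t); unfold f2; repeat cont_step.
- unfold f; rewrite cos_0; unfold A; ring.
- unfold f; rewrite cos_PI; unfold A; generalize (Anti 0); rewrite Rplus_0_l; lra.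
- assert (E : RInt (fun x => (f x + f2 x) * f x) 0 PI = RInt (fun t => (S (p, t) + S2 (p, t)) * S (p, t)) 0 PI).
  { transitivity (RInt (fun t => (S (p, t) + S2 (p, t)) * S (p, t) + 1 * ((S (p, t) + S2 (p, t)) * (- A * cos t + 0 * sin t))) 0 PI).
    - apply RInt_ext; intros t _; real_eq; unfold f, f2; ring.
    - rewrite (RInt_lin (fun t => (S (p, t) + S2 (p, t)) * S (p, t)) (fun t => (S (p, t) + S2 (p, t)) * (- A * cos t + 0 * sin t))).
      + rewrite (orthogonal_trig _ _ _ _ _ HC); real_eq; ring.
      + intros t; destruct (continuous_of_C2 _ _ _ t HC) as (? & ? & ?); repeat cont_step.
      + intros t; destruct (continuous_of_C2 _ _ _ t HC) as (? & ? & ?); assert (Cc := continuous_cos t); assert (Cs := continuous_sin t); repeat cont_step. }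
  rewrite E; lra.
- exists A, B; intros t.
  set (d := fun t => Rabs (S (p, t) - (A * cos t + B * sin t))).
  assert (Per : forall t, d (t + PI) = d t).
  { intros u; unfold d; rewrite Anti, neg_cos, neg_sin, <- Rabs_Ropp; f_equal; ring. }
  destruct (mod_period PI 0 t Hpi) as [k Hk].
  assert (Z : d t = 0).
  { rewrite <- (periodic_Z d PI Per (- k) t), opp_IZR; replace (t + - IZR k * PI) with (t - IZR k * PI) by ring.
    unfold d; specialize (HB (t - IZR k * PI) ltac:(lra)); unfold f in HB.
    replace (S (p, t - IZR k * PI) - _) with 0 by lra; apply Rabs_R0. }
  unfold d in Z; destruct (Req_dec (S (p, t) - (A * cos t + B * sin t)) 0) as [e|e]; [lra|].
  apply Rabs_no_R0 in e; contradiction.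
Qed.

Lemma exists_normal (w : pt) : exists theta, dot (nvec theta) w = 0.
Proof.
destruct w as [x y]; unfold dot, nvec; simpl.
destruct (Req_dec (x * x + y * y) 0) as [h|h].
- exists 0; assert (x = 0) by nra; assert (y = 0) by nra; subst; ring.
- assert (P : 0 < x * x + y * y) by nra.
  assert (Q := sqrt_lt_R0 _ P); assert (QQ := sqrt_sqrt _ (Rlt_le _ _ P)).
  set (n := sqrt (x * x + y * y)) in *.
  destruct (polar_unit (y / n) (- x / n)) as (th & Hc & Hs).
  + transitivity ((x * x + y * y) / (n * n)); [field; lra|rewrite QQ; field; lra].
  + exists th; rewrite <- Hc, <- Hs; field; lra.
Qed.

Lemma image_chord_through p A B : inside K p -> (forall t, S (p, t) = A * cos t + B * sin t) ->
  forall s b, is_chord K p s b ->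
  orient (at_angle K (s + PI)) (at_angle K (b + PI)) (fst p + A, snd p + B) = 0.
Proof.
intros Hp HS s b Hc; unfold orient.
set (w := vsub (at_angle K (b + PI)) (at_angle K (s + PI))).
destruct (exists_normal w) as [th Hth].
assert (N : w <> (0, 0)).
{ intros e; apply (at_angle_neq K (s + PI) (b + PI)); [destruct Hc; lra|].
  unfold w, vsub, at_angle in *; simpl in e; injection e; intros; f_equal; lra. }
apply (line_normal th w); [exact N|exact Hth|].
assert (E : height K th (s + PI) = height K th (b + PI)).
{ unfold w, height, dot, vsub, nvec in *; simpl in *; lra. }
assert (H := image_chord_height K p th (s + PI) (b + PI) Hp).
replace (s + PI - PI) with s in H by ring; replace (b + PI - PI) with b in H by ring.
specialize (H Hc E); specialize (HS th); unfold pencil_support in HS; simpl in HS; rewrite <- H in HS.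
unfold height, dot, vsub, nvec in *; simpl in *; lra.
Qed.

(** A chord joining points with parallel tangents is mapped to itself, so any common
    point of the image lines is the intersection of two such diameters. *)
Lemma diameters_meet : exists O, inside K O /\ is_chord K O 0 PI /\ is_chord K O (PI / 2) (PI / 2 + PI) /\
  forall Z, orient (at_angle K 0) (at_angle K PI) Z = 0 ->
    orient (at_angle K (PI / 2)) (at_angle K (PI / 2 + PI)) Z = 0 -> Z = O.
Proof.
generalize PI_RGT_0; intros Hpi.
assert (P1 := orient_pos K 0 PI (PI / 2 + PI) ltac:(lra) ltac:(lra) ltac:(lra)).
assert (P2 := orient_pos K 0 (PI / 2) PI ltac:(lra) ltac:(lra) ltac:(lra)).
assert (P3 := orient_pos K (PI / 2) (PI / 2 + PI) (0 + 2 * PI) ltac:(lra) ltac:(lra) ltac:(lra)).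
assert (P4 := orient_pos K (PI / 2) PI (PI / 2 + PI) ltac:(lra) ltac:(lra) ltac:(lra)).
rewrite at_angle_periodic in P3.
assert (N0 := at_angle_neq K 0 PI ltac:(lra)).
assert (TA : forall mu phi, tang K phi (fst (at_angle K 0) + mu * (fst (at_angle K PI) - fst (at_angle K 0)), snd (at_angle K 0) + mu * (snd (at_angle K PI) - snd (at_angle K 0)))
   = (1 - mu) * tang K phi (at_angle K 0) + mu * tang K phi (at_angle K PI)) by (intros; apply tang_affine).
assert (T0 : forall phi, tang K phi (at_angle K 0) = 0 -> at_angle K 0 = at_angle K phi).
{ intros phi; apply on_boundary; intros; apply tang_nonneg. }
assert (TP : forall phi, tang K phi (at_angle K PI) = 0 -> at_angle K PI = at_angle K phi).
{ intros phi; apply on_boundary; intros; apply tang_nonneg. }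
assert (NN := fun phi psi => tang_nonneg K phi psi).
unfold is_chord, chord_side.
revert P1 P2 P3 P4 N0 TA; specialize (NN) ; intros P1 P2 P3 P4 N0 TA.
set (A := at_angle K 0) in *; set (B := at_angle K PI) in *.
set (M := at_angle K (PI / 2)) in *; set (N := at_angle K (PI / 2 + PI)) in *.
set (D := cross (vsub B A) (vsub N M)).
assert (HD : D = orient A B N + orient A M B).
{ unfold D, orient, cross, vsub; simpl; ring. }
assert (HD2 : D = orient M N A + orient M B N).
{ unfold D, orient, cross, vsub; simpl; ring. }
assert (PD : 0 < D) by lra.
set (mu := orient M N A / D).
assert (Hmu : 0 < mu < 1).
{ unfold mu; split; [apply Rdiv_lt_0_compat; lra|].
  apply (Rmult_lt_reg_r D); [lra|]; unfold Rdiv; rewrite Rmult_assoc, Rinv_l, Rmult_1_r by lra; lra. }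
set (O := (fst A + mu * (fst B - fst A), snd A + mu * (snd B - snd A)) : pt).
assert (O1 : orient A B O = 0) by (unfold O, orient, cross, vsub; simpl; ring).
assert (O2 : orient M N O = 0).
{ transitivity (orient M N A - mu * D).
  - unfold O, D, orient, cross, vsub; simpl; ring.
  - unfold mu; field; lra. }
exists O; split; [|split; [|split]].
- intros phi; unfold O; rewrite TA.
  generalize (NN phi 0) (NN phi PI); fold A; fold B; intros h1 h2.
  destruct h1 as [h1|h1].
  + assert (0 < (1 - mu) * tang K phi A) by (apply Rmult_lt_0_compat; lra).
    assert (0 <= mu * tang K phi B) by (apply Rmult_le_pos; lra); lra.
  + destruct h2 as [h2|h2].
    * rewrite <- h1; assert (0 < mu * tang K phi B) by (apply Rmult_lt_0_compat; lra); lra.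
    * exfalso; apply N0; rewrite (T0 phi), (TP phi); congruence.
- split; [lra|exact O1].
- split; [lra|exact O2].
- intros Z Z1 Z2.
  assert (X1 : cross (vsub B A) (vsub Z O) = 0).
  { transitivity (orient A B Z - orient A B O); [unfold orient, cross, vsub; simpl; ring|lra]. }
  assert (X2 : cross (vsub N M) (vsub Z O) = 0).
  { transitivity (orient M N Z - orient M N O); [unfold orient, cross, vsub; simpl; ring|lra]. }
  rewrite (surjective_pairing Z), (surjective_pairing O); f_equal.
  + apply Rminus_diag_uniq, (Rmult_eq_reg_l D); [|lra].
    transitivity ((fst B - fst A) * cross (vsub N M) (vsub Z O) * -1 + (fst N - fst M) * cross (vsub B A) (vsub Z O)).
    * unfold D, cross, vsub; simpl; ring.
    * rewrite X1, X2; ring.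
  + apply Rminus_diag_uniq, (Rmult_eq_reg_l D); [|lra].
    transitivity ((snd B - snd A) * cross (vsub N M) (vsub Z O) * -1 + (snd N - snd M) * cross (vsub B A) (vsub Z O)).
    * unfold D, cross, vsub; simpl; ring.
    * rewrite X1, X2; ring.
Qed.

(** If the second endpoint b of the chord from t came before t + PI, then by
    monotonicity the chord from b would end before the one from t + PI, that is,
    t + 2 PI < b + PI, a contradiction; likewise if b came after t + PI. *)
Lemma all_diameters_through O : inside K O ->
  (forall s b, is_chord K O s b -> is_chord K O (s + PI) (b + PI)) ->
  forall t, is_chord K O t (t + PI).
Proof.
intros HO H t.
assert (Hc := second_spec K O t HO); set (b := second K O t) in *.
assert (H1 := H _ _ Hc); assert (H2 := is_chord_swap K O t b Hc).
destruct (Rtotal_order b (t + PI)) as [h|[h|h]].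
- generalize (is_chord_mono K O _ _ _ _ HO H2 H1 h); lra.
- rewrite <- h; exact Hc.
- generalize (is_chord_mono K O _ _ _ _ HO H1 H2 h); lra.
Qed.

(** Parallel tangents at the endpoints of concurrent chords make the ratio of the two
    distances from O to these tangents constant in t; half a turn later the ratio is
    inverted, so it is 1. *)
Lemma antipode_of_diameters O : inside K O -> (forall t, is_chord K O t (t + PI)) ->
  forall t, at_angle K (t + PI) = vsub (vscal 2 O) (at_angle K t).
Proof.
intros HO HD; generalize PI_RGT_0; intros Hpi.
set (h := fun t => tang K t O).
set (k := fun t => - (sin t * (snd O - cy K t) + cos t * (fst O - cx K t))).
assert (Dh : forall t, is_derive h t (k t)) by (intros; apply is_derive_tang_angle).
assert (Col : forall t, h (t + PI) * k t = k (t + PI) * h t).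
{ intros t; destruct (HD t) as [_ E]; unfold chord_side, orient, cross, vsub, at_angle in E; simpl in E.
  generalize (sin2_cos2 t); unfold Rsqr; intros SC.
  apply Rminus_diag_uniq; unfold h, k, tang; rewrite neg_cos, neg_sin.
  transitivity ((sin t * sin t + cos t * cos t) * ((cx K (t + PI) - cx K t) * (snd O - cy K t) - (cy K (t + PI) - cy K t) * (fst O - cx K t))); [ring|].
  rewrite E; ring. }
set (r := fun t => h (t + PI) / h t).
assert (Dr : forall t, is_derive r t 0).
{ intros t; unfold r; assert (Hp : 0 < h t) by apply HO.
  replace 0 with ((k (t + PI) * h t - h (t + PI) * k t) / h t ^ 2) by (rewrite Col; field; lra).
  apply (is_derive_div (fun t => h (t + PI)) h); [|apply Dh|lra].
  replace (k (t + PI)) with (1 * k (t + PI)) by ring.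
  apply (is_derive_comp (K := R_AbsRing) (V := R_NormedModule) h (fun t => t + PI)); [apply Dh|auto_derive; [trivial|ring]]. }
intros t.
assert (P1 : 0 < h t) by apply HO; assert (P2 : 0 < h (t + PI)) by apply HO.
assert (E : r (t + PI) = r t) by (apply constant_of_derive, Dr).
unfold r in E; replace (t + PI + PI) with (t + 2 * PI) in E by ring.
assert (E2 : h (t + 2 * PI) = h t) by apply tang_periodic; rewrite E2 in E.
assert (Sq : h t * h t = h (t + PI) * h (t + PI)).
{ transitivity (h t / h (t + PI) * h t * h (t + PI)); [field; lra|rewrite E; field; lra]. }
assert (Eh : h (t + PI) = h t) by nra.
assert (Ek : k (t + PI) = k t).
{ generalize (Col t); rewrite Eh; intros G; apply (Rmult_eq_reg_r (h t)); lra. }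
generalize (sin2_cos2 t); unfold Rsqr; intros SC.
unfold h, k, tang in Eh, Ek; rewrite neg_cos, neg_sin in Eh, Ek.
unfold at_angle, vsub, vscal; simpl; f_equal; apply Rminus_diag_uniq.
- transitivity ((sin t * sin t + cos t * cos t) * (cx K (t + PI) - (2 * fst O - cx K t))); [rewrite SC; ring|].
  set (X := cx K (t + PI) - (2 * fst O - cx K t)) in *; set (Y := cy K (t + PI) - (2 * snd O - cy K t)).
  assert (G1 : cos t * Y = sin t * X) by (unfold X, Y; lra).
  assert (G2 : sin t * Y = - (cos t * X)) by (unfold X, Y; lra).
  transitivity (sin t * (sin t * X) + cos t * (cos t * X)); [ring|].
  rewrite <- G1; replace (cos t * X) with (- (sin t * Y)) by lra; ring.
- transitivity ((sin t * sin t + cos t * cos t) * (cy K (t + PI) - (2 * snd O - cy K t))); [rewrite SC; ring|].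
  set (X := cx K (t + PI) - (2 * fst O - cx K t)) in *; set (Y := cy K (t + PI) - (2 * snd O - cy K t)).
  assert (G1 : cos t * Y = sin t * X) by (unfold X, Y; lra).
  assert (G2 : sin t * Y = - (cos t * X)) by (unfold X, Y; lra).
  transitivity (sin t * (sin t * Y) + cos t * (cos t * Y)); [ring|].
  rewrite G1, G2; ring.
Qed.

(** With O the intersection of two diameters, energy at most 0 makes the image lines of
    the pencil at O pass through O itself. Then the chords through O are permuted by
    the antipodal map, all of them are diameters, and the oval is symmetric about O. *)
Theorem exists_positive_energy : ~ centrally_symmetric C -> exists O, inside K O /\ 0 < energy C O.
Proof.
intros NS; generalize PI_RGT_0; intros Hpi.
destruct diameters_meet as (O & HO & C0 & C1 & U).
exists O; split; [exact HO|apply Rnot_le_lt; intros HE; apply NS].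
destruct (concurrent_of_energy_le O HO HE) as (A & B & HS).
assert (Th := image_chord_through O A B HO HS).
assert (FO : (fst O + A, snd O + B) = O).
{ apply U.
  - generalize (Th _ _ C0); rewrite Rplus_0_l; replace (PI + PI) with (0 + 2 * PI) by ring; rewrite at_angle_periodic.
    unfold orient, cross, vsub; simpl; lra.
  - generalize (Th _ _ C1); replace (PI / 2 + PI + PI) with (PI / 2 + 2 * PI) by ring; rewrite at_angle_periodic.
    unfold orient, cross, vsub; simpl; lra. }
rewrite FO in Th.
assert (Comm : forall s b, is_chord K O s b -> is_chord K O (s + PI) (b + PI)).
{ intros s b Hc; split; [destruct Hc; lra|exact (Th s b Hc)]. }
assert (Anti := antipode_of_diameters O HO (all_diameters_through O HO Comm)).
exists O; intros z; rewrite !(on_oval_iff C K HK); split; intros [phi E]; exists (phi + PI); rewrite Anti.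
- rewrite E; reflexivity.
- rewrite <- E; destruct z; unfold vsub, vscal; simpl; f_equal; ring.
Qed.

End Symmetry.

(** * Maximizers *)

Section Main.
Context (C : oval).

Lemma energy_partials p : int_oval C p ->
  is_derive (fun x => energy C (x, snd p)) (fst p) (- RInt (fun theta => rho C p theta * q_1 C p theta) 0 PI) /\
  is_derive (fun y => energy C (fst p, y)) (snd p) (- RInt (fun theta => rho C p theta * q_2 C p theta) 0 PI).
Proof.
destruct (exists_turning_curve C) as [K HK]; destruct (C1_pencil_support_dir K dir_angle) as [S2 HS2].
intros Hp; apply (int_oval_iff C K HK) in Hp.
assert (Lin : forall vx vy, locally 0 (fun h => inside K (fst p + h * vx, snd p + h * vy))).
{ intros vx vy; generalize (locally_translate K (p, 0) (dir_plane vx vy) Hp); apply locally_imp.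
  intros h; rewrite translate_plane; trivial. }
assert (DS : forall vx vy t, is_derive (fun h => q C (fst p + h * vx, snd p + h * vy) t) 0 (pencil_support_dir K (dir_plane vx vy) (p, t))).
{ intros vx vy t; apply (is_derive_ext_loc (fun h => pencil_support K (translate (p, t) (dir_plane vx vy) h))).
  - generalize (Lin vx vy); apply locally_imp; intros h Hh; rewrite translate_plane; symmetry; apply (q_eq C K HK), Hh.
  - apply (C1_pencil_support K (dir_plane vx vy) (p, t) Hp). }
assert (Shift : forall (F : R -> R) x l, is_derive (fun h => F (x + h)) 0 l -> is_derive F x l).
{ intros F x l D; apply (is_derive_ext (fun u => F (x + (u - x)))); [intros u; f_equal; ring|].
  replace l with (1 * l) by ring.
  apply (is_derive_comp (K := R_AbsRing) (V := R_NormedModule) (fun h => F (x + h)) (fun u => u - x)).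
  - replace (x - x) with 0 by ring; exact D.
  - auto_derive; [trivial|ring]. }
split.
- replace (RInt _ 0 PI) with (RInt (fun t => (pencil_support K (p, t) + S2 (p, t)) * pencil_support_dir K (dir_plane 1 0) (p, t)) 0 PI).
  + apply (Shift (fun x => energy C (x, snd p))).
    apply (is_derive_ext (fun h => energy C (fst p + h * 1, snd p + h * 0))); [intros h; do 2 f_equal; ring|].
    apply (energy_derivative C K HK S2 HS2 p 1 0 Hp).
  + apply RInt_ext; intros t _; rewrite (rho_eq C K HK S2 HS2 p t Hp); f_equal; symmetry.
    apply is_derive_unique, (Shift (fun x => q C (x, snd p) t)).
    apply (is_derive_ext (fun h => q C (fst p + h * 1, snd p + h * 0) t)); [intros h; do 2 f_equal; ring|apply DS].
- replace (RInt _ 0 PI) with (RInt (fun t => (pencil_support K (p, t) + S2 (p, t)) * pencil_support_dir K (dir_plane 0 1) (p, t)) 0 PI).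
  + apply (Shift (fun y => energy C (fst p, y))).
    apply (is_derive_ext (fun h => energy C (fst p + h * 0, snd p + h * 1))); [intros h; do 2 f_equal; ring|].
    apply (energy_derivative C K HK S2 HS2 p 0 1 Hp).
  + apply RInt_ext; intros t _; rewrite (rho_eq C K HK S2 HS2 p t Hp); f_equal; symmetry.
    apply is_derive_unique, (Shift (fun y => q C (fst p, y) t)).
    apply (is_derive_ext (fun h => q C (fst p + h * 0, snd p + h * 1) t)); [intros h; do 2 f_equal; ring|apply DS].
Qed.

Lemma int_oval_open p : int_oval C p -> locally p (int_oval C).
Proof.
destruct (exists_turning_curve C) as [K HK]; rewrite (int_oval_iff C K HK p).
intros Hp; apply (locally_imp p (inside K)); [intros z; apply (int_oval_iff C K HK)|apply inside_open, Hp].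
Qed.

Lemma int_oval_closure p : int_oval C p -> closure (int_oval C) p.
Proof. intros Hp eps; exists p; split; [exact Hp|apply ball_center]. Qed.

(** The energy vanishes off the interior, and it is positive somewhere inside. *)
Lemma maximizer_interior p : ~ centrally_symmetric C -> C_ART C p -> int_oval C p.
Proof.
intros NS [_ Hmax].
destruct (exists_turning_curve C) as [K HK]; destruct (C1_pencil_support_dir K dir_angle) as [S2 HS2].
destruct (exists_positive_energy C K HK S2 HS2 NS) as (O & HO & PO).
apply (int_oval_iff C K HK) in HO.
specialize (Hmax O (int_oval_closure O HO)).
unfold energy at 2 in Hmax; destruct (excluded_middle_informative (int_oval C p)) as [h|h]; [exact h|lra].
Qed.

End Main.

Theorem proposition4p12 (C : oval) :
  (forall p : pt, int_oval C p ->
     is_derive (fun x => energy C (x, snd p)) (fst p)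
       (- RInt (fun theta => rho C p theta * q_1 C p theta) 0 PI) /\
     is_derive (fun y => energy C (fst p, y)) (snd p)
       (- RInt (fun theta => rho C p theta * q_2 C p theta) 0 PI)) /\
  (~ centrally_symmetric C ->
   forall p : pt, C_ART C p ->
     int_oval C p /\
     RInt (fun theta => rho C p theta * q_1 C p theta) 0 PI = 0 /\
     RInt (fun theta => rho C p theta * q_2 C p theta) 0 PI = 0).
Proof.
split; [apply energy_partials|].
intros NS p Hmax.
assert (Hp := maximizer_interior C p NS Hmax); destruct Hmax as [_ Hmax].
split; [exact Hp|].
destruct (energy_partials C p Hp) as [D1 D2].
destruct (int_oval_open C p Hp) as [d Hd].
split.
- rewrite <- (Ropp_involutive (RInt _ _ _)).
  rewrite (critical_local_max _ _ _ D1); [apply Ropp_0|].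
  exists d; intros x Hx; cbv beta; rewrite <- surjective_pairing.
  apply Hmax, int_oval_closure, Hd; split; [exact Hx|apply ball_center].
- rewrite <- (Ropp_involutive (RInt _ _ _)).
  rewrite (critical_local_max _ _ _ D2); [apply Ropp_0|].
  exists d; intros y Hy; cbv beta; rewrite <- surjective_pairing.
  apply Hmax, int_oval_closure, Hd; split; [apply ball_center|exact Hy].
Qed.
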